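(* In the continuous-time scaled model described in the context, assume $x_0=y_0>0$, $x^N_0+y^N_0=T$ for all $N$ (so $T=2x_0$), and $z^N_0=N^{1/2}(x^N_0-y^N_0)\to z_0\in\mathbb R$. Then the scaled residual time $S_N=N^{1/4}(T-\tau_N)$ converges in distribution as $N\to\infty$ to a random variable $S$ with $P(S>0)=1$, whose law is uniquely determined by $$E[S^q]=\Big(\frac23\Big)^{q/4}\frac{\Gamma(\frac12+\frac q4)}{\Gamma(\frac12)}\,T^{3q/4}\,h_{3q/4}\Big(\frac{z_0^2}{2T}\Big),\qquad q>0,$$ where $h_\rho(x)=M\big(-\tfrac{\rho}{3},\tfrac12,-3x\big)$.
   Context: Continuous-time model: $(X_t,Y_t)_{t\ge0}$ is a pure-jump Markov process with nonnegative integer values. Jumps occur at the times of a rate-one Poisson process $(\mathcal N_t)$. At a jump time $t'$, with $q=X_{t'-}/(X_{t'-}+Y_{t'-})$: with probability $q$, $Y$ decreases by $1$; with probability $1-q$, $X$ decreases by $1$. The process is stopped when one coordinate reaches $0$. Scaling: $x^N_t=N^{-1}X_{Nt}$, $y^N_t=N^{-1}Y_{Nt}$, with $x^N_0\to x_0$, $y^N_0\to y_0$; $T=x_0+y_0$; the scaled ruin time is $\tau_N=\inf\{t>0: x^N_t\wedge y^N_t=0\}$. $M(a,b,z)=\sum_{n\ge0}\frac{a^{(n)}}{b^{(n)}n!}z^n$ is Kummer's confluent hypergeometric function, with rising factorial $a^{(0)}=1$, $a^{(n)}=\prod_{j=0}^{n-1}(a+j)$. *)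

(* Defs.v *)
From Stdlib Require Import Reals Lra Lia Arith.
Open Scope R_scope.

(* ruinp x y k = probability that, started from (X,Y) = (x,y), the process is
   stopped (one coordinate hits 0) exactly at its k-th jump.  At a jump from
   (x,y) with x,y>0: with prob x/(x+y), Y decreases by 1; with prob y/(x+y),
   X decreases by 1. *)
Fixpoint ruinp (x y : nat) (k : nat) {struct k} : R :=
  match k with
  | O => if orb (Nat.eqb x 0) (Nat.eqb y 0) then 1 else 0
  | S k' =>
      match x, y with
      | S x', S y' =>
          INR x / INR (x + y) * ruinp x y' k'
          + INR y / INR (x + y) * ruinp x' y k'
      | _, _ => 0
      end
  end.

(* gamma_ge k u = P(G_k >= u), where G_k is the time of the k-th jump of a
   rate-one Poisson process (G_0 = 0, G_k ~ Gamma(k,1)). *)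
Definition gamma_ge (k : nat) (u : R) : R :=
  match k with
  | O => if Rle_dec u 0 then 1 else 0
  | S k' => if Rle_dec u 0 then 1
            else exp (- u) * sum_f_R0 (fun j => u ^ j / INR (fact j)) k'
  end.

(* P(tau_N >= t) for the scaled ruin time tau_N = (unscaled ruin time)/N,
   started from (X_0, Y_0) = (x, y).  The number of jumps until ruin is at
   most x + y and is independent of the Poisson clock. *)
Definition tau_ge (N x y : nat) (t : R) : R :=
  sum_f_R0 (fun k => ruinp x y k * gamma_ge k (INR N * t)) (x + y).

(* Distribution function of S_N = N^{1/4} (T - tau_N):
   P(S_N <= s) = P(tau_N >= T - s N^{-1/4}). *)
Definition cdf_S (T : R) (N x y : nat) (s : R) : R :=
  tau_ge N x y (T - s / Rpower (INR N) (1/4)).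

Definition is_cdf (F : R -> R) : Prop :=
  (forall s t, s <= t -> F s <= F t) /\
  (forall s eps, 0 < eps -> exists d, 0 < d /\
      forall t, s <= t < s + d -> Rabs (F t - F s) < eps) /\
  (forall eps, 0 < eps -> exists M, forall t, t <= M -> Rabs (F t) < eps) /\
  (forall eps, 0 < eps -> exists M, forall t, M <= t -> Rabs (F t - 1) < eps).

Definition ImproperInt0inf (f : R -> R) (l : R) : Prop :=
  forall eps, 0 < eps -> exists d M, 0 < d /\ 0 < M /\
    forall a b, 0 < a < d -> M < b ->
      exists pr : Riemann_integrable f a b, Rabs (RiemannInt pr - l) < eps.

Definition IsGamma (a g : R) : Prop :=
  ImproperInt0inf (fun t => Rpower t (a - 1) * exp (- t)) g.

Fixpoint rising (a : R) (n : nat) : R :=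
  match n with
  | O => 1
  | S n' => rising a n' * (a + INR n')
  end.

Definition IsKummer (a b z v : R) : Prop :=
  infinite_sum (fun n => rising a n / (rising b n * INR (fact n)) * z ^ n) v.

(* E[S^q] = int_0^oo q s^{q-1} P(S > s) ds for a law on [0,oo) with cdf F *)
Definition moment (F : R -> R) (q m : R) : Prop :=
  ImproperInt0inf (fun s => q * Rpower s (q - 1) * (1 - F s)) m.

Definition moment_identity (T z0 : R) (F : R -> R) : Prop :=
  forall q, 0 < q ->
  forall g1 g0 h,
    IsGamma (1/2 + q/4) g1 -> IsGamma (1/2) g0 ->
    IsKummer (- ((3 * q / 4) / 3)) (1/2) (- 3 * (z0 ^ 2 / (2 * T))) h ->
    moment F q (Rpower (2/3) (q/4) * (g1 / g0) * Rpower T (3 * q / 4) * h).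

(* Main.v *)
(** Let [W(x,y) = (x(x+1) - y(y+1))/2] and [V(x,y) = sum_(i<=x) i^2 + sum_(j<=y) j^2].
    A jump changes [W] by [y] (probability [x/(x+y)]) or by [-x] (probability [y/(x+y)])
    and lowers [V] by the square of that change, so [W] is a martingale and
    [Phi((W-c)/sqrt(V+D))], with [Phi] the normal distribution function, is harmonic for
    the chain up to a third-order Taylor remainder: [Phi(w/sqrt t)] solves the heat equation.
    Summing the remainders (Lindeberg's method) and using that at ruin [W = +-r(r+1)/2],
    [r] being the number of survivors, the number [r] of survivors satisfies
    [r^2 / N^(3/2) -> |G|] in law, where [G] is normal with mean [z0 T] and variance [T^3/3].
    The Poisson clock only contributes fluctuations of order [N^(1/2)], negligible against
    [r ~ N^(3/4)], by Chebyshev's inequality.  Hence [S = sqrt |G|].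

    The moments of [S] come from the substitution [t = s^4 / (2 T^3/3)], from term-by-term
    integration of a series of [cosh], and from Kummer's transformation
    [M(a,b,z) = e^z M(b-a,b,-z)].  They determine the law, because their growth allows
    integrating the difference of two candidate tails against every Gamma density, and
    Gamma densities concentrate at any given point. *)

(* The constant [D] is what makes the Lindeberg sum converge. Near ruin [V] is only of order [r^3],
   about [N^(9/4)] against [N^3] at the start, so without [D] the remainders would not be uniformly
   small. Write [m = N^(1/8)] and [D = m^(2a)]. Each of the at most [T m^8] jumps costs about
   [(m^8 / m^a)^3], so the total vanishes when [a > 32/3]; the blur [sqrt D] is invisible against
   [W], of order [m^12], when [a < 12]. The integer [a = 11] gives the [m^22] used throughout.

   [Phi] is both the test function and the limit distribution, so the comparison of the start with
   the ruin states is itself the central limit theorem.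

   The parameters of [G] are read off at the start: [2 W = (X - Y)(X + Y + 1)] is about
   [z0 T N^(3/2)] and [V] about [T^3 N^3 / 12]. At ruin [r^2] is about [2 |W|], whence mean [z0 T]
   and variance [4 T^3 / 12].

   Every jump removes one individual, so ruin with [r] survivors occurs at jump [X + Y - r]. Given
   [r], the event [S <= s] concerns the clock alone, which reduces the limit to an inequality for
   each value of [r]. *)
Require Import Defs.
From Stdlib Require Import Reals Lra Lia Psatz Arith Factorial ClassicalEpsilon.
From Coquelicot Require Import Coquelicot.
Open Scope R_scope.

(** * The jump chain and the Poisson clock *)

(* Mean of [h] at the number of survivors: ruin at the [k]-th jump leaves [x + y - k]. *)
Definition ruin_mean (x y : nat) (h : nat -> R) : R :=
  sum_f_R0 (fun k => ruinp x y k * h (x + y - k)%nat) (x + y).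

Lemma ruinp_ge0 x y k : 0 <= ruinp x y k.
Proof.
revert x y; induction k as [|k IH]; intros x y; simpl.
- destruct orb; lra.
- destruct x as [|x]; [lra|]. destruct y as [|y]; [lra|].
  assert (H : 0 < INR (S x + S y)) by (apply lt_0_INR; lia).
  apply Rplus_le_le_0_compat; apply Rmult_le_pos; try apply IH;
    apply Rmult_le_pos; try apply pos_INR; left; apply Rinv_0_lt_compat; exact H.
Qed.

Lemma ruin_mean_edge x y h :
  (x = 0 \/ y = 0)%nat -> ruin_mean x y h = h (x + y)%nat.
Proof.
intros Hxy; unfold ruin_mean.
assert (H0 : ruinp x y 0 = 1).
{ destruct Hxy; subst; simpl; [reflexivity|]. now rewrite Bool.orb_true_r. }
assert (HS : forall k, ruinp x y (S k) = 0).
{ intros k; destruct Hxy; subst; simpl; [reflexivity|]. now destruct x. }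
assert (H : forall n, sum_f_R0 (fun k => ruinp x y k * h (x + y - k)%nat) n = h (x + y)%nat).
{ induction n as [|n IH].
  - change (ruinp x y 0 * h (x + y - 0)%nat = h (x + y)%nat).
    rewrite H0, Nat.sub_0_r. ring.
  - rewrite tech5, IH, HS. ring. }
apply H.
Qed.

(** Conditioning on the first jump. The argument of [h] needs no shift, because the jump index and
    the total population change by one together. *)
Lemma ruin_mean_step x y h :
  ruin_mean (S x) (S y) h =
  INR (S x) / INR (S x + S y) * ruin_mean (S x) y h
  + INR (S y) / INR (S x + S y) * ruin_mean x (S y) h.
Proof.
unfold ruin_mean.
replace (S x + S y)%nat with (S (S x + y)) at 2 by lia.
rewrite decomp_sum by lia.
replace (ruinp (S x) (S y) 0) with 0 by reflexivity.
rewrite Rmult_0_l, Rplus_0_l. simpl pred.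
replace (x + S y)%nat with (S x + y)%nat by lia.
rewrite !scal_sum, <- plus_sum.
apply sum_eq; intros k Hk.
change (ruinp (S x) (S y) (S k)) with
  (INR (S x) / INR (S x + S y) * ruinp (S x) y k
   + INR (S y) / INR (S x + S y) * ruinp x (S y) k).
replace (S x + S y - S k)%nat with (S x + y - k)%nat by lia.
replace (S (S x + y)) with (S x + S y)%nat by lia.
ring.
Qed.

Lemma step_weights x y :
  INR (S x) / INR (S x + S y) + INR (S y) / INR (S x + S y) = 1 /\
  0 <= INR (S x) / INR (S x + S y) /\ 0 <= INR (S y) / INR (S x + S y).
Proof.
assert (H : 0 < INR (S x + S y)) by (apply lt_0_INR; lia).
repeat split.
- rewrite plus_INR in *. field. lra.
- apply Rmult_le_pos; [apply pos_INR|left; now apply Rinv_0_lt_compat].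
- apply Rmult_le_pos; [apply pos_INR|left; now apply Rinv_0_lt_compat].
Qed.

(** The telescoping half of Lindeberg's method: each jump adds a defect of at most [e], and at most
    [x + y] jumps remain. The defect is controlled only below the total [n], so [e] may depend on
    the starting point; the induction runs on a separate bound [m] while [n] and [e] stay fixed. *)
Lemma ruin_mean_approx (u : nat -> nat -> R) (b : nat -> R) (e : R) (n : nat) :
  (forall x, u x 0%nat = b x) -> (forall y, u 0%nat y = b y) -> 0 <= e ->
  (forall x y, (S x + S y <= n)%nat ->
     Rabs (u (S x) (S y) - (INR (S x) / INR (S x + S y) * u (S x) y
        + INR (S y) / INR (S x + S y) * u x (S y))) <= e) ->
  forall x y, (x + y <= n)%nat ->
    Rabs (u x y - ruin_mean x y b) <= INR (x + y) * e.
Proof.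
intros Hx Hy He Hstep.
assert (H : forall m x y, (x + y <= m)%nat -> (x + y <= n)%nat ->
    Rabs (u x y - ruin_mean x y b) <= INR (x + y) * e).
2: { intros x y; apply (H (x + y)%nat x y); lia. }
induction m as [|m IH]; intros x y Hm Hn.
- rewrite ruin_mean_edge by lia.
  replace x with 0%nat by lia. rewrite Hy, Nat.add_0_l, Rminus_diag, Rabs_R0.
  apply Rmult_le_pos; [apply pos_INR|exact He].
- destruct x as [|x].
  { rewrite ruin_mean_edge by lia. rewrite Hy, Nat.add_0_l, Rminus_diag, Rabs_R0.
    apply Rmult_le_pos; [apply pos_INR|exact He]. }
  destruct y as [|y].
  { rewrite ruin_mean_edge by lia. rewrite Hx, Nat.add_0_r, Rminus_diag, Rabs_R0.
    apply Rmult_le_pos; [apply pos_INR|exact He]. }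
  rewrite ruin_mean_step.
  assert (H1 := IH (S x) y ltac:(lia) ltac:(lia)).
  assert (H2 := IH x (S y) ltac:(lia) ltac:(lia)).
  assert (H3 := Hstep x y Hn).
  replace (x + S y)%nat with (S x + y)%nat in H2 by lia.
  replace (INR (S x + S y) * e) with (INR (S x + y) * e + e)
    by (replace (S x + S y)%nat with (S (S x + y)) by lia; rewrite (S_INR (S x + y)); ring).
  destruct (step_weights x y) as [Hpq [Hp Hq]].
  set (p := INR (S x) / INR (S x + S y)) in *.
  set (q := INR (S y) / INR (S x + S y)) in *.
  set (E := INR (S x + y) * e) in *.
  apply Rabs_le_between in H1, H2, H3. apply Rabs_le. nra.
Qed.

Lemma ruin_mean_le x y h1 h2 :
  (forall r, (r <= x + y)%nat -> h1 r <= h2 r) -> ruin_mean x y h1 <= ruin_mean x y h2.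
Proof.
intros H; apply sum_Rle; intros k _.
apply Rmult_le_compat_l; [apply ruinp_ge0|apply H; lia].
Qed.

(** This expresses that ruin is certain within [x + y] jumps. Constants are exactly harmonic, so the
    previous comparison applies with [e = 0]. *)
Lemma ruin_mean_const x y c : ruin_mean x y (fun _ => c) = c.
Proof.
assert (H := ruin_mean_approx (fun _ _ => c) (fun _ => c) 0 (x + y)%nat
  (fun _ => eq_refl) (fun _ => eq_refl) (Rle_refl 0)).
assert (H' : Rabs (c - ruin_mean x y (fun _ => c)) <= INR (x + y) * 0).
{ apply H; [|lia]. intros a b _. destruct (step_weights a b) as [Hpq _].
  rewrite <- Rmult_plus_distr_r, Hpq. right. rewrite <- Rabs_R0. f_equal. ring. }
rewrite Rmult_0_r in H'. apply Rabs_le_between in H'. lra.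
Qed.

Lemma ruin_mean_plus x y h1 h2 :
  ruin_mean x y (fun r => h1 r + h2 r) = ruin_mean x y h1 + ruin_mean x y h2.
Proof.
unfold ruin_mean. rewrite <- plus_sum. apply sum_eq; intros; ring.
Qed.

Lemma tau_ge_ruin_mean N x y t :
  tau_ge N x y t = ruin_mean x y (fun r => gamma_ge (x + y - r) (INR N * t)).
Proof.
apply sum_eq; intros k Hk. do 2 f_equal. lia.
Qed.

(** * Chebyshev's inequality for the Poisson clock *)

Lemma exp_infinite_sum u : infinite_sum (fun j => u ^ j / INR (fact j)) (exp u).
Proof.
apply is_series_Reals. eapply is_series_ext; [|exact (is_exp_Reals u)].
intros k; unfold scal; simpl; unfold mult; simpl. rewrite pow_n_pow. reflexivity.
Qed.

Lemma exp_partial_le u n : 0 <= u -> sum_f_R0 (fun j => u ^ j / INR (fact j)) n <= exp u.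
Proof.
intros Hu. apply (sum_incr (fun j => u ^ j / INR (fact j))); [apply exp_infinite_sum|].
intros k; apply Rmult_le_pos; [now apply pow_le|].
left; apply Rinv_0_lt_compat, INR_fact_lt_0.
Qed.

(** The truncated variance of a Poisson variable in closed form, up to the factor [exp (- u)]. The
    boundary term has a favourable sign as soon as [n + 1 >= u], which yields the variance bound
    from finite sums only. *)
Lemma poisson_second_moment_partial u n :
  sum_f_R0 (fun j => (INR j - u) ^ 2 * (u ^ j / INR (fact j))) n =
  u * sum_f_R0 (fun j => u ^ j / INR (fact j)) n
  - u * (u ^ n / INR (fact n)) * (INR n + 1 - u).
Proof.
induction n as [|n IH].
- simpl. field.
- rewrite !tech5, IH, fact_simpl, mult_INR, S_INR. simpl pow.
  assert (H := INR_fact_neq_0 n). assert (H' := pos_INR n).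
  field. split; [exact H|lra].
Qed.

Lemma poisson_second_moment_le u n : 0 <= u ->
  sum_f_R0 (fun j => (INR j - u) ^ 2 * (u ^ j / INR (fact j))) n <= u * exp u.
Proof.
intros Hu.
assert (Ht : forall j, 0 <= u ^ j / INR (fact j)).
{ intros k; apply Rmult_le_pos; [now apply pow_le|].
  left; apply Rinv_0_lt_compat, INR_fact_lt_0. }
(* Lengthening the sum past [u] only increases it and makes the boundary term of the closed form
   nonpositive. *)
destruct (INR_unbounded u) as [M HM].
apply Rle_trans with
  (sum_f_R0 (fun j => (INR j - u) ^ 2 * (u ^ j / INR (fact j))) (n + M)).
- clear HM. induction M as [|M IH].
  + rewrite Nat.add_0_r; lra.
  + rewrite Nat.add_succ_r, tech5.
    assert (0 <= (INR (S (n + M)) - u) ^ 2 * (u ^ S (n + M) / INR (fact (S (n + M)))))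
      by (apply Rmult_le_pos; [apply pow2_ge_0|apply Ht]).
    lra.
- rewrite poisson_second_moment_partial.
  assert (H1 := exp_partial_le u (n + M) Hu).
  assert (H2 := Ht (n + M)%nat).
  assert (H3 : 0 <= INR (n + M) + 1 - u) by (rewrite plus_INR; assert (H := pos_INR n); lra).
  assert (0 <= u * (u ^ (n + M) / INR (fact (n + M))) * (INR (n + M) + 1 - u)).
  { apply Rmult_le_pos; [apply Rmult_le_pos; assumption|assumption]. }
  nra.
Qed.

Lemma gamma_ge_pos_succ k u : 0 < u ->
  gamma_ge (S k) u = exp (- u) * sum_f_R0 (fun j => u ^ j / INR (fact j)) k.
Proof.
intros Hu; simpl. destruct (Rle_dec u 0); [lra|reflexivity].
Qed.

Lemma gamma_ge_bounds k u : 0 <= gamma_ge k u <= 1.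
Proof.
destruct k as [|k].
- simpl. destruct Rle_dec; lra.
- destruct (Rle_dec u 0) as [H|H].
  + simpl. destruct (Rle_dec u 0); lra.
  + rewrite gamma_ge_pos_succ by lra. split.
    * apply Rmult_le_pos; [left; apply exp_pos|]. apply cond_pos_sum; intros j.
      apply Rmult_le_pos; [apply pow_le; lra|].
      left; apply Rinv_0_lt_compat, INR_fact_lt_0.
    * apply Rle_trans with (exp (- u) * exp u).
      { apply Rmult_le_compat_l; [left; apply exp_pos|apply exp_partial_le; lra]. }
      rewrite <- exp_plus, Rplus_opp_l, exp_0; lra.
Qed.

(** The [k]-th jump comes after time [u] when fewer than [k] jumps occur before [u]; this forces a
    Poisson variable of mean and variance [u] to lie at least [d] below its mean. *)
Lemma gamma_ge_small k u d :
  0 < u -> 0 < d -> INR k <= u - d -> gamma_ge k u <= u / d ^ 2.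
Proof.
intros Hu Hd Hk.
assert (Hd2 : 0 < d ^ 2) by (apply pow_lt; lra).
destruct k as [|k].
- simpl. destruct Rle_dec; [lra|].
  apply Rmult_le_pos; [lra|]. left; apply Rinv_0_lt_compat. simpl in Hd2. exact Hd2.
- rewrite gamma_ge_pos_succ by lra.
  assert (H := poisson_second_moment_le u k ltac:(lra)).
  assert (H1 : d ^ 2 * sum_f_R0 (fun j => u ^ j / INR (fact j)) k
     <= sum_f_R0 (fun j => (INR j - u) ^ 2 * (u ^ j / INR (fact j))) k).
  { rewrite scal_sum. apply sum_Rle. intros j Hj.
    rewrite Rmult_comm. apply Rmult_le_compat_r.
    - apply Rmult_le_pos; [apply pow_le; lra|].
      left; apply Rinv_0_lt_compat, INR_fact_lt_0.
    - assert (INR j <= INR (S k)) by (apply le_INR; lia). nra. }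
  apply Rmult_le_reg_l with (d ^ 2); [exact Hd2|].
  replace (d ^ 2 * (u / d ^ 2)) with (exp (- u) * (u * exp u)).
  2: { rewrite exp_Ropp. field. split; [lra|]. apply Rgt_not_eq, exp_pos. }
  assert (He := exp_pos (- u)). nra.
Qed.

Lemma gamma_ge_large k u d :
  0 < u -> 0 < d -> u + d <= INR k -> 1 - gamma_ge k u <= u / d ^ 2.
Proof.
intros Hu Hd Hk.
assert (Hd2 : 0 < d ^ 2) by (apply pow_lt; lra).
destruct k as [|k]; [simpl in Hk; lra|].
rewrite gamma_ge_pos_succ by lra.
set (a := fun j => u ^ j / INR (fact j)).
(* The upper tail is an infinite series: its finite pieces are bounded uniformly in [n] here, and
   [HL] passes to the limit. *)
assert (Hn : forall n, d ^ 2 * (sum_f_R0 a (S k + n) - sum_f_R0 a k) <= u * exp u).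
{ intros n. rewrite tech2 with (m := k) by lia.
  replace (sum_f_R0 a k + sum_f_R0 (fun i => a (S k + i)%nat) (S k + n - S k) - sum_f_R0 a k)
    with (sum_f_R0 (fun i => a (S k + i)%nat) (S k + n - S k)) by ring.
  assert (H := poisson_second_moment_le u (S k + n) ltac:(lra)).
  rewrite tech2 with (m := k) in H by lia.
  assert (H1 : 0 <= sum_f_R0 (fun j => (INR j - u) ^ 2 * (u ^ j / INR (fact j))) k).
  { apply cond_pos_sum; intros j. apply Rmult_le_pos; [apply pow2_ge_0|].
    apply Rmult_le_pos; [apply pow_le; lra|].
    left; apply Rinv_0_lt_compat, INR_fact_lt_0. }
  match type of H with _ + ?B <= _ =>
    apply Rle_trans with B; [|lra] end.
  rewrite scal_sum. apply sum_Rle. intros j _. unfold a.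
  rewrite Rmult_comm. apply Rmult_le_compat_r.
  - apply Rmult_le_pos; [apply pow_le; lra|].
    left; apply Rinv_0_lt_compat, INR_fact_lt_0.
  - assert (INR (S k) <= INR (S k + j)) by (apply le_INR; lia). nra. }
assert (HL : d ^ 2 * (exp u - sum_f_R0 a k) <= u * exp u).
{ assert (Hlim := exp_infinite_sum u). fold a in Hlim.
  apply Rnot_lt_le; intros Hlt.
  set (e := (d ^ 2 * (exp u - sum_f_R0 a k) - u * exp u) / d ^ 2).
  assert (He : 0 < e) by (apply Rdiv_lt_0_compat; lra).
  destruct (Hlim e He) as [M HM].
  specialize (HM (S k + M)%nat ltac:(lia)). specialize (Hn M).
  unfold Rdist in HM. apply Rabs_def2 in HM.
  assert (Heq : d ^ 2 * e = d ^ 2 * (exp u - sum_f_R0 a k) - u * exp u)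
    by (unfold e; field; lra).
  nra. }
apply Rmult_le_reg_l with (d ^ 2); [exact Hd2|].
replace (d ^ 2 * (u / d ^ 2)) with (exp (- u) * (u * exp u)).
2: { rewrite exp_Ropp. field. split; [lra|]. apply Rgt_not_eq, exp_pos. }
assert (He := exp_pos (- u)).
assert (Hee : exp (- u) * exp u = 1) by (rewrite <- exp_plus, Rplus_opp_l, exp_0; lra).
replace (1 - exp (- u) * sum_f_R0 a k) with (exp (- u) * (exp u - sum_f_R0 a k))
  by (rewrite <- Hee; ring).
nra.
Qed.

(** * Improper integrals and the Gamma function *)

Definition locally_integrable (f : R -> R) : Prop :=
  forall a b, 0 < a -> a <= b -> ex_RInt f a b.

(* For a nonnegative integrand, the improper integral is the supremum of the proper ones. *)
Definition sup_integral (f : R -> R) (l : R) : Prop :=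
  (forall a b, 0 < a -> a <= b -> RInt f a b <= l) /\
  (forall eps, 0 < eps -> exists a b, 0 < a /\ a <= b /\ l - eps < RInt f a b).

Lemma ImproperInt0inf_RInt f l : ImproperInt0inf f l <->
  (forall eps, 0 < eps -> exists d M, 0 < d /\ 0 < M /\
     forall a b, 0 < a < d -> M < b -> ex_RInt f a b /\ Rabs (RInt f a b - l) < eps).
Proof.
split; intros H eps Heps; destruct (H eps Heps) as (d & M & Hd & HM & K);
  exists d, M; (split; [exact Hd|]); (split; [exact HM|]);
  intros a b Ha Hb; specialize (K a b Ha Hb).
- destruct K as [pr K]. split; [now apply ex_RInt_Reals_1|].
  now rewrite (RInt_Reals _ _ _ pr).
- destruct K as [pr K]. exists (ex_RInt_Reals_0 _ _ _ pr).
  now rewrite <- RInt_Reals.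
Qed.

Lemma ImproperInt0inf_ext f g l :
  (forall t, 0 < t -> f t = g t) -> ImproperInt0inf f l -> ImproperInt0inf g l.
Proof.
rewrite !ImproperInt0inf_RInt. intros E H eps Heps.
destruct (H eps Heps) as (d & M & Hd & HM & K).
exists (Rmin d M), M. split; [now apply Rmin_glb_lt|]. split; [exact HM|].
intros a b Ha Hb. assert (L1 := Rmin_l d M). assert (L2 := Rmin_r d M).
destruct (K a b ltac:(lra) Hb) as [K1 K2].
assert (E' : forall x, Rmin a b < x < Rmax a b -> f x = g x).
{ intros x Hx. rewrite Rmin_left in Hx by lra. apply E; lra. }
split; [now apply ex_RInt_ext with f|]. now rewrite <- (RInt_ext f g).
Qed.

Lemma RInt_split f a b c : ex_RInt f a b -> ex_RInt f b c ->
  RInt f a c = RInt f a b + RInt f b c.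
Proof. intros H1 H2. symmetry. exact (RInt_Chasles f a b c H1 H2). Qed.

Lemma RInt_mono_interval f a b c d :
  locally_integrable f -> (forall t, 0 < t -> 0 <= f t) ->
  0 < a -> a <= b -> b <= c -> c <= d -> RInt f b c <= RInt f a d.
Proof.
intros Hi Hp Ha Hab Hbc Hcd.
rewrite (RInt_split f a b d) by (apply Hi; lra).
rewrite (RInt_split f b c d) by (apply Hi; lra).
assert (0 <= RInt f a b) by (apply RInt_ge_0; [lra|apply Hi; lra|intros; apply Hp; lra]).
assert (0 <= RInt f c d) by (apply RInt_ge_0; [lra|apply Hi; lra|intros; apply Hp; lra]).
lra.
Qed.

Lemma sup_integral_ImproperInt0inf f l :
  locally_integrable f -> (forall t, 0 < t -> 0 <= f t) ->
  ImproperInt0inf f l <-> sup_integral f l.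
Proof.
intros Hi Hp. rewrite ImproperInt0inf_RInt. split.
- intros H; split.
  + intros a b Ha Hab. apply Rnot_lt_le; intros Hlt.
    destruct (H (RInt f a b - l)) as (d & M & Hd & HM & K); [lra|].
    assert (L1 := Rmin_l a d). assert (L2 := Rmin_r a d).
    assert (L0 : 0 < Rmin a d) by (apply Rmin_glb_lt; lra).
    assert (L3 := Rmax_l b M). assert (L4 := Rmax_r b M).
    destruct (K (Rmin a d / 2) (Rmax b M + 1)) as [_ A]; [lra..|].
    assert (B := RInt_mono_interval f (Rmin a d / 2) a b (Rmax b M + 1) Hi Hp
      ltac:(lra) ltac:(lra) ltac:(lra) ltac:(lra)).
    apply Rabs_lt_between in A. lra.
  + intros eps Heps. destruct (H eps Heps) as (d & M & Hd & HM & K).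
    assert (L3 := Rmax_l d M). assert (L4 := Rmax_r d M).
    destruct (K (d / 2) (Rmax d M + 1)) as [_ A]; [lra..|].
    exists (d / 2), (Rmax d M + 1). apply Rabs_lt_between in A. lra.
- intros [H1 H2] eps Heps. destruct (H2 eps Heps) as (a & b & Ha & Hab & K).
  exists a, b. split; [exact Ha|]. split; [lra|]. intros a0 b0 Ha0 Hb0. split.
  + apply Hi; lra.
  + assert (B := RInt_mono_interval f a0 a b b0 Hi Hp
      ltac:(lra) ltac:(lra) ltac:(lra) ltac:(lra)).
    assert (C := H1 a0 b0 ltac:(lra) ltac:(lra)).
    apply Rabs_lt_between. lra.
Qed.

Lemma sup_integral_exists f K :
  (forall a b, 0 < a -> a <= b -> RInt f a b <= K) -> exists l, sup_integral f l.
Proof.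
intros H.
destruct (completeness (fun x => exists a b, 0 < a /\ a <= b /\ x = RInt f a b)) as [l [U L]].
- exists K. intros x (a & b & Ha & Hab & ->). now apply H.
- exists (RInt f 1 1), 1, 1. lra.
- exists l. split.
  + intros a b Ha Hab. apply U. now exists a, b.
  + intros eps Heps. apply Classical_Prop.NNPP; intros C.
    assert (B : l <= l - eps).
    { apply L. intros x (a & b & Ha & Hab & ->).
      apply Rnot_lt_le; intros Hlt. apply C. now exists a, b. }
    lra.
Qed.

Lemma continuous_locally_integrable f :
  (forall t, 0 < t -> continuous f t) -> locally_integrable f.
Proof.
intros H a b Ha Hab. apply (ex_RInt_continuous (V := R_CompleteNormedModule)). intros z Hz.
rewrite Rmin_left in Hz by lra. apply H; lra.
Qed.

Lemma RInt_derive f df a b : 0 < a -> a <= b ->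
  (forall t, 0 < t -> is_derive f t (df t)) -> (forall t, 0 < t -> continuous df t) ->
  RInt df a b = f b - f a.
Proof.
intros Ha Hab H1 H2. apply is_RInt_unique, (is_RInt_derive f df);
  intros x Hx; rewrite Rmin_left in Hx by lra; [apply H1|apply H2]; lra.
Qed.

(** Integration by parts reduced to its boundary function: two integrands differing by the
    derivative of some [B] that vanishes at both ends have the same integral. It gives the
    recurrence of the Gamma function and the passage from tails to densities in the moments. *)
Lemma ImproperInt0inf_parts f g B l :
  (forall t, 0 < t -> continuous f t) -> (forall t, 0 < t -> continuous g t) ->
  (forall t, 0 < t -> is_derive B t (g t - f t)) ->
  (forall eps, 0 < eps -> exists d, 0 < d /\ forall t, 0 < t < d -> Rabs (B t) < eps) ->
  (forall eps, 0 < eps -> exists M, 0 < M /\ forall t, M < t -> Rabs (B t) < eps) ->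
  ImproperInt0inf f l -> ImproperInt0inf g l.
Proof.
intros Cf Cg HB B0 Binf. rewrite !ImproperInt0inf_RInt. intros H eps Heps.
destruct (H (eps / 3)) as (d & M & Hd & HM & K); [lra|].
destruct (B0 (eps / 3)) as (d' & Hd' & K0); [lra|].
destruct (Binf (eps / 3)) as (M' & HM' & Ki); [lra|].
assert (L1 := Rmin_l d d'). assert (L2 := Rmin_r d d').
assert (L3 := Rmax_l M M'). assert (L4 := Rmax_r M M').
assert (L5 := Rmin_l (Rmin d d') M). assert (L6 := Rmin_r (Rmin d d') M).
exists (Rmin (Rmin d d') M), (Rmax M M').
split; [repeat apply Rmin_glb_lt; lra|]. split; [lra|].
intros a b Ha Hb.
destruct (K a b) as [Kf1 Kf2]; [lra..|].
assert (Kg : ex_RInt g a b) by (apply continuous_locally_integrable; trivial; lra).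
split; [exact Kg|].
assert (E : RInt (fun t => g t - f t) a b = B b - B a).
{ apply RInt_derive; trivial; try lra. intros t Ht.
  apply (continuous_minus (V := R_NormedModule)); auto. }
assert (E' : RInt (fun t => g t - f t) a b = RInt g a b - RInt f a b)
  by exact (RInt_minus g f a b Kg Kf1).
assert (K1 := K0 a ltac:(lra)). assert (K2 := Ki b ltac:(lra)).
apply Rabs_lt_between in Kf2, K1, K2. apply Rabs_lt_between. lra.
Qed.

Lemma ImproperInt0inf_scal f l c :
  ImproperInt0inf f l -> ImproperInt0inf (fun t => c * f t) (c * l).
Proof.
rewrite !ImproperInt0inf_RInt. intros H eps Heps.
assert (Hc : 0 < Rabs c + 1) by (assert (H0 := Rabs_pos c); lra).
destruct (H (eps / (Rabs c + 1))) as (d & M & Hd & HM & K).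
{ now apply Rdiv_lt_0_compat. }
exists d, M. split; [exact Hd|]. split; [exact HM|].
intros a b Ha Hb. destruct (K a b Ha Hb) as [K1 K2]. split.
- exact (ex_RInt_scal f a b c K1).
- replace (RInt (fun t => c * f t) a b) with (c * RInt f a b)
    by (symmetry; exact (RInt_scal f a b c K1)).
  rewrite <- Rmult_minus_distr_l, Rabs_mult.
  assert (E : eps = (Rabs c + 1) * (eps / (Rabs c + 1))) by (field; lra).
  assert (0 <= Rabs (RInt f a b - l)) by apply Rabs_pos.
  assert (0 <= Rabs c) by apply Rabs_pos.
  set (e := eps / (Rabs c + 1)) in *. rewrite E. nra.
Qed.

Lemma ImproperInt0inf_plus f g l m :
  ImproperInt0inf f l -> ImproperInt0inf g m ->
  ImproperInt0inf (fun t => f t + g t) (l + m).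
Proof.
rewrite !ImproperInt0inf_RInt. intros H H' eps Heps.
destruct (H (eps / 2)) as (d & M & Hd & HM & K); [lra|].
destruct (H' (eps / 2)) as (d' & M' & Hd' & HM' & K'); [lra|].
assert (L1 := Rmin_l d d'). assert (L2 := Rmin_r d d').
assert (L3 := Rmax_l M M'). assert (L4 := Rmax_r M M').
exists (Rmin d d'), (Rmax M M').
split; [apply Rmin_glb_lt; lra|]. split; [lra|].
intros a b Ha Hb.
destruct (K a b) as [K1 K2]; [lra..|].
destruct (K' a b) as [K1' K2']; [lra..|].
split; [exact (ex_RInt_plus f g a b K1 K1')|].
replace (RInt (fun t => f t + g t) a b) with (RInt f a b + RInt g a b)
  by (symmetry; exact (RInt_plus f g a b K1 K1')).
apply Rabs_lt_between in K2, K2'. apply Rabs_lt_between. lra.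
Qed.

(** * Real powers and Euler's integral *)

Lemma Rpower_is_derive p t : 0 < t ->
  is_derive (fun t => Rpower t p) t (p * Rpower t (p - 1)).
Proof.
intros Ht. apply is_derive_Reals. now apply derivable_pt_lim_power.
Qed.

Lemma Rpower_continuous p t : 0 < t -> continuous (fun t => Rpower t p) t.
Proof.
intros Ht. apply (ex_derive_continuous (V := R_NormedModule)).
eexists. now apply Rpower_is_derive.
Qed.

Lemma Rpower_pos x p : 0 < Rpower x p.
Proof. apply exp_pos. Qed.

Lemma ln_le_minus1 x : 0 < x -> ln x <= x - 1.
Proof.
intros Hx. assert (H := exp_ineq1_le (ln x)). rewrite exp_ln in H by exact Hx. lra.
Qed.

Lemma Rpower_le_exp p : 0 < p ->
  exists K, 0 < K /\ forall t, 0 < t -> Rpower t p <= K * exp t.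
Proof.
(* The constant is [p^p]; it comes from [ln (t/p) <= t/p - 1] multiplied by [p]. *)
intros Hp. exists (exp (p * ln p)). split; [apply exp_pos|]. intros t Ht.
rewrite <- exp_plus. unfold Rpower.
assert (H := ln_le_minus1 (t / p) ltac:(now apply Rdiv_lt_0_compat)).
assert (E : ln t = ln (t / p) + ln p).
{ rewrite <- ln_mult; [f_equal; field; lra| now apply Rdiv_lt_0_compat|lra]. }
assert (E2 : p * (t / p) = t) by (field; lra).
destruct (Rle_lt_or_eq_dec (p * ln t) (p * ln p + t)) as [L|L].
- rewrite E. nra.
- left; now apply exp_increasing.
- right; now rewrite L.
Qed.

Lemma Rpower_small p eps : 0 < p -> 0 < eps ->
  exists d, 0 < d /\ forall t, 0 < t < d -> Rpower t p < eps.
Proof.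
intros Hp Heps. exists (Rpower eps (/ p)). split; [apply Rpower_pos|].
intros t Ht. replace eps with (Rpower (Rpower eps (/ p)) p).
- apply Rlt_Rpower_l; lra.
- rewrite Rpower_mult, Rinv_l, Rpower_1; lra.
Qed.

Definition gamma_integrand (a t : R) : R := Rpower t (a - 1) * exp (- t).

Lemma gamma_integrand_continuous a t : 0 < t -> continuous (gamma_integrand a) t.
Proof.
intros Ht. apply (continuous_mult (K := R_AbsRing)); [now apply Rpower_continuous|].
apply (ex_derive_continuous (V := R_NormedModule)). auto_derive. trivial.
Qed.

Lemma gamma_integrand_pos a t : 0 < gamma_integrand a t.
Proof. apply Rmult_lt_0_compat; apply exp_pos. Qed.

Lemma IsGamma_sup_integral a g : IsGamma a g <-> sup_integral (gamma_integrand a) g.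
Proof.
apply sup_integral_ImproperInt0inf.
- apply continuous_locally_integrable, gamma_integrand_continuous.
- intros t _; left; apply gamma_integrand_pos.
Qed.

(* The integrand is dominated by the derivative of the bounded function t^a / (1 + t^a). *)
Lemma IsGamma_exists a : 0 < a -> exists g, IsGamma a g.
Proof.
intros Ha.
destruct (Rpower_le_exp a Ha) as (K1 & HK1 & B1).
destruct (Rpower_le_exp (2 * a) ltac:(lra)) as (K2 & HK2 & B2).
(* Domination amounts to [(1 + t^a)^2 <= (1 + 2 K1 + K2) e^t], obtained by expanding the square;
   dividing by [a] cancels the factor [a] in [df]. *)
set (K := (1 + 2 * K1 + K2) / a).
assert (HK : 0 < K) by (apply Rdiv_lt_0_compat; lra).
set (f := fun t => K * (Rpower t a / (1 + Rpower t a))).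
set (df := fun t => K * (a * Rpower t (a - 1) / (1 + Rpower t a) ^ 2)).
assert (Hne : forall t, 1 + Rpower t a <> 0).
{ intros t. assert (H := Rpower_pos t a). lra. }
assert (Hc : forall t, 0 < t -> continuous df t).
{ intros t Ht. unfold df.
  apply (continuous_mult (K := R_AbsRing)); [apply continuous_const|].
  apply (continuous_mult (K := R_AbsRing)).
  - apply (continuous_mult (K := R_AbsRing)); [apply continuous_const|].
    now apply Rpower_continuous.
  - apply continuous_comp with (f := fun t => Rpower t a) (g := fun y => / (1 + y) ^ 2).
    + now apply Rpower_continuous.
    + apply (ex_derive_continuous (V := R_NormedModule)). auto_derive.
      rewrite Rmult_1_r.
      apply Rmult_integral_contrapositive_currified; apply Hne. }
destruct (sup_integral_exists (gamma_integrand a) K) as [g Hg].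
- intros x y Hx Hxy. apply Rle_trans with (RInt df x y).
  + apply RInt_le; trivial.
    * apply continuous_locally_integrable; trivial. apply gamma_integrand_continuous.
    * now apply continuous_locally_integrable.
    * intros t Ht. assert (H1 := B1 t ltac:(lra)). assert (H2 := B2 t ltac:(lra)).
      assert (E2 : Rpower t (2 * a) = Rpower t a ^ 2).
      { replace (2 * a) with (a + a) by ring. rewrite Rpower_plus. ring. }
      rewrite E2 in H2.
      assert (He := exp_pos t).
      assert (He1 : 1 <= exp t) by (assert (H := exp_ineq1_le t); lra).
      assert (Hp := Rpower_pos t a). assert (Hq := Rpower_pos t (a - 1)).
      unfold gamma_integrand, df, K. rewrite exp_Ropp.
      set (p := Rpower t a) in *. set (q := Rpower t (a - 1)) in *. set (e := exp t) in *.
      replace ((1 + 2 * K1 + K2) / a * (a * q / (1 + p) ^ 2))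
        with (q * ((1 + 2 * K1 + K2) / (1 + p) ^ 2)) by (field; split; lra).
      apply Rmult_le_compat_l; [lra|].
      apply Rmult_le_reg_l with (e * (1 + p) ^ 2).
      { apply Rmult_lt_0_compat; [lra|]. apply pow_lt; lra. }
      replace (e * (1 + p) ^ 2 * / e) with ((1 + p) ^ 2) by (field; lra).
      replace (e * (1 + p) ^ 2 * ((1 + 2 * K1 + K2) / (1 + p) ^ 2))
        with ((1 + 2 * K1 + K2) * e) by (field; lra).
      nra.
  + rewrite (RInt_derive f df); trivial.
    * unfold f. assert (H1 := Rpower_pos x a). assert (H2 := Rpower_pos y a).
      assert (0 <= Rpower x a / (1 + Rpower x a)).
      { apply Rmult_le_pos; [lra|]. left; apply Rinv_0_lt_compat; lra. }
      assert (Rpower y a / (1 + Rpower y a) <= 1).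
      { apply Rmult_le_reg_r with (1 + Rpower y a); [lra|]. field_simplify; lra. }
      nra.
    * intros t Ht. unfold f, df.
      evar_last.
      { apply (is_derive_scal (fun t => Rpower t a / (1 + Rpower t a))).
        apply (is_derive_div (fun t => Rpower t a) (fun t => 1 + Rpower t a)).
        - now apply Rpower_is_derive.
        - apply (is_derive_plus (V := R_NormedModule) (fun _ => 1) (fun t => Rpower t a)).
          + apply (is_derive_const (V := R_NormedModule)).
          + now apply Rpower_is_derive.
        - apply Hne. }
      unfold plus, zero, scal; simpl; unfold mult; simpl. field. apply Hne.
- exists g. now apply IsGamma_sup_integral.
Qed.

Lemma IsGamma_succ a g : 0 < a -> IsGamma a g -> IsGamma (a + 1) (a * g).
Proof.
intros Ha Hg.
destruct (Rpower_le_exp (a + 1) ltac:(lra)) as (K & HK & BK).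
apply (ImproperInt0inf_parts (fun t => a * gamma_integrand a t) _
   (fun t => - (Rpower t a * exp (- t)))).
- intros t Ht. apply (continuous_mult (K := R_AbsRing)); [apply continuous_const|].
  now apply gamma_integrand_continuous.
- intros t Ht. now apply gamma_integrand_continuous.
- intros t Ht. evar_last.
  { apply (is_derive_opp (V := R_NormedModule)).
    apply (is_derive_mult (fun t => Rpower t a) (fun t => exp (- t))).
    - now apply Rpower_is_derive.
    - auto_derive; [trivial|reflexivity].
    - intros; apply Rmult_comm. }
  unfold gamma_integrand, opp, plus, mult; simpl.
  replace (a + 1 - 1) with a by ring. ring.
- intros eps Heps. destruct (Rpower_small a eps Ha Heps) as (d & Hd & K').
  exists d. split; trivial. intros t Ht. rewrite Rabs_Ropp, Rabs_pos_eq.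
  + assert (H := K' t Ht). assert (exp (- t) <= 1).
    { rewrite <- exp_0. left; apply exp_increasing; lra. }
    assert (H1 := Rpower_pos t a). assert (H2 := exp_pos (- t)). nra.
  + left; apply Rmult_lt_0_compat; apply exp_pos.
(* Since [t^(a+1) <= K e^t], the boundary function is at most [K / t]. *)
- intros eps Heps. exists (K / eps). split; [now apply Rdiv_lt_0_compat|].
  intros t Ht.
  assert (HKe : 0 < K / eps) by now apply Rdiv_lt_0_compat.
  rewrite Rabs_Ropp, Rabs_pos_eq; [|left; apply Rmult_lt_0_compat; apply exp_pos].
  assert (H := BK t ltac:(lra)). rewrite Rpower_plus, Rpower_1 in H by lra.
  assert (He := exp_pos t). assert (Hp := Rpower_pos t a).
  rewrite exp_Ropp. apply Rmult_lt_reg_r with (exp t * t); [nra|].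
  replace (Rpower t a * / exp t * (exp t * t)) with (Rpower t a * t) by (field; lra).
  assert (K < eps * t).
  { apply Rmult_lt_reg_r with (/ eps); [now apply Rinv_0_lt_compat|].
    replace (eps * t * / eps) with t by (field; lra). exact Ht. }
  nra.
- now apply ImproperInt0inf_scal.
Qed.

Lemma rising_pos a n : 0 < a -> 0 < rising a n.
Proof.
intros Ha; induction n as [|n IH]; simpl; [lra|].
apply Rmult_lt_0_compat; [exact IH|]. assert (H := pos_INR n); lra.
Qed.

Lemma IsGamma_rising a g n : 0 < a -> IsGamma a g -> IsGamma (a + INR n) (rising a n * g).
Proof.
intros Ha Hg; induction n as [|n IH].
- simpl. now rewrite Rplus_0_r, Rmult_1_l.
- simpl rising. rewrite S_INR, <- Rplus_assoc.
  replace (rising a n * (a + INR n) * g) with ((a + INR n) * (rising a n * g)) by ring.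
  apply IsGamma_succ; [assert (H := pos_INR n); lra|exact IH].
Qed.

(** * The normal distribution function *)

Definition gauss (x : R) : R := exp (- (x ^ 2 / 2)).

Lemma gauss_pos x : 0 < gauss x.
Proof. apply exp_pos. Qed.

Lemma gauss_le1 x : gauss x <= 1.
Proof.
unfold gauss. rewrite <- exp_0. destruct (Req_dec x 0) as [->|H].
- right; f_equal; lra.
- left; apply exp_increasing. nra.
Qed.

Lemma gauss_opp x : gauss (- x) = gauss x.
Proof. unfold gauss. f_equal. field. Qed.

Lemma gauss_derive x : is_derive gauss x (- (x * gauss x)).
Proof.
unfold gauss. auto_derive; [trivial|].
replace (x * (x * 1) * / 2) with (x ^ 2 / 2) by field. simpl. field.
Qed.

Lemma gauss_continuous x : continuous gauss x.
Proof.
apply (ex_derive_continuous (V := R_NormedModule)). unfold gauss. auto_derive. trivial.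
Qed.

Lemma gauss_ex_RInt a b : ex_RInt gauss a b.
Proof.
apply (ex_RInt_continuous (V := R_CompleteNormedModule)). intros; apply gauss_continuous.
Qed.

(** The substitution [t = s^2 / 2]. The interval starts at a positive [x] because the Gamma
    integrand with parameter [1/2] is singular at 0. *)
Lemma RInt_gauss_gamma x y : 0 < x -> x <= y ->
  sqrt 2 * RInt gauss x y = RInt (gamma_integrand (1/2)) (x ^ 2 / 2) (y ^ 2 / 2).
Proof.
intros Hx Hxy.
rewrite <- (RInt_comp (gamma_integrand (1/2)) (fun s => s ^ 2 / 2) (fun s => s)).
- replace (sqrt 2 * RInt gauss x y) with (RInt (fun s => sqrt 2 * gauss s) x y)
    by exact (RInt_scal gauss x y (sqrt 2) (gauss_ex_RInt x y)).
  apply RInt_ext. intros s Hs. rewrite Rmin_left in Hs by lra.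
  unfold scal; simpl; unfold mult; simpl. unfold gamma_integrand, gauss.
  replace (1 / 2 - 1) with (- / 2) by field.
  rewrite Rpower_Ropp, Rpower_sqrt by nra.
  simpl pow. rewrite Rmult_1_r, sqrt_div_alt, sqrt_square by lra.
  assert (H2 : 0 < sqrt 2) by (apply sqrt_lt_R0; lra).
  field. split; lra.
- intros s Hs. rewrite Rmin_left in Hs by lra. apply gamma_integrand_continuous. nra.
- intros s Hs. split; [auto_derive; [trivial|field]|apply continuous_id].
Qed.

Lemma RInt_gauss_lim g : IsGamma (1/2) g -> is_lim (RInt gauss 0) p_infty (g / sqrt 2).
Proof.
intros Hg. apply IsGamma_sup_integral in Hg. destruct Hg as [U L].
assert (H2 : 0 < sqrt 2) by (apply sqrt_lt_R0; lra).
assert (Upper : forall y, 0 < y -> RInt gauss 0 y <= g / sqrt 2).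
{ intros y Hy. apply Rnot_lt_le; intros Hlt.
  (* The comparison with the Gamma integral needs an interval away from 0. The discarded piece below
     [x] contributes at most [x], hence at most half of the assumed excess. *)
  set (x := Rmin y ((RInt gauss 0 y - g / sqrt 2) / 2)).
  assert (Hx0 : 0 < x) by (apply Rmin_glb_lt; lra).
  assert (Hxy : x <= y) by apply Rmin_l.
  assert (Hx : x <= (RInt gauss 0 y - g / sqrt 2) / 2) by apply Rmin_r.
  rewrite (RInt_split gauss 0 x y) in Hlt, Hx by apply gauss_ex_RInt.
  assert (H1 : RInt gauss 0 x <= (x - 0) * 1).
  { apply Rle_trans with (Rabs (RInt gauss 0 x)); [apply Rle_abs|].
    apply abs_RInt_le_const; [lra|apply gauss_ex_RInt|].
    intros t _. rewrite Rabs_pos_eq by (left; apply gauss_pos). apply gauss_le1. }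
  assert (H3 := U (x ^ 2 / 2) (y ^ 2 / 2) ltac:(nra) ltac:(nra)).
  rewrite <- RInt_gauss_gamma in H3 by lra.
  assert (H4 : RInt gauss x y <= g / sqrt 2).
  { apply Rmult_le_reg_l with (sqrt 2); [lra|]. field_simplify; lra. }
  lra. }
apply is_lim_spec. intros eps. simpl.
destruct (L (eps * sqrt 2)) as (a & b & Ha & Hab & K).
{ apply Rmult_lt_0_compat; [apply cond_pos|lra]. }
assert (Hsa : 0 < sqrt (2 * a)) by (apply sqrt_lt_R0; lra).
assert (Hsab : sqrt (2 * a) <= sqrt (2 * b)) by (apply sqrt_le_1; lra).
exists (sqrt (2 * b)). intros y Hy.
assert (E : RInt (gamma_integrand (1 / 2)) a b = sqrt 2 * RInt gauss (sqrt (2 * a)) (sqrt (2 * b))).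
{ rewrite RInt_gauss_gamma by lra. rewrite !pow2_sqrt by lra. f_equal; field. }
rewrite E in K.
assert (H1 := Upper y ltac:(lra)).
assert (H3 : RInt gauss (sqrt (2 * a)) (sqrt (2 * b)) <= RInt gauss 0 y).
{ rewrite (RInt_split gauss 0 (sqrt (2 * a)) y) by apply gauss_ex_RInt.
  rewrite (RInt_split gauss (sqrt (2 * a)) (sqrt (2 * b)) y) by apply gauss_ex_RInt.
  assert (0 <= RInt gauss 0 (sqrt (2 * a))).
  { apply RInt_ge_0; [lra|apply gauss_ex_RInt|intros; left; apply gauss_pos]. }
  assert (0 <= RInt gauss (sqrt (2 * b)) y).
  { apply RInt_ge_0; [lra|apply gauss_ex_RInt|intros; left; apply gauss_pos]. }
  lra. }
assert (H4 : g / sqrt 2 - eps < RInt gauss (sqrt (2 * a)) (sqrt (2 * b))).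
{ apply Rmult_lt_reg_l with (sqrt 2); [lra|].
  replace (sqrt 2 * (g / sqrt 2 - eps)) with (g - eps * sqrt 2) by (field; lra). exact K. }
apply Rabs_lt_between. lra.
Qed.

(** This is [sqrt (PI / 2)], kept as a limit: the moment formula divides by Gamma(1/2), which equals
    [sqrt 2 * half_mass], so the normalisation of [Phi] and the formula share this constant. *)
Definition half_mass : R := real (Lim (RInt gauss 0) p_infty).

Lemma IsGamma_half g : IsGamma (1/2) g -> g = sqrt 2 * half_mass.
Proof.
intros Hg. apply RInt_gauss_lim in Hg.
unfold half_mass. rewrite (is_lim_unique _ _ _ Hg). simpl. field.
apply Rgt_not_eq, sqrt_lt_R0. lra.
Qed.

Lemma half_mass_lim : is_lim (RInt gauss 0) p_infty half_mass.
Proof.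
destruct (IsGamma_exists (1/2) ltac:(lra)) as [g Hg].
apply RInt_gauss_lim in Hg.
unfold half_mass. now rewrite (is_lim_unique _ _ _ Hg).
Qed.

Lemma RInt_gauss_le x y : x <= y -> RInt gauss 0 x <= RInt gauss 0 y.
Proof.
intros Hxy. rewrite (RInt_split gauss 0 x y) by apply gauss_ex_RInt.
assert (0 <= RInt gauss x y).
{ apply RInt_ge_0; [lra|apply gauss_ex_RInt|intros; left; apply gauss_pos]. }
lra.
Qed.

Lemma RInt_gauss_le_half_mass x : RInt gauss 0 x <= half_mass.
Proof.
apply Rnot_lt_le; intros Hlt.
assert (H := half_mass_lim). apply is_lim_spec in H.
assert (He : 0 < RInt gauss 0 x - half_mass) by lra.
destruct (H (mkposreal _ He)) as [M HM]. simpl in HM.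
assert (L1 := Rmax_l M x). assert (L2 := Rmax_r M x).
specialize (HM (Rmax M x + 1) ltac:(lra)).
assert (H1 := RInt_gauss_le x (Rmax M x + 1) ltac:(lra)).
apply Rabs_lt_between in HM. lra.
Qed.

Lemma half_mass_pos : 0 < half_mass.
Proof.
apply Rlt_le_trans with (RInt gauss 0 1); [|apply RInt_gauss_le_half_mass].
apply RInt_gt_0; [lra|intros; apply gauss_pos|intros; apply gauss_continuous].
Qed.

Lemma RInt_gauss_opp x : RInt gauss 0 (- x) = - RInt gauss 0 x.
Proof.
assert (H := RInt_comp_lin gauss (-1) 0 0 x).
replace (-1 * 0 + 0) with 0 in H by ring.
replace (-1 * x + 0) with (- x) in H by ring.
rewrite <- H by apply gauss_ex_RInt.
transitivity (RInt (fun y => opp (gauss y)) 0 x).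
- apply RInt_ext. intros y _. unfold scal, opp; simpl; unfold mult; simpl.
  replace (-1 * y + 0) with (- y) by ring. rewrite gauss_opp. ring.
- exact (RInt_opp gauss 0 x (gauss_ex_RInt 0 x)).
Qed.

Definition Phi (x : R) : R := 1 / 2 + RInt gauss 0 x / (2 * half_mass).

Lemma Phi_derive x : is_derive Phi x (gauss x / (2 * half_mass)).
Proof.
assert (H := half_mass_pos).
unfold Phi. evar_last.
- apply (is_derive_plus (V := R_NormedModule)).
  + apply (is_derive_const (V := R_NormedModule)).
  + apply (is_derive_ext (fun t => / (2 * half_mass) * RInt gauss 0 t)).
    { intros t. unfold Rdiv. apply Rmult_comm. }
    apply (is_derive_scal (RInt gauss 0)).
    apply (is_derive_RInt (V := R_NormedModule) gauss _ 0).
    * apply filter_forall. intros y. apply (RInt_correct (V := R_CompleteNormedModule)).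
      apply gauss_ex_RInt.
    * apply gauss_continuous.
- unfold plus, zero, scal; simpl. unfold mult; simpl. field. lra.
Qed.

Lemma Phi_continuous x : continuous Phi x.
Proof.
apply (ex_derive_continuous (V := R_NormedModule)). eexists. apply Phi_derive.
Qed.

Lemma Phi_opp x : Phi (- x) = 1 - Phi x.
Proof.
assert (H := half_mass_pos). unfold Phi. rewrite RInt_gauss_opp. field. lra.
Qed.

Lemma Phi_le x y : x <= y -> Phi x <= Phi y.
Proof.
intros Hxy. unfold Phi. apply Rplus_le_compat_l, Rmult_le_compat_r.
- left; apply Rinv_0_lt_compat. assert (H := half_mass_pos). lra.
- now apply RInt_gauss_le.
Qed.

Lemma Phi_le1 x : Phi x <= 1.
Proof.
unfold Phi. assert (H := half_mass_pos). assert (H1 := RInt_gauss_le_half_mass x).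
assert (RInt gauss 0 x / (2 * half_mass) <= / 2); [|lra].
apply Rmult_le_reg_r with (2 * half_mass); [lra|]. field_simplify; lra.
Qed.

Lemma Phi_ge0 x : 0 <= Phi x.
Proof. assert (H := Phi_le1 (- x)). rewrite Phi_opp in H. lra. Qed.

Lemma Phi_near1 eps : 0 < eps -> exists M, 0 < M /\ forall x, M <= x -> 1 - eps < Phi x.
Proof.
intros Heps. assert (Hc := half_mass_pos).
assert (H := half_mass_lim). apply is_lim_spec in H.
assert (He : 0 < eps * half_mass) by now apply Rmult_lt_0_compat.
destruct (H (mkposreal _ He)) as [M HM]. simpl in HM.
exists (Rmax M 0 + 1). assert (L1 := Rmax_l M 0). assert (L2 := Rmax_r M 0).
split; [lra|]. intros x Hx.
specialize (HM x ltac:(lra)). apply Rabs_lt_between in HM.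
unfold Phi. assert (1 / 2 - eps / 2 < RInt gauss 0 x / (2 * half_mass)); [|lra].
apply Rmult_lt_reg_r with (2 * half_mass); [lra|]. field_simplify; [|lra..]. lra.
Qed.

Lemma Phi_near0 eps : 0 < eps -> exists M, 0 < M /\ forall x, x <= - M -> Phi x < eps.
Proof.
intros Heps. destruct (Phi_near1 eps Heps) as (M & HM & K).
exists M. split; [exact HM|]. intros x Hx.
specialize (K (- x) ltac:(lra)). rewrite Phi_opp in K. lra.
Qed.

(** The function [C e^(-k x) + Phi x] is nonincreasing, because [gauss z <= e^(k^2/2 - k z)] by
    [(z - k)^2 >= 0], and it comes arbitrarily close to values at least 1 far to the right. It is
    therefore at least 1 everywhere. *)
Lemma Phi_tail k : 0 < k -> exists C, 0 < C /\ forall x, 1 - Phi x <= C * exp (- k * x).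
Proof.
intros Hk. assert (Hc := half_mass_pos).
set (c := / (2 * half_mass)).
assert (Hc' : 0 < c) by (apply Rinv_0_lt_compat; lra).
set (C := c * exp (k ^ 2 / 2) / k).
assert (HC : 0 < C).
{ apply Rdiv_lt_0_compat; [|exact Hk]. apply Rmult_lt_0_compat; [exact Hc'|apply exp_pos]. }
exists C. split; [exact HC|]. intros x.
apply Rnot_lt_le; intros Hlt.
destruct (Phi_near1 (1 - Phi x - C * exp (- k * x))) as (M & HM & K); [lra|].
set (y := Rmax M x + 1).
assert (L1 := Rmax_l M x). assert (L2 := Rmax_r M x).
specialize (K y ltac:(unfold y; lra)).
destruct (MVT_gen (fun x => C * exp (- k * x) + Phi x) x y
  (fun x => - k * (C * exp (- k * x)) + c * gauss x)) as (z & Hz & E).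
- intros z _. apply (is_derive_plus (V := R_NormedModule)
    (fun x => C * exp (- k * x)) Phi).
  + auto_derive; [trivial|ring].
  + replace (c * gauss z) with (gauss z / (2 * half_mass)) by (unfold c; field; lra).
    apply Phi_derive.
- intros z _. apply continuity_pt_filterlim.
  apply (continuous_plus (V := R_NormedModule) (fun x => C * exp (- k * x)) Phi).
  + apply (ex_derive_continuous (V := R_NormedModule)). auto_derive. trivial.
  + apply Phi_continuous.
- assert (Hneg : - k * (C * exp (- k * z)) + c * gauss z <= 0).
  { replace (- k * (C * exp (- k * z))) with (- (c * exp (k ^ 2 / 2 + - k * z))).
    2: { rewrite exp_plus. unfold C. field. lra. }
    assert (gauss z <= exp (k ^ 2 / 2 + - k * z)).
    { unfold gauss. destruct (Req_dec z k) as [->|Hne].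
      - right; f_equal; field.
      - left; apply exp_increasing. nra. }
    nra. }
  assert (Hy : 0 < y - x) by (unfold y; lra).
  assert (0 < C * exp (- k * y)) by (apply Rmult_lt_0_compat; [exact HC|apply exp_pos]).
  nra.
Qed.

(** These products are, up to sign, the second and third derivatives of [gauss], which appear in the
    remainder of the heat step. Both bounds follow from [e^(x^2/2) >= 1 + x^2/2 + x^4/8]. *)
Lemma gauss_poly_bound x :
  Rabs (1 - x ^ 2) * gauss x <= 3 /\ Rabs (3 * x - x ^ 3) * gauss x <= 18.
Proof.
assert (H1 : 1 + x ^ 2 / 2 + x ^ 4 / 8 <= exp (x ^ 2 / 2)).
{ assert (H := exp_partial_le (x ^ 2 / 2) 2 ltac:(nra)). simpl in H. simpl.
  replace (1 + x * (x * 1) / 2 + x * (x * (x * (x * 1))) / 8) with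
    (1 / 1 + x * (x * 1) / 2 * 1 / 1 + x * (x * 1) / 2 * (x * (x * 1) / 2 * 1) / (1 + 1)) by field.
  exact H. }
assert (Hg : gauss x * exp (x ^ 2 / 2) = 1).
{ unfold gauss. rewrite <- exp_plus, Rplus_opp_l. apply exp_0. }
assert (Hp := gauss_pos x).
assert (Hs : forall y B, y <= B * exp (x ^ 2 / 2) -> y * gauss x <= B).
{ intros y B HB. replace B with (B * exp (x ^ 2 / 2) * gauss x).
  - apply Rmult_le_compat_r; lra.
  - rewrite Rmult_assoc, (Rmult_comm _ (gauss x)), Hg. ring. }
split; apply Hs.
- apply Rabs_le. nra.
- assert (Rabs (3 * x - x ^ 3) <= 11 + 3 * x ^ 2 + x ^ 4) by (apply Rabs_le; nra).
  nra.
Qed.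

(* The first-order term cancels between the two possible jumps; the second-order one
   vanishes because [Phi (w / sqrt t)] solves the heat equation. *)
Lemma Phi_heat_step : exists K, 0 < K /\ forall w t a D,
  0 < D -> a ^ 2 + D <= t ->
  Rabs (Phi ((w + a) / sqrt (t - a ^ 2)) - Phi (w / sqrt t)
        - a * (gauss (w / sqrt t) / (2 * half_mass) / sqrt t))
  <= K * ((Rabs a / sqrt D) ^ 3 + (Rabs a / sqrt D) ^ 4).
Proof.
assert (Hc := half_mass_pos).
set (c := / (2 * half_mass)).
assert (Hc' : 0 < c) by (apply Rinv_0_lt_compat; lra).
(* The third-order term carries [2 * 3 = 6] and the fourth-order term 18, from the two bounds of
   [gauss_poly_bound]; 18 covers both. *)
exists (18 * c). split; [lra|].
intros w t a D HD Ht.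
(* The states before and after the jump are joined by the parabola [s -> (w + s, t - s^2)]; [d1] and
   [d2] are the first two derivatives of [Phi] along it. By the heat equation every term of [d2]
   carries a factor [s], which turns the second-order remainder into a third-order one. *)
set (rho := fun s => / sqrt (t - s ^ 2)).
set (zeta := fun s => (w + s) * rho s).
set (d1 := fun s => c * gauss (zeta s) * (rho s + s * zeta s * rho s ^ 2)).
set (d2 := fun s => c * gauss (zeta s) *
  (2 * s * rho s ^ 3 * (1 - zeta s ^ 2) + s ^ 2 * rho s ^ 4 * (3 * zeta s - zeta s ^ 3))).
assert (Hsq : forall s, s ^ 2 <= a ^ 2 -> 0 < sqrt (t - s ^ 2)).
{ intros s Hs. apply sqrt_lt_R0. lra. }
assert (Dr : forall s, s ^ 2 <= a ^ 2 -> is_derive rho s (s * rho s ^ 3)).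
{ intros s Hs. assert (H := Hsq s Hs). unfold rho. auto_derive.
  - replace (t + - (s * (s * 1))) with (t - s ^ 2) by ring. repeat split; lra.
  - replace (t + - (s * (s * 1))) with (t - s ^ 2) by ring. field. lra. }
assert (Dz : forall s, s ^ 2 <= a ^ 2 -> is_derive zeta s (rho s + s * zeta s * rho s ^ 2)).
{ intros s Hs. unfold zeta. evar_last.
  - apply (is_derive_mult (fun s => w + s) rho).
    + auto_derive; [trivial|reflexivity].
    + now apply Dr.
    + intros; apply Rmult_comm.
  - unfold plus, mult; simpl. ring. }
assert (Dg : forall s, s ^ 2 <= a ^ 2 -> is_derive (fun s => gauss (zeta s)) s
   (- (zeta s * gauss (zeta s) * (rho s + s * zeta s * rho s ^ 2)))).
{ intros s Hs. evar_last.
  - apply (is_derive_comp gauss zeta); [apply gauss_derive|now apply Dz].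
  - unfold scal; simpl; unfold mult; simpl. ring. }
assert (D1 : forall s, s ^ 2 <= a ^ 2 -> is_derive (fun s => Phi (zeta s)) s (d1 s)).
{ intros s Hs. evar_last.
  - apply (is_derive_comp Phi zeta); [apply Phi_derive|now apply Dz].
  - unfold scal; simpl; unfold mult; simpl. unfold d1, c. field. lra. }
assert (D2 : forall s, s ^ 2 <= a ^ 2 -> is_derive d1 s (d2 s)).
{ intros s Hs. assert (R1 := Dr s Hs). assert (R2 := Dz s Hs). assert (R3 := Dg s Hs).
  unfold d1. evar_last.
  - apply (is_derive_mult (fun s => c * gauss (zeta s))
      (fun s => rho s + s * zeta s * rho s ^ 2)).
    + apply (is_derive_scal (fun s => gauss (zeta s))). exact R3.
    + apply (is_derive_plus (V := R_NormedModule) rho (fun s => s * zeta s * rho s ^ 2)).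
      * exact R1.
      * apply (is_derive_mult (fun s => s * zeta s) (fun s => rho s ^ 2)).
        -- apply (is_derive_mult (fun s => s) zeta).
           ++ apply (is_derive_id (K := R_AbsRing)).
           ++ exact R2.
           ++ intros; apply Rmult_comm.
        -- apply (is_derive_pow rho 2). exact R1.
        -- intros; apply Rmult_comm.
    + intros; apply Rmult_comm.
  - unfold plus, mult, one; simpl. unfold d2. simpl. ring. }
assert (Hb : forall s z, Rmin 0 s <= z <= Rmax 0 s -> z ^ 2 <= s ^ 2).
{ intros s z. unfold Rmin, Rmax. destruct (Rle_dec 0 s); intros; nra. }
assert (Hcont : forall f s l, is_derive f s l -> continuity_pt f s).
{ intros f s l H. apply continuity_pt_filterlim.
  apply (ex_derive_continuous (V := R_NormedModule)). now exists l. }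
(* Two mean value steps give the remainder in the form [d2 eta * xi * a], with [xi] and [eta] no
   larger than [a] in absolute value. [MVT_gen] is used because [a] may be negative. *)
destruct (MVT_gen (fun s => Phi (zeta s)) 0 a d1) as (xi & Hxi & E1).
{ intros s Hs. apply D1, Hb. lra. }
{ intros s Hs. apply (Hcont _ _ (d1 s)), D1, Hb, Hs. }
apply Hb in Hxi.
destruct (MVT_gen d1 0 xi d2) as (eta & Heta & E2).
{ intros s Hs. apply D2. apply Rle_trans with (xi ^ 2); [apply Hb; lra|exact Hxi]. }
{ intros s Hs. apply (Hcont _ _ (d2 s)), D2.
  apply Rle_trans with (xi ^ 2); [apply Hb, Hs|exact Hxi]. }
apply Hb in Heta.
assert (Heta2 : eta ^ 2 <= a ^ 2) by lra.
replace (Phi ((w + a) / sqrt (t - a ^ 2))) with (Phi (zeta a)) by reflexivity.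
assert (Ez0 : zeta 0 = w / sqrt t).
{ unfold zeta, rho. replace (t - 0 ^ 2) with t by ring. unfold Rdiv. f_equal. ring. }
assert (Er0 : rho 0 = / sqrt t).
{ unfold rho. f_equal. f_equal. ring. }
replace (gauss (w / sqrt t) / (2 * half_mass) / sqrt t) with (d1 0).
2: { unfold d1. rewrite Er0, Ez0. unfold c.
     assert (0 < sqrt t) by (apply sqrt_lt_R0; nra). field. split; lra. }
rewrite <- Ez0. rewrite Rminus_0_r in E1, E2.
replace (Phi (zeta a) - Phi (zeta 0) - a * d1 0) with (d2 eta * (xi * a)) by nra.
rewrite !Rabs_mult.
assert (Hxia : Rabs xi <= Rabs a) by (apply Rsqr_le_abs_0; unfold Rsqr; lra).
assert (Hea : Rabs eta <= Rabs a) by (apply Rsqr_le_abs_0; unfold Rsqr; lra).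
set (r0 := / sqrt D).
assert (HsD : 0 < sqrt D) by now apply sqrt_lt_R0.
assert (Hr0 : 0 < r0) by now apply Rinv_0_lt_compat.
assert (Hr : 0 < rho eta <= r0).
{ split; [apply Rinv_0_lt_compat, Hsq, Heta2|].
  apply Rinv_le_contravar; [exact HsD|]. apply sqrt_le_1; lra. }
destruct (gauss_poly_bound (zeta eta)) as [G1 G2].
assert (Hd2 : Rabs (d2 eta) <= c * (6 * (Rabs a * r0 ^ 3) + 18 * (Rabs a ^ 2 * r0 ^ 4))).
{ unfold d2. rewrite Rmult_assoc, Rabs_mult, (Rabs_pos_eq c) by lra.
  apply Rmult_le_compat_l; [lra|].
  rewrite Rmult_plus_distr_l. eapply Rle_trans; [apply Rabs_triang|].
  rewrite !Rabs_mult, (Rabs_pos_eq (gauss _)) by (left; apply gauss_pos).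
  rewrite <- !RPow_abs, (Rabs_pos_eq (rho eta)), (Rabs_pos_eq 2) by lra.
  assert (P3 : rho eta ^ 3 <= r0 ^ 3) by (apply pow_incr; lra).
  assert (P4 : rho eta ^ 4 <= r0 ^ 4) by (apply pow_incr; lra).
  assert (Q3 : 0 <= rho eta ^ 3) by (apply pow_le; lra).
  assert (Q4 : 0 <= rho eta ^ 4) by (apply pow_le; lra).
  assert (S2 : Rabs eta ^ 2 <= Rabs a ^ 2) by (apply pow_incr; split; [apply Rabs_pos|lra]).
  assert (T1 : Rabs eta * rho eta ^ 3 <= Rabs a * r0 ^ 3)
    by (apply Rmult_le_compat; trivial; apply Rabs_pos).
  assert (T2 : Rabs eta ^ 2 * rho eta ^ 4 <= Rabs a ^ 2 * r0 ^ 4)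
    by (apply Rmult_le_compat; trivial; apply pow2_ge_0).
  assert (U1 : 0 <= Rabs eta * rho eta ^ 3) by (apply Rmult_le_pos; [apply Rabs_pos|exact Q3]).
  assert (U2 : 0 <= Rabs eta ^ 2 * rho eta ^ 4) by (apply Rmult_le_pos; [apply pow2_ge_0|exact Q4]).
  apply Rplus_le_compat.
  - replace (gauss (zeta eta) * (2 * Rabs eta * rho eta ^ 3 * Rabs (1 - zeta eta ^ 2)))
      with (2 * (Rabs eta * rho eta ^ 3) * (Rabs (1 - zeta eta ^ 2) * gauss (zeta eta))) by ring.
    assert (0 <= Rabs (1 - zeta eta ^ 2) * gauss (zeta eta))
      by (apply Rmult_le_pos; [apply Rabs_pos|left; apply gauss_pos]).
    nra.
  - replace (gauss (zeta eta) * (Rabs eta ^ 2 * rho eta ^ 4 * Rabs (3 * zeta eta - zeta eta ^ 3)))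
      with ((Rabs eta ^ 2 * rho eta ^ 4) * (Rabs (3 * zeta eta - zeta eta ^ 3) * gauss (zeta eta))) by ring.
    assert (0 <= Rabs (3 * zeta eta - zeta eta ^ 3) * gauss (zeta eta))
      by (apply Rmult_le_pos; [apply Rabs_pos|left; apply gauss_pos]).
    nra. }
assert (Hxa : Rabs xi * Rabs a <= Rabs a ^ 2).
{ simpl. rewrite Rmult_1_r. apply Rmult_le_compat_r; [apply Rabs_pos|exact Hxia]. }
assert (Ha0 := Rabs_pos a).
apply Rle_trans with (c * (6 * (Rabs a * r0 ^ 3) + 18 * (Rabs a ^ 2 * r0 ^ 4)) * Rabs a ^ 2).
- apply Rmult_le_compat; trivial; [apply Rabs_pos|].
  apply Rmult_le_pos; apply Rabs_pos.
- unfold Rdiv. fold r0.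
  assert (V1 : 0 <= (Rabs a * r0) ^ 3) by (apply pow_le, Rmult_le_pos; lra).
  assert (V2 : 0 <= (Rabs a * r0) ^ 4) by (apply pow_le, Rmult_le_pos; lra).
  replace (c * (6 * (Rabs a * r0 ^ 3) + 18 * (Rabs a ^ 2 * r0 ^ 4)) * Rabs a ^ 2)
    with (c * (6 * (Rabs a * r0) ^ 3 + 18 * (Rabs a * r0) ^ 4)) by ring.
  nra.
Qed.

(** * Kummer's function *)

Lemma rising_shift a n : rising a (S n) = a * rising (a + 1) n.
Proof.
induction n as [|n IH]; [simpl; ring|].
change (rising a (S (S n))) with (rising a (S n) * (a + INR (S n))).
rewrite IH. simpl rising. rewrite S_INR. ring.
Qed.

Lemma sum_pascal (u : nat -> R) n :
  sum_f_R0 (fun k => Binomial.C (S n) k * u k) (S n) =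
  sum_f_R0 (fun k => Binomial.C n k * u k) n + sum_f_R0 (fun k => Binomial.C n k * u (S k)) n.
Proof.
destruct n as [|n].
- simpl. rewrite !C_n_0, C_n_n. ring.
- rewrite tech5, decomp_sum by lia.
  rewrite (decomp_sum (fun k => Binomial.C (S n) k * u k)) by lia.
  rewrite (tech5 (fun k => Binomial.C (S n) k * u (S k))).
  simpl pred.
  rewrite !C_n_0, !C_n_n.
  assert (E : sum_f_R0 (fun i => Binomial.C (S (S n)) (S i) * u (S i)) n
    = sum_f_R0 (fun i => Binomial.C (S n) (S i) * u (S i)) n
      + sum_f_R0 (fun i => Binomial.C (S n) i * u (S i)) n).
  { rewrite <- plus_sum. apply sum_eq. intros i Hi.
    rewrite <- pascal by lia. ring. }
  rewrite E. ring.
Qed.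

(** The Chu-Vandermonde identity. Pascal's rule splits the sum at [n + 1] into the sum at [n] for
    [(a, b)] and a multiple of the one for [(a + 1, b + 1)], so the induction must vary both
    parameters. *)
Lemma vandermonde n : forall a b, 0 < b ->
  sum_f_R0 (fun k => Binomial.C n k * ((-1) ^ k * rising a k / rising b k)) n
  = rising (b - a) n / rising b n.
Proof.
induction n as [|n IH]; intros a b Hb.
- simpl. rewrite C_n_0. field.
- rewrite sum_pascal, IH by exact Hb.
  assert (E : sum_f_R0 (fun k => Binomial.C n k *
      ((-1) ^ S k * rising a (S k) / rising b (S k))) n
    = - (a / b) * (rising (b - a) n / rising (b + 1) n)).
  { replace (b - a) with (b + 1 - (a + 1)) by ring. rewrite <- IH by lra.
    rewrite scal_sum. apply sum_eq. intros k _. rewrite !rising_shift.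
    assert (H := rising_pos (b + 1) k ltac:(lra)). simpl pow. field. lra. }
  rewrite E.
  assert (H1 := rising_pos (b + 1) n ltac:(lra)).
  assert (H2 := rising_pos b n Hb).
  assert (H4 := pos_INR n).
  assert (H3 : b * rising (b + 1) n = rising b n * (b + INR n)).
  { rewrite <- rising_shift. reflexivity. }
  simpl rising.
  replace (rising (b + 1) n) with (rising b n * (b + INR n) / b)
    by (rewrite <- H3; field; lra).
  field. lra.
Qed.

Lemma ratio_bound a b n : 0 < a -> 0 < b ->
  0 < rising a n / rising b n <= (a / b + 1) ^ n.
Proof.
intros Ha Hb. split.
- apply Rdiv_lt_0_compat; now apply rising_pos.
- induction n as [|n IH]; [simpl; lra|].
  assert (H1 := rising_pos b n Hb). assert (H2 := rising_pos a n Ha). assert (H3 := pos_INR n).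
  simpl. replace (rising a n * (a + INR n) / (rising b n * (b + INR n)))
    with ((a + INR n) / (b + INR n) * (rising a n / rising b n)) by (field; lra).
  assert (Hab : 0 < a / b) by now apply Rdiv_lt_0_compat.
  apply Rmult_le_compat; trivial.
  + left; apply Rdiv_lt_0_compat; lra.
  + left; apply Rdiv_lt_0_compat; trivial.
  + apply Rmult_le_reg_r with (b + INR n); [lra|].
    replace ((a + INR n) / (b + INR n) * (b + INR n)) with (a + INR n) by (field; lra).
    replace ((a / b + 1) * (b + INR n)) with (a + INR n + b + a / b * INR n) by (field; lra).
    assert (0 <= a / b * INR n) by (apply Rmult_le_pos; lra). lra.
Qed.

Definition kummer_term (a b z : R) (n : nat) : R := rising a n / (rising b n * INR (fact n)) * z ^ n.

Lemma kummer_term_summable a b z : 0 < a -> 0 < b -> 0 <= z ->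
  ex_series (kummer_term a b z).
Proof.
intros Ha Hb Hz.
apply (ex_series_le (V := R_CompleteNormedModule) _ (fun n => ((a / b + 1) * z) ^ n / INR (fact n))).
- intros n. destruct (ratio_bound a b n Ha Hb) as [B1 B2].
  assert (Hf := INR_fact_lt_0 n). assert (Hr := rising_pos b n Hb).
  assert (Hzn : 0 <= z ^ n) by now apply pow_le.
  unfold norm; simpl. unfold abs; simpl.
  replace (kummer_term a b z n) with (rising a n / rising b n * (z ^ n / INR (fact n)))
    by (unfold kummer_term; field; lra).
  assert (0 <= z ^ n / INR (fact n)) by (apply Rmult_le_pos; [exact Hzn|left; now apply Rinv_0_lt_compat]).
  rewrite Rabs_pos_eq by (apply Rmult_le_pos; lra).
  rewrite Rpow_mult_distr. unfold Rdiv at 3. rewrite Rmult_assoc.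
  now apply Rmult_le_compat_r.
- exists (exp ((a / b + 1) * z)). apply is_series_Reals, exp_infinite_sum.
Qed.

(** Cauchy product of the series with that of [exp (- z)]; its coefficients are summed by
    [vandermonde]. The form with [a, b > 0] and [z >= 0] has nonnegative terms and suits termwise
    integration, whereas the moment formula is stated with a negative first parameter and a
    nonpositive argument. *)
Lemma kummer_transformation a b z : 0 < a -> 0 < b -> 0 <= z -> exists L,
  infinite_sum (kummer_term a b z) L /\ IsKummer (b - a) b (- z) (exp (- z) * L).
Proof.
intros Ha Hb Hz.
assert (Hex := kummer_term_summable a b z Ha Hb Hz).
destruct Hex as [L HL]. exists L. split; [now apply is_series_Reals|].
apply is_series_Reals. rewrite Rmult_comm.
eapply is_series_ext; [|apply (is_series_mult (kummer_term a b z) (fun j => (- z) ^ j / INR (fact j)))].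
- intros n. assert (H0 := INR_fact_lt_0 n). assert (Hr := rising_pos b n Hb).
  replace (rising (b - a) n / (rising b n * INR (fact n)) * (- z) ^ n)
    with ((- z) ^ n / INR (fact n) * (rising (b - a) n / rising b n)) by (field; lra).
  rewrite <- vandermonde, scal_sum by exact Hb.
  apply sum_eq. intros k Hk. unfold kummer_term, Binomial.C.
  replace ((- z) ^ n) with ((- z) ^ (n - k) * (-1) ^ k * z ^ k).
  2: { rewrite Rmult_assoc, <- Rpow_mult_distr.
       replace (-1 * z) with (- z) by ring. rewrite <- pow_add. f_equal. lia. }
  assert (H1 := INR_fact_lt_0 k). assert (H2 := INR_fact_lt_0 (n - k)).
  assert (H3 := INR_fact_lt_0 n). assert (H4 := rising_pos b k Hb).
  assert (E : (-1) ^ k * (-1) ^ k = 1).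
  { rewrite <- Rpow_mult_distr. replace (-1 * -1) with 1 by ring. apply pow1. }
  transitivity (((-1) ^ k * (-1) ^ k) * (rising a k / (rising b k * INR (fact k)) * z ^ k *
     ((- z) ^ (n - k) / INR (fact (n - k))))).
  + rewrite E. ring.
  + field. lra.
- exact HL.
- apply is_series_Reals, exp_infinite_sum.
- apply ex_series_ext with (kummer_term a b z); [|now exists L].
  intros n. rewrite Rabs_pos_eq; trivial. unfold kummer_term.
  apply Rmult_le_pos; [|now apply pow_le]. left. apply Rdiv_lt_0_compat.
  + now apply rising_pos.
  + apply Rmult_lt_0_compat; [now apply rising_pos|apply INR_fact_lt_0].
- apply ex_series_ext with (fun j => z ^ j / INR (fact j)).
  + intros n. unfold Rdiv. rewrite Rabs_mult, <- RPow_abs, Rabs_Ropp, (Rabs_pos_eq z) by exact Hz.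
    f_equal. rewrite Rabs_pos_eq; [reflexivity|]. left; apply Rinv_0_lt_compat, INR_fact_lt_0.
  + exists (exp z). apply is_series_Reals, exp_infinite_sum.
Qed.

Lemma fact_double n : INR (fact (2 * n)) = 4 ^ n * INR (fact n) * rising (1/2) n.
Proof.
induction n as [|n IH]; [simpl; ring|].
replace (2 * S n)%nat with (S (S (2 * n))) by lia.
rewrite !fact_simpl, !mult_INR, IH, !S_INR, mult_INR. simpl. field.
Qed.

Lemma cosh_infinite_sum x : infinite_sum (fun n => x ^ (2 * n) / INR (fact (2 * n))) (cosh x).
Proof.
intros eps Heps.
destruct (exp_infinite_sum x eps Heps) as [N1 H1].
destruct (exp_infinite_sum (- x) eps Heps) as [N2 H2].
exists (N1 + N2)%nat. intros n Hn.
specialize (H1 (S (2 * n)) ltac:(lia)). specialize (H2 (S (2 * n)) ltac:(lia)).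
assert (E : forall n, sum_f_R0 (fun n => x ^ (2 * n) / INR (fact (2 * n))) n =
  (sum_f_R0 (fun j => x ^ j / INR (fact j)) (S (2 * n))
   + sum_f_R0 (fun j => (- x) ^ j / INR (fact j)) (S (2 * n))) / 2).
{ assert (Ev : forall k, (- x) ^ (2 * k) = x ^ (2 * k)).
  { intros k. rewrite !pow_mult. f_equal. ring. }
  intros k; induction k as [|k IH].
  - simpl. field.
  - replace (2 * S k)%nat with (S (S (2 * k))) by lia.
    rewrite (tech5 _ k), IH.
    rewrite !(tech5 _ (S (S (2 * k)))), !(tech5 _ (S (2 * k))).
    replace (2 * S k)%nat with (S (S (2 * k))) by lia.
    replace ((- x) ^ S (S (2 * k))) with (x ^ S (S (2 * k))).
    2: { replace (S (S (2 * k)))%nat with (2 * S k)%nat by lia. now rewrite Ev. }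
    replace ((- x) ^ S (S (S (2 * k)))) with (- x ^ S (S (S (2 * k)))).
    2: { rewrite <- (tech_pow_Rmult (- x)), <- (tech_pow_Rmult x).
         replace (S (S (2 * k)))%nat with (2 * S k)%nat by lia. rewrite Ev. ring. }
    field. split; apply INR_fact_neq_0. }
rewrite E. unfold cosh, Rdist in *.
apply Rabs_lt_between in H1, H2. apply Rabs_lt_between. lra.
Qed.

(** By [fact_double] the series of [cosh] becomes a hypergeometric series in [M t] with the single
    lower parameter [1/2]. Integrating against a Gamma density inserts [rising a n] and produces
    Kummer's series. *)
Lemma cosh_sqrt_infinite_sum M t : 0 <= M -> 0 <= t ->
  infinite_sum (fun n => M ^ n / (rising (1/2) n * INR (fact n)) * t ^ n) (cosh (2 * sqrt (M * t))).
Proof.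
intros HM Ht. apply is_series_Reals.
eapply is_series_ext; [|apply is_series_Reals, cosh_infinite_sum].
intros n. cbv beta. match goal with |- @eq _ ?x ?y => change (@eq R x y) end. rewrite fact_double, pow_mult, Rpow_mult_distr, pow2_sqrt by now apply Rmult_le_pos.
replace (2 ^ 2) with 4 by ring. rewrite !Rpow_mult_distr.
assert (H1 := INR_fact_lt_0 n). assert (H2 := rising_pos (1/2) n ltac:(lra)).
assert (H3 : 0 < 4 ^ n) by (apply pow_lt; lra).
field. lra.
Qed.

Lemma gamma_integrand_pow a t n : 0 < t -> gamma_integrand a t * t ^ n = gamma_integrand (a + INR n) t.
Proof.
intros Ht. unfold gamma_integrand. rewrite <- Rpower_pow by exact Ht.
replace (a + INR n - 1) with (a - 1 + INR n) by ring. rewrite Rpower_plus. ring.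
Qed.

Lemma ImproperInt0inf_gamma_poly a g (c : nat -> R) n : 0 < a -> IsGamma a g ->
  ImproperInt0inf (fun t => gamma_integrand a t * sum_f_R0 (fun k => c k * t ^ k) n)
    (sum_f_R0 (fun k => c k * (rising a k * g)) n).
Proof.
intros Ha Hg. induction n as [|n IH].
- simpl sum_f_R0. apply (ImproperInt0inf_ext (fun t => c 0%nat * gamma_integrand a t)).
  + intros t _; ring.
  + rewrite Rmult_1_l. now apply ImproperInt0inf_scal.
- rewrite tech5.
  apply (ImproperInt0inf_ext (fun t => gamma_integrand a t * sum_f_R0 (fun k => c k * t ^ k) n
     + c (S n) * gamma_integrand (a + INR (S n)) t)).
  + intros t Ht. rewrite tech5, <- gamma_integrand_pow by exact Ht. ring.
  + apply ImproperInt0inf_plus; [exact IH|]. apply ImproperInt0inf_scal.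
    now apply (IsGamma_rising a g (S n)).
Qed.

Lemma infinite_sum_partial_le (u : nat -> R) l n :
  (forall k, 0 <= u k) -> infinite_sum u l -> sum_f_R0 u n <= l.
Proof. intros Hu H. now apply sum_incr. Qed.

Lemma power_series_tail_le (c : nat -> R) (f : R -> R) n x y :
  (forall k, 0 <= c k) -> 0 <= x <= y ->
  infinite_sum (fun k => c k * x ^ k) (f x) -> infinite_sum (fun k => c k * y ^ k) (f y) ->
  f x - sum_f_R0 (fun k => c k * x ^ k) n <= f y - sum_f_R0 (fun k => c k * y ^ k) n.
Proof.
intros Hc Hxy Hx Hy. apply Rnot_lt_le; intros Hlt.
set (d := fun k => c k * y ^ k + -1 * (c k * x ^ k)).
assert (Hd : infinite_sum d (f y + -1 * f x)).
{ apply is_series_Reals. apply (is_series_plus (V := R_NormedModule)).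
  - now apply is_series_Reals.
  - apply (is_series_scal (V := R_NormedModule)). now apply is_series_Reals. }
assert (H := infinite_sum_partial_le d (f y + -1 * f x) n).
assert (E : sum_f_R0 d n = sum_f_R0 (fun k => c k * y ^ k) n - sum_f_R0 (fun k => c k * x ^ k) n).
{ unfold d. clear. induction n as [|n IH]; simpl; lra. }
assert (sum_f_R0 d n <= f y + -1 * f x); [|lra].
apply H; [|exact Hd]. intros k. unfold d.
assert (x ^ k <= y ^ k) by (apply pow_incr; lra). assert (Hck := Hc k). nra.
Qed.

(* Term-by-term integration: on [0, b] the tail of the power series is at most its value at b. *)
Lemma sup_integral_gamma_series a g (c : nat -> R) (f : R -> R) L :
  0 < a -> IsGamma a g -> (forall k, 0 <= c k) ->
  (forall t, 0 < t -> continuous f t) ->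
  (forall t, 0 <= t -> infinite_sum (fun k => c k * t ^ k) (f t)) ->
  infinite_sum (fun k => c k * rising a k) L ->
  sup_integral (fun t => gamma_integrand a t * f t) (g * L).
Proof.
intros Ha Hg Hc Cf Hf HL.
assert (Hgs := Hg). apply IsGamma_sup_integral in Hgs. destruct Hgs as [Ug _].
assert (g0 : 0 <= g).
{ apply Rle_trans with (RInt (gamma_integrand a) 1 1); [|apply Ug; lra].
  rewrite RInt_point. apply Rle_refl. }
set (p := fun n t => sum_f_R0 (fun k => c k * t ^ k) n).
assert (Cp : forall n t, continuous (p n) t).
{ intros n t. unfold p. induction n as [|n IH]; simpl.
  - apply (ex_derive_continuous (V := R_NormedModule)). auto_derive. trivial.
  - apply (continuous_plus (V := R_NormedModule) (fun t => sum_f_R0 (fun k => c k * t ^ k) n)).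
    + exact IH.
    + apply (ex_derive_continuous (V := R_NormedModule)). auto_derive. trivial. }
assert (Cgp : forall n t, 0 < t -> continuous (fun t => gamma_integrand a t * p n t) t).
{ intros n t Ht. apply (continuous_mult (K := R_AbsRing)); [now apply gamma_integrand_continuous|apply Cp]. }
assert (Cgf : forall t, 0 < t -> continuous (fun t => gamma_integrand a t * f t) t).
{ intros t Ht. apply (continuous_mult (K := R_AbsRing)); [now apply gamma_integrand_continuous|now apply Cf]. }
assert (Pp : forall n t, 0 <= t -> 0 <= p n t).
{ intros n t Ht. apply cond_pos_sum. intros k. apply Rmult_le_pos; [apply Hc|now apply pow_le]. }
assert (Pf : forall n t, 0 <= t -> p n t <= f t).
{ intros n t Ht. apply (infinite_sum_partial_le (fun k => c k * t ^ k)); [|now apply Hf].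
  intros k. apply Rmult_le_pos; [apply Hc|now apply pow_le]. }
set (S_ := fun n => sum_f_R0 (fun k => c k * rising a k) n).
assert (HS : forall n, sup_integral (fun t => gamma_integrand a t * p n t) (g * S_ n)).
{ intros n. apply sup_integral_ImproperInt0inf.
  - apply continuous_locally_integrable, Cgp.
  - intros t Ht. apply Rmult_le_pos; [left; apply gamma_integrand_pos|apply Pp; lra].
  - unfold S_. rewrite scal_sum.
    rewrite (sum_eq _ (fun k => c k * (rising a k * g))) by (intros; ring).
    now apply ImproperInt0inf_gamma_poly. }
assert (HSL : forall n, S_ n <= L).
{ intros n. apply (infinite_sum_partial_le (fun k => c k * rising a k)); [|exact HL].
  intros k. apply Rmult_le_pos; [apply Hc|left; now apply rising_pos]. }
split.
- intros x y Hx Hxy. apply Rnot_lt_le; intros Hlt.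
  set (I := RInt (fun t => gamma_integrand a t * f t) x y) in *.
  (* The excess is written [e * g + e]: replacing the series by its partial sum costs at most
     [e * g], which leaves the slack [e] for the contradiction. *)
  assert (He : 0 < (I - g * L) / (g + 1)) by (apply Rdiv_lt_0_compat; lra).
  destruct (Hf y ltac:(lra) _ He) as [n Hn]. specialize (Hn n (Nat.le_refl n)).
  fold (p n y) in Hn. unfold Rdist in Hn. apply Rabs_lt_between in Hn.
  set (e := (I - g * L) / (g + 1)) in *.
  assert (Ee : I - g * L = e * g + e) by (unfold e; field; lra).
  destruct (HS n) as [U _]. specialize (U x y Hx Hxy). specialize (HSL n).
  assert (Ex1 : ex_RInt (fun t => gamma_integrand a t * p n t) x y)
    by (apply continuous_locally_integrable; [exact (Cgp n)|lra|lra]).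
  assert (Ex2 : ex_RInt (gamma_integrand a) x y)
    by (apply continuous_locally_integrable; trivial; apply gamma_integrand_continuous).
  assert (Ex3 : ex_RInt (fun t => e * gamma_integrand a t) x y)
    by exact (ex_RInt_scal _ x y e Ex2).
  assert (B : I <= RInt (fun t => gamma_integrand a t * p n t) x y + e * RInt (gamma_integrand a) x y).
  { replace (e * RInt (gamma_integrand a) x y) with (RInt (fun t => e * gamma_integrand a t) x y)
      by exact (RInt_scal _ x y e Ex2).
    replace (RInt (fun t => gamma_integrand a t * p n t) x y + RInt (fun t => e * gamma_integrand a t) x y)
      with (RInt (fun t => gamma_integrand a t * p n t + e * gamma_integrand a t) x y)
      by exact (RInt_plus _ _ x y Ex1 Ex3).
    apply RInt_le; trivial.
    - apply continuous_locally_integrable; trivial.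
    - exact (ex_RInt_plus _ _ x y Ex1 Ex3).
    - intros t Ht.
      assert (T := power_series_tail_le c f n t y Hc ltac:(lra) (Hf t ltac:(lra)) (Hf y ltac:(lra))).
      fold (p n t) (p n y) in T. assert (G := gamma_integrand_pos a t). nra. }
  specialize (Ug x y Hx Hxy). nra.
- intros eps Heps.
  assert (He : 0 < eps / 2 / (g + 1)) by (apply Rdiv_lt_0_compat; lra).
  destruct (HL _ He) as [n Hn]. specialize (Hn n (Nat.le_refl n)).
  fold (S_ n) in Hn. unfold Rdist in Hn. apply Rabs_lt_between in Hn.
  destruct (HS n) as [_ W]. destruct (W (eps / 2)) as (x & y & Hx & Hxy & B); [lra|].
  exists x, y. split; [exact Hx|]. split; [exact Hxy|].
  assert (RInt (fun t => gamma_integrand a t * p n t) x y <= RInt (fun t => gamma_integrand a t * f t) x y).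
  { apply RInt_le; trivial; try (apply continuous_locally_integrable; trivial; exact (Cgp n)).
    intros t Ht. apply Rmult_le_compat_l; [left; apply gamma_integrand_pos|apply Pf; lra]. }
  set (e := eps / 2 / (g + 1)) in *.
  assert (Ee : eps / 2 = e * g + e) by (unfold e; field; lra).
  nra.
Qed.

Lemma sup_integral_subst_pow4 f l k : 0 < k -> (forall t, 0 < t -> continuous f t) ->
  sup_integral f l -> sup_integral (fun s => 4 * k * s ^ 3 * f (k * s ^ 4)) l.
Proof.
intros Hk Cf [U W].
assert (E : forall x y, 0 < x -> x <= y ->
  RInt (fun s => 4 * k * s ^ 3 * f (k * s ^ 4)) x y = RInt f (k * x ^ 4) (k * y ^ 4)).
{ intros x y Hx Hxy.
  rewrite <- (RInt_comp f (fun s => k * s ^ 4) (fun s => 4 * k * s ^ 3)).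
  - reflexivity.
  - intros s Hs. rewrite Rmin_left in Hs by lra. apply Cf.
    apply Rmult_lt_0_compat; [exact Hk|]. apply pow_lt; lra.
  - intros s _. split.
    + auto_derive; [trivial|ring].
    + apply (ex_derive_continuous (V := R_NormedModule)). auto_derive. trivial. }
split.
- intros a b Ha Hab. rewrite E by lra. apply U.
  + apply Rmult_lt_0_compat; [exact Hk|now apply pow_lt].
  + apply Rmult_le_compat_l; [lra|]. apply pow_incr; lra.
- intros eps Heps. destruct (W eps Heps) as (a & b & Ha & Hab & B).
  assert (Q : forall x, 0 < x -> k * sqrt (sqrt (x / k)) ^ 4 = x).
  { intros x Hx. assert (0 < x / k) by now apply Rdiv_lt_0_compat.
    replace (sqrt (sqrt (x / k)) ^ 4) with ((sqrt (sqrt (x / k)) ^ 2) ^ 2) by ring.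
    rewrite !pow2_sqrt; [field; lra|lra|apply sqrt_pos]. }
  assert (0 < a / k) by now apply Rdiv_lt_0_compat.
  assert (0 < sqrt (sqrt (a / k))) by now apply sqrt_lt_R0, sqrt_lt_R0.
  assert (sqrt (sqrt (a / k)) <= sqrt (sqrt (b / k))).
  { apply sqrt_le_1_alt, sqrt_le_1_alt. apply Rmult_le_compat_r; [|exact Hab].
    left; now apply Rinv_0_lt_compat. }
  exists (sqrt (sqrt (a / k))), (sqrt (sqrt (b / k))).
  split; [assumption|]. split; [assumption|].
  rewrite E by assumption. rewrite !Q by lra. exact B.
Qed.

(** * The limit law and its moments *)

(* P(|W| > r) for a normal variable W with mean mu and standard deviation sg. *)
Definition abs_normal_tail (mu sg r : R) : R := Phi ((mu - r) / sg) + Phi ((- mu - r) / sg).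

(* The limit S is the square root of |W|. *)
Definition limit_cdf (mu sg s : R) : R := 1 - abs_normal_tail mu sg (Rmax 0 s ^ 2).

Lemma abs_normal_tail_0 mu sg : sg <> 0 -> abs_normal_tail mu sg 0 = 1.
Proof.
intros H. unfold abs_normal_tail.
replace ((- mu - 0) / sg) with (- ((mu - 0) / sg)) by (field; exact H).
rewrite Phi_opp. ring.
Qed.

Lemma abs_normal_tail_derive mu sg r : 0 < sg -> is_derive (abs_normal_tail mu sg) r
  (- (gauss ((mu - r) / sg) + gauss ((- mu - r) / sg)) / (2 * half_mass * sg)).
Proof.
intros Hsg. assert (Hc := half_mass_pos). unfold abs_normal_tail. evar_last.
- apply (is_derive_plus (V := R_NormedModule));
    (apply (is_derive_comp Phi); [apply Phi_derive|auto_derive; [lra|reflexivity]]).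
- unfold plus, scal; simpl; unfold mult; simpl. field. lra.
Qed.

Lemma abs_normal_tail_continuous mu sg r : 0 < sg -> continuous (abs_normal_tail mu sg) r.
Proof.
intros Hsg. apply (ex_derive_continuous (V := R_NormedModule)).
eexists. now apply abs_normal_tail_derive.
Qed.

Lemma abs_normal_tail_le mu sg r1 r2 : 0 < sg -> r1 <= r2 ->
  abs_normal_tail mu sg r2 <= abs_normal_tail mu sg r1.
Proof.
intros Hsg Hr. assert (H : 0 < / sg) by now apply Rinv_0_lt_compat.
apply Rplus_le_compat; apply Phi_le; apply Rmult_le_compat_r; lra.
Qed.

Lemma abs_normal_tail_ge0 mu sg r : 0 <= abs_normal_tail mu sg r.
Proof. apply Rplus_le_le_0_compat; apply Phi_ge0. Qed.

(** The square root of a normal variable has exponential moments of every order: [Phi_tail] at rate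
    [k * sg] gives decay in [k s^2], and [s <= s^2 + 1] turns it into decay in [k s]. *)
Lemma abs_normal_tail_sqr_exp mu sg k : 0 < sg -> 0 < k -> exists C, 0 < C /\
  forall s, abs_normal_tail mu sg (s ^ 2) <= C * exp (- k * s).
Proof.
intros Hsg Hk.
destruct (Phi_tail (k * sg)) as (C & HC & HT); [nra|].
exists (C * (exp (k + k * mu) + exp (k - k * mu))). split.
- apply Rmult_lt_0_compat; [exact HC|]. assert (H1 := exp_pos (k + k * mu)).
  assert (H2 := exp_pos (k - k * mu)). lra.
- intros s.
  assert (P : forall m, Phi ((m - s ^ 2) / sg) <= C * exp (k + k * m) * exp (- k * s)).
  { intros m. assert (H := HT ((s ^ 2 - m) / sg)).
    replace ((m - s ^ 2) / sg) with (- ((s ^ 2 - m) / sg)) by (field; lra).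
    rewrite Phi_opp. eapply Rle_trans; [exact H|].
    rewrite Rmult_assoc, <- exp_plus. apply Rmult_le_compat_l; [lra|].
    replace (- (k * sg) * ((s ^ 2 - m) / sg)) with (- k * (s ^ 2 - m)) by (field; lra).
    apply Rnot_lt_le; intros Hlt. apply exp_lt_inv in Hlt.
    assert (0 <= k * (s - 1) ^ 2) by (apply Rmult_le_pos; [lra|apply pow2_ge_0]).
    assert (0 <= k * (s * s)) by (apply Rmult_le_pos; [lra|apply Rle_0_sqr]). nra. }
  assert (P1 := P mu). assert (P2 := P (- mu)). unfold abs_normal_tail.
  replace (k + k * - mu) with (k - k * mu) in P2 by ring. lra.
Qed.

Lemma limit_cdf_pos mu sg s : 0 <= s -> limit_cdf mu sg s = 1 - abs_normal_tail mu sg (s ^ 2).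
Proof. intros Hs. unfold limit_cdf. now rewrite Rmax_right. Qed.

Lemma limit_cdf_neg mu sg s : sg <> 0 -> s <= 0 -> limit_cdf mu sg s = 0.
Proof.
intros Hsg Hs. unfold limit_cdf. rewrite Rmax_left by exact Hs.
replace (0 ^ 2) with 0 by ring. rewrite abs_normal_tail_0 by exact Hsg. ring.
Qed.

Lemma limit_cdf_continuous mu sg s : 0 < sg -> continuous (limit_cdf mu sg) s.
Proof.
intros Hsg. unfold limit_cdf.
apply (continuous_minus (V := R_NormedModule)); [apply continuous_const|].
apply (continuous_comp (fun s => Rmax 0 s ^ 2) (abs_normal_tail mu sg)).
- apply (continuous_comp (fun s => Rmax 0 s) (fun x => x ^ 2)).
  + apply (continuous_ext (fun s => (s + Rabs s) * / 2)).
    { intros x. unfold Rmax, Rabs. destruct (Rle_dec 0 x), (Rcase_abs x); lra. }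
    apply (continuous_mult (K := R_AbsRing)); [|apply continuous_const].
    apply (continuous_plus (V := R_NormedModule)); [apply continuous_id|].
    apply continuous_Rabs.
  + apply (ex_derive_continuous (V := R_NormedModule)). auto_derive. trivial.
- now apply abs_normal_tail_continuous.
Qed.

Lemma limit_cdf_eps mu sg s eps : 0 < sg -> 0 < eps -> exists d, 0 < d /\
  forall t, Rabs (t - s) < d -> Rabs (limit_cdf mu sg t - limit_cdf mu sg s) < eps.
Proof.
intros Hsg Heps.
assert (H := limit_cdf_continuous mu sg s Hsg).
destruct (proj1 (filterlim_locally _ _) H (mkposreal eps Heps)) as [d Hd].
exists d. split; [apply cond_pos|]. intros t Ht. exact (Hd t Ht).
Qed.

Lemma limit_cdf_is_cdf mu sg : 0 < sg -> is_cdf (limit_cdf mu sg).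
Proof.
intros Hsg. split; [|split; [|split]].
- intros s t Hst. unfold limit_cdf.
  assert (abs_normal_tail mu sg (Rmax 0 t ^ 2) <= abs_normal_tail mu sg (Rmax 0 s ^ 2)); [|lra].
  apply abs_normal_tail_le; [exact Hsg|]. apply pow_incr. split; [apply Rmax_l|].
  now apply Rle_max_compat_l.
- intros s eps Heps. destruct (limit_cdf_eps mu sg s eps Hsg Heps) as (d & Hd & K).
  exists d. split; [exact Hd|]. intros t Ht. apply K. apply Rabs_lt_between. lra.
- intros eps Heps. exists 0. intros t Ht.
  rewrite limit_cdf_neg, Rabs_R0 by lra. exact Heps.
- intros eps Heps.
  destruct (abs_normal_tail_sqr_exp mu sg 1 Hsg Rlt_0_1) as (C & HC & HT).
  assert (HCe : 0 < C / eps) by now apply Rdiv_lt_0_compat.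
  exists (C / eps). intros t Ht. rewrite limit_cdf_pos by lra.
  assert (H0 := abs_normal_tail_ge0 mu sg (t ^ 2)).
  replace (1 - abs_normal_tail mu sg (t ^ 2) - 1) with (- abs_normal_tail mu sg (t ^ 2)) by ring.
  rewrite Rabs_Ropp, Rabs_pos_eq by exact H0.
  eapply Rle_lt_trans; [apply HT|].
  replace (- (1) * t) with (- t) by ring. rewrite exp_Ropp.
  assert (He := exp_ineq1_le t).
  apply Rmult_lt_reg_r with (exp t); [apply exp_pos|].
  replace (C * / exp t * exp t) with (C / eps * eps) by (field; split; [|lra]; apply Rgt_not_eq, exp_pos).
  rewrite Rmult_comm. apply Rmult_lt_compat_l; lra.
Qed.

(** The left side is [t^q] times the density of the limit law. Expanding both squares yields
    [exp (-M) exp (-k t^4)] times a hyperbolic cosine, with [M = mu^2 / (2 sg^2)] and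
    [k = 1 / (2 sg^2)]; this is a Gamma integrand at [k t^4] together with the Jacobian
    [4 k t^3]. *)
Lemma limit_density_gamma mu sg q t : 0 < sg -> 0 < t ->
  Rpower t q * (2 * t * (gauss ((mu - t ^ 2) / sg) + gauss ((- mu - t ^ 2) / sg)) / (2 * half_mass * sg))
  = exp (- (mu ^ 2 / (2 * sg ^ 2))) * Rpower (2 * sg ^ 2) (q / 4) / (sqrt 2 * half_mass)
    * (4 * / (2 * sg ^ 2) * t ^ 3 *
       (gamma_integrand (1 / 2 + q / 4) (/ (2 * sg ^ 2) * t ^ 4)
        * cosh (2 * sqrt (mu ^ 2 / (2 * sg ^ 2) * (/ (2 * sg ^ 2) * t ^ 4))))).
Proof.
intros Hsg Ht. assert (Hc := half_mass_pos).
set (M := mu ^ 2 / (2 * sg ^ 2)). set (k := / (2 * sg ^ 2)).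
assert (Hsg2 : 0 < 2 * sg ^ 2) by nra.
assert (Hk : 0 < k) by now apply Rinv_0_lt_compat.
assert (Ht4 : 0 < t ^ 4) by now apply pow_lt.
assert (Eg : gauss ((mu - t ^ 2) / sg) + gauss ((- mu - t ^ 2) / sg) =
  exp (- M) * exp (- (k * t ^ 4)) * (2 * cosh (mu * t ^ 2 / sg ^ 2))).
{ unfold gauss, cosh.
  replace (2 * ((exp (mu * t ^ 2 / sg ^ 2) + exp (- (mu * t ^ 2 / sg ^ 2))) / 2))
    with (exp (mu * t ^ 2 / sg ^ 2) + exp (- (mu * t ^ 2 / sg ^ 2))) by field.
  rewrite Rmult_plus_distr_l, <- !exp_plus. unfold M, k.
  f_equal; f_equal; field; lra. }
assert (Ec : cosh (2 * sqrt (M * (k * t ^ 4))) = cosh (mu * t ^ 2 / sg ^ 2)).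
{ replace (M * (k * t ^ 4)) with (Rsqr (mu * t ^ 2 / (2 * sg ^ 2)))
    by (unfold Rsqr, M, k; field; lra).
  rewrite sqrt_Rsqr_abs. unfold Rabs. destruct Rcase_abs.
  - replace (2 * - (mu * t ^ 2 / (2 * sg ^ 2))) with (- (mu * t ^ 2 / sg ^ 2)) by (field; lra).
    unfold cosh. rewrite Ropp_involutive. f_equal. ring.
  - f_equal. field. lra. }
rewrite Eg, Ec. unfold gamma_integrand.
replace (1 / 2 + q / 4 - 1) with (q / 4 + - / 2) by field.
assert (Ep : Rpower (k * t ^ 4) (q / 4 + - / 2) =
  Rpower (2 * sg ^ 2) (- (q / 4)) * (sqrt 2 * sg) * (Rpower t q * / t ^ 2)).
{ rewrite <- Rpower_mult_distr by assumption. f_equal.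
  - unfold k.
    replace (/ (2 * sg ^ 2)) with (Rpower (2 * sg ^ 2) (- (1))).
    2: { rewrite Rpower_Ropp, Rpower_1 by exact Hsg2. reflexivity. }
    rewrite Rpower_mult.
    replace (- (1) * (q / 4 + - / 2)) with (- (q / 4) + / 2) by ring.
    rewrite Rpower_plus, Rpower_sqrt by exact Hsg2. f_equal.
    rewrite sqrt_mult by nra. rewrite sqrt_pow2 by lra. reflexivity.
  - replace (t ^ 4) with (Rpower t 4) by (rewrite <- Rpower_pow by exact Ht; f_equal; simpl; ring).
    rewrite Rpower_mult.
    replace (4 * (q / 4 + - / 2)) with (q + - (2)) by field.
    rewrite Rpower_plus, Rpower_Ropp. do 2 f_equal.
    rewrite <- Rpower_pow by exact Ht. f_equal. }
rewrite Ep, Rpower_Ropp.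
assert (H2 : 0 < sqrt 2) by (apply sqrt_lt_R0; lra).
assert (Hq := Rpower_pos (2 * sg ^ 2) (q / 4)).
unfold k at 2. field. repeat split; lra.
Qed.

(** The density form of the moment is integrated termwise after the substitution [k s^4].
    Integration by parts with boundary function [t^q P(S > t)] then returns to the tail form used by
    [moment]. *)
Lemma limit_cdf_moment mu sg q g1 g0 L : 0 < sg -> 0 < q ->
  IsGamma (1/2 + q/4) g1 -> IsGamma (1/2) g0 ->
  infinite_sum (kummer_term (1/2 + q/4) (1/2) (mu ^ 2 / (2 * sg ^ 2))) L ->
  moment (limit_cdf mu sg) q
    (exp (- (mu ^ 2 / (2 * sg ^ 2))) * Rpower (2 * sg ^ 2) (q / 4) / g0 * (g1 * L)).
Proof.
intros Hsg Hq Hg1 Hg0 HL. assert (Hc := half_mass_pos).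
assert (Hsg2 : 0 < 2 * sg ^ 2) by nra.
set (M := mu ^ 2 / (2 * sg ^ 2)) in *. set (k := / (2 * sg ^ 2)).
assert (Hk : 0 < k) by now apply Rinv_0_lt_compat.
assert (HM : 0 <= M).
{ apply Rmult_le_pos; [apply pow2_ge_0|]. left; now apply Rinv_0_lt_compat. }
rewrite (IsGamma_half g0 Hg0).
set (K := exp (- M) * Rpower (2 * sg ^ 2) (q / 4) / (sqrt 2 * half_mass)).
set (f := fun t => gamma_integrand (1/2 + q/4) t * cosh (2 * sqrt (M * t))).
assert (Cc : forall t, 0 < t -> continuous (fun t => cosh (2 * sqrt (M * t))) t).
{ intros t Ht. unfold cosh.
  assert (Cs : continuous (fun t => 2 * sqrt (M * t)) t).
  { apply (continuous_mult (K := R_AbsRing)); [apply continuous_const|].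
    apply (continuous_comp (fun t => M * t) sqrt).
    - apply (ex_derive_continuous (V := R_NormedModule)). auto_derive. trivial.
    - apply continuous_sqrt. }
  apply (continuous_comp (fun t => 2 * sqrt (M * t)) (fun x => (exp x + exp (- x)) / 2)).
  - exact Cs.
  - apply (ex_derive_continuous (V := R_NormedModule)). auto_derive. trivial. }
assert (Cf : forall t, 0 < t -> continuous f t).
{ intros t Ht. apply (continuous_mult (K := R_AbsRing)).
  - now apply gamma_integrand_continuous.
  - now apply Cc. }
assert (Pc : forall x, 0 < cosh x).
{ intros x. unfold cosh. assert (H1 := exp_pos x). assert (H2 := exp_pos (- x)). lra. }
assert (Hsup : sup_integral f (g1 * L)).
{ apply (sup_integral_gamma_series (1/2 + q/4) g1 (fun n => M ^ n / (rising (1/2) n * INR (fact n)))); trivial.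
  - lra.
  - intros n. apply Rmult_le_pos; [now apply pow_le|].
    left; apply Rinv_0_lt_compat, Rmult_lt_0_compat; [apply rising_pos; lra|apply INR_fact_lt_0].
  - intros t Ht. now apply cosh_sqrt_infinite_sum.
  - apply is_series_Reals. eapply is_series_ext; [|apply is_series_Reals, HL].
    intros n. unfold kummer_term, Rdiv. simpl. ring. }
apply (sup_integral_subst_pow4 f _ k Hk Cf) in Hsup.
set (h := fun s => 4 * k * s ^ 3 * f (k * s ^ 4)) in Hsup.
assert (Ch : forall t, 0 < t -> continuous h t).
{ intros t Ht. apply (continuous_mult (K := R_AbsRing)).
  - apply (ex_derive_continuous (V := R_NormedModule)). auto_derive. trivial.
  - apply (continuous_comp (fun s => k * s ^ 4) f).
    + apply (ex_derive_continuous (V := R_NormedModule)). auto_derive. trivial.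
    + apply Cf, Rmult_lt_0_compat; [exact Hk|now apply pow_lt]. }
apply sup_integral_ImproperInt0inf in Hsup; [|now apply continuous_locally_integrable|].
2: { intros t Ht. apply Rmult_le_pos.
     - apply Rmult_le_pos; [lra|]. left; now apply pow_lt.
     - apply Rmult_le_pos; left; [apply gamma_integrand_pos|apply Pc]. }
apply (ImproperInt0inf_scal _ _ K) in Hsup.
unfold moment.
apply (ImproperInt0inf_ext (fun s => q * Rpower s (q - 1) * abs_normal_tail mu sg (s ^ 2))).
{ intros t Ht. rewrite limit_cdf_pos by lra. ring. }
revert Hsup.
apply (ImproperInt0inf_parts _ _ (fun t => Rpower t q * abs_normal_tail mu sg (t ^ 2))).
- intros t Ht. apply (continuous_mult (K := R_AbsRing)); [apply continuous_const|now apply Ch].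
- intros t Ht. apply (continuous_mult (K := R_AbsRing)).
  + apply (continuous_mult (K := R_AbsRing)); [apply continuous_const|now apply Rpower_continuous].
  + apply (continuous_comp (fun t => t ^ 2) (abs_normal_tail mu sg)).
    * apply (ex_derive_continuous (V := R_NormedModule)). auto_derive. trivial.
    * now apply abs_normal_tail_continuous.
- intros t Ht. unfold h, f, K, M, k. rewrite <- limit_density_gamma by assumption.
  evar_last.
  + apply (is_derive_mult (fun t => Rpower t q) (fun t => abs_normal_tail mu sg (t ^ 2))).
    * now apply Rpower_is_derive.
    * apply (is_derive_comp (abs_normal_tail mu sg) (fun t => t ^ 2)).
      -- now apply abs_normal_tail_derive.
      -- auto_derive; [trivial|reflexivity].
    * intros; apply Rmult_comm.
  + unfold plus, scal, mult; simpl; unfold mult; simpl. field. lra.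
- intros eps Heps. destruct (Rpower_small q eps Hq Heps) as (d & Hd & Hs).
  exists d. split; [exact Hd|]. intros t Ht. specialize (Hs t Ht).
  assert (H0 := abs_normal_tail_ge0 mu sg (t ^ 2)). assert (Hp := Rpower_pos t q).
  assert (H1 : abs_normal_tail mu sg (t ^ 2) <= 1).
  { rewrite <- (abs_normal_tail_0 mu sg) by lra. apply abs_normal_tail_le; [exact Hsg|apply pow2_ge_0]. }
  rewrite Rabs_pos_eq by (apply Rmult_le_pos; lra). nra.
- intros eps Heps.
  destruct (abs_normal_tail_sqr_exp mu sg 2 Hsg ltac:(lra)) as (C & HC & HT).
  destruct (Rpower_le_exp q Hq) as (B & HB & HP).
  assert (HCB : 0 < C * B) by now apply Rmult_lt_0_compat.
  exists (C * B / eps). split; [now apply Rdiv_lt_0_compat|]. intros t Ht.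
  assert (Ht0 : 0 < t) by (apply Rlt_trans with (2 := Ht); now apply Rdiv_lt_0_compat).
  assert (H0 := abs_normal_tail_ge0 mu sg (t ^ 2)). assert (Hp := Rpower_pos t q).
  rewrite Rabs_pos_eq by (apply Rmult_le_pos; lra).
  specialize (HT t). specialize (HP t Ht0).
  apply Rle_lt_trans with ((B * exp t) * (C * exp (- (2) * t))).
  { apply Rmult_le_compat; lra. }
  replace (B * exp t * (C * exp (- (2) * t))) with (C * B * exp (- t)).
  2: { replace (- t) with (t + - (2) * t) by ring. rewrite exp_plus. ring. }
  assert (He := exp_ineq1_le t). rewrite exp_Ropp.
  apply Rmult_lt_reg_r with (exp t); [apply exp_pos|].
  replace (C * B * / exp t * exp t) with (C * B / eps * eps)
    by (field; split; [|lra]; apply Rgt_not_eq, exp_pos).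
  rewrite Rmult_comm. apply Rmult_lt_compat_l; lra.
Qed.

(** Here [mu^2 / (2 sg^2) = 3 z0^2 / (2 T)] is minus the argument of Kummer's function, and
    [2 sg^2 = (2/3) T^3] supplies both power factors. Kummer's transformation turns the parameter
    [1/2 + q/4] into [- q/4]. *)
Lemma limit_cdf_moment_identity T z0 : 0 < T ->
  moment_identity T z0 (limit_cdf (z0 * T) (sqrt (T ^ 3 / 3))).
Proof.
intros HT q Hq g1 g0 h Hg1 Hg0 Hh.
assert (HT3 : 0 < T ^ 3) by now apply pow_lt.
assert (Hsg : 0 < sqrt (T ^ 3 / 3)) by (apply sqrt_lt_R0; lra).
assert (Es : sqrt (T ^ 3 / 3) ^ 2 = T ^ 3 / 3) by (apply pow2_sqrt; lra).
assert (EM : (z0 * T) ^ 2 / (2 * sqrt (T ^ 3 / 3) ^ 2) = 3 * (z0 ^ 2 / (2 * T)))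
  by (rewrite Es; field; lra).
assert (HM : 0 <= 3 * (z0 ^ 2 / (2 * T))).
{ apply Rmult_le_pos; [lra|]. apply Rmult_le_pos; [apply pow2_ge_0|].
  left; apply Rinv_0_lt_compat; lra. }
destruct (kummer_transformation (1/2 + q/4) (1/2) (3 * (z0 ^ 2 / (2 * T)))) as (L & HL & HK); try lra.
assert (Eh : h = exp (- (3 * (z0 ^ 2 / (2 * T)))) * L).
{ apply (uniqueness_sum _ _ _ Hh).
  replace (- (3 * q / 4 / 3)) with (1 / 2 - (1 / 2 + q / 4)) by field.
  replace (-3 * (z0 ^ 2 / (2 * T))) with (- (3 * (z0 ^ 2 / (2 * T)))) by ring. exact HK. }
assert (H := limit_cdf_moment (z0 * T) (sqrt (T ^ 3 / 3)) q g1 g0 L Hsg Hq Hg1 Hg0).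
rewrite EM, Es in H. specialize (H HL).
replace (Rpower (2 / 3) (q / 4) * (g1 / g0) * Rpower T (3 * q / 4) * h) with
  (exp (- (3 * (z0 ^ 2 / (2 * T)))) * Rpower (2 * (T ^ 3 / 3)) (q / 4) / g0 * (g1 * L)); [exact H|].
replace (2 * (T ^ 3 / 3)) with (2 / 3 * T ^ 3) by field.
rewrite <- Rpower_mult_distr by lra.
replace (Rpower (T ^ 3) (q / 4)) with (Rpower T (3 * q / 4)).
2: { rewrite <- Rpower_pow by exact HT. rewrite Rpower_mult. f_equal. simpl. field. }
rewrite Eh. unfold Rdiv. ring.
Qed.

(** [moment_identity] only speaks about given Gamma and Kummer values, so their existence has to be
    supplied. The value [m] is chosen before [G]: all laws satisfying the identity share their
    moments. *)
Lemma moment_identity_value T z0 q : 0 < T -> 0 < q ->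
  exists m, forall G, moment_identity T z0 G -> moment G q m.
Proof.
intros HT Hq.
destruct (IsGamma_exists (1/2 + q/4)) as [g1 Hg1]; [lra|].
destruct (IsGamma_exists (1/2)) as [g0 Hg0]; [lra|].
destruct (kummer_transformation (1/2 + q/4) (1/2) (3 * (z0 ^ 2 / (2 * T)))) as (L & _ & HK); try lra.
{ apply Rmult_le_pos; [lra|]. apply Rmult_le_pos; [apply pow2_ge_0|].
  left; apply Rinv_0_lt_compat; lra. }
eexists. intros G HG. apply (HG q Hq g1 g0 (exp (- (3 * (z0 ^ 2 / (2 * T)))) * L) Hg1 Hg0).
replace (- (3 * q / 4 / 3)) with (1 / 2 - (1 / 2 + q / 4)) by field.
replace (-3 * (z0 ^ 2 / (2 * T))) with (- (3 * (z0 ^ 2 / (2 * T)))) by ring. exact HK.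
Qed.

(** * Determinacy of the moment problem *)

Lemma Derive_n_exp_opp k t : Derive_n (fun t => exp (- t)) k t = (-1) ^ k * exp (- t).
Proof.
revert t; induction k as [|k IH]; intros t; [simpl; ring|].
simpl Derive_n. rewrite (Derive_ext _ _ _ IH).
apply is_derive_unique. auto_derive; [trivial|simpl; ring].
Qed.

(** Lagrange's remainder: on the positive axis all derivatives of [exp (- t)] are bounded by 1, so
    the estimate is uniform in the order. *)
Lemma exp_opp_taylor y n : 0 < y ->
  Rabs (exp (- y) - sum_f_R0 (fun j => (- y) ^ j / INR (fact j)) n) <= y ^ S n / INR (fact (S n)).
Proof.
intros Hy.
destruct (Taylor_Lagrange (fun t => exp (- t)) n 0 y Hy) as (z & Hz & E).
{ intros t _ [|k] _; [exact I|]. simpl.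
  apply (ex_derive_ext (fun t => (-1) ^ k * exp (- t))).
  - intros s. symmetry. apply Derive_n_exp_opp.
  - auto_derive. trivial. }
rewrite Derive_n_exp_opp in E. rewrite Rminus_0_r in E.
rewrite (sum_eq _ (fun j => (- y) ^ j / INR (fact j))) in E.
2: { intros i _. rewrite Derive_n_exp_opp, Ropp_0, exp_0.
     replace (- y) with (-1 * y) by ring. rewrite Rpow_mult_distr. unfold Rdiv. ring. }
rewrite E.
match goal with |- Rabs (?s + ?r - ?s) <= _ => replace (s + r - s) with r by ring end.
rewrite !Rabs_mult, pow_1_abs, Rmult_1_l.
assert (Hf : 0 < y ^ S n / INR (fact (S n))).
{ apply Rdiv_lt_0_compat; [now apply pow_lt|apply INR_fact_lt_0]. }
rewrite (Rabs_pos_eq (_ / _)) by lra.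
rewrite (Rabs_pos_eq (exp _)) by (left; apply exp_pos).
assert (exp (- z) <= 1) by (rewrite <- exp_0; left; apply exp_increasing; lra).
nra.
Qed.

Lemma ImproperInt0inf_poly (A : R -> R) (m c : nat -> R) n J :
  (forall k, ImproperInt0inf (fun s => s ^ k * A s) (m k)) ->
  ImproperInt0inf (fun s => s ^ n * sum_f_R0 (fun j => c j * s ^ j) J * A s)
    (sum_f_R0 (fun j => c j * m (n + j)%nat) J).
Proof.
intros Hm. induction J as [|J IH].
- simpl sum_f_R0. apply (ImproperInt0inf_ext (fun s => c 0%nat * (s ^ (n + 0) * A s))).
  + intros t _. rewrite Nat.add_0_r. ring.
  + apply (ImproperInt0inf_scal (fun s => s ^ (n + 0) * A s)), Hm.
- rewrite tech5.
  apply (ImproperInt0inf_ext (fun s => s ^ n * sum_f_R0 (fun j => c j * s ^ j) J * A s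
     + c (S J) * (s ^ (n + S J) * A s))).
  + intros t _. rewrite tech5, pow_add. ring.
  + apply ImproperInt0inf_plus; [exact IH|].
    apply (ImproperInt0inf_scal (fun s => s ^ (n + S J) * A s)), Hm.
Qed.

Lemma is_derive_gamma_ge n l s : 0 < l -> 0 < s ->
  is_derive (fun s => gamma_ge (S n) (l * s)) s
    (- (l * (l * s) ^ n / INR (fact n) * exp (- (l * s)))).
Proof.
intros Hl Hs.
(* [gamma_ge] has a separate case for nonpositive times, so the formula holds only in a
   neighbourhood of the positive point [s]. The derivative then telescopes in [n]. *)
apply (is_derive_ext_loc (fun s => exp (- (l * s)) * sum_f_R0 (fun j => (l * s) ^ j / INR (fact j)) n)).
{ exists (mkposreal s Hs). intros y Hy. simpl in Hy.
  unfold ball in Hy; simpl in Hy. unfold AbsRing_ball, abs, minus, plus, opp in Hy; simpl in Hy.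
  apply Rabs_lt_between in Hy. rewrite gamma_ge_pos_succ; [reflexivity|].
  apply Rmult_lt_0_compat; lra. }
induction n as [|n IH].
- simpl. auto_derive; [trivial|field].
- assert (Hf := INR_fact_neq_0 n). assert (Hn := pos_INR n).
  apply (is_derive_ext (fun s => exp (- (l * s)) * sum_f_R0 (fun j => (l * s) ^ j / INR (fact j)) n
     + exp (- (l * s)) * ((l * s) ^ S n / INR (fact (S n))))).
  { intros t. rewrite tech5. apply eq_sym, Rmult_plus_distr_l. }
  evar_last.
  + apply (is_derive_plus (V := R_NormedModule)); [exact IH|].
    auto_derive; [trivial|reflexivity].
  + match goal with |- plus ?u ?v = ?w => change (u + v = w) end.
    change (fact n + n * fact n)%nat with (S n * fact n)%nat.
    change (match n with 0%nat => 1 | S _ => INR n + 1 end) with (INR (S n)).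
    simpl pred. rewrite fact_simpl, !mult_INR, S_INR. simpl pow. field. lra.
Qed.

(** The density of the jump number [n + 1] of a Poisson process of rate [l]. The Chebyshev bounds
    for the clock thereby serve a second time, as concentration of an approximate identity. *)
Definition gamma_kernel (l : R) (n : nat) (s : R) : R := l * (l * s) ^ n / INR (fact n) * exp (- (l * s)).

Lemma gamma_kernel_continuous l n s : continuous (gamma_kernel l n) s.
Proof.
apply (ex_derive_continuous (V := R_NormedModule)). unfold gamma_kernel. auto_derive. trivial.
Qed.

Lemma gamma_kernel_ex_RInt l n a b : ex_RInt (gamma_kernel l n) a b.
Proof.
apply (ex_RInt_continuous (V := R_CompleteNormedModule)). intros; apply gamma_kernel_continuous.
Qed.

Lemma RInt_gamma_kernel l n a b : 0 < l -> 0 < a -> a <= b ->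
  RInt (gamma_kernel l n) a b = gamma_ge (S n) (l * a) - gamma_ge (S n) (l * b).
Proof.
intros Hl Ha Hab.
rewrite (RInt_derive (fun s => - gamma_ge (S n) (l * s)) (gamma_kernel l n)); trivial.
- unfold Rminus. rewrite Ropp_involutive. apply Rplus_comm.
- intros t Ht. evar_last.
  + apply (is_derive_opp (V := R_NormedModule)). now apply is_derive_gamma_ge.
  + unfold opp; simpl. apply Ropp_involutive.
- intros; apply gamma_kernel_continuous.
Qed.

Lemma gamma_kernel_pos l n s : 0 < l -> 0 < s -> 0 <= gamma_kernel l n s.
Proof.
intros Hl Hs. apply Rmult_le_pos; [|left; apply exp_pos].
apply Rmult_le_pos; [|left; apply Rinv_0_lt_compat, INR_fact_lt_0].
apply Rmult_le_pos; [lra|]. apply pow_le. apply Rmult_le_pos; lra.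
Qed.

(** The rate [l = (n + 1) / c] puts the mean at the midpoint [c] of [[p, r]], at distance [h] from
    both ends, while the variance [c^2 / (n + 1)] tends to 0. *)
Lemma gamma_kernel_concentrates p r eps : 0 < p -> p < r -> 0 < eps ->
  exists l n, 0 < l /\ 1 - eps <= gamma_ge (S n) (l * p) /\ gamma_ge (S n) (l * r) <= eps.
Proof.
intros Hp Hpr Heps.
set (c := (p + r) / 2). set (h := (r - p) / 2).
assert (Hc : 0 < c) by (unfold c; lra). assert (Hh : 0 < h) by (unfold h; lra).
(* This size of [n] is exactly what brings the Chebyshev bound [r / (l h^2)] below [eps]. *)
destruct (INR_unbounded (c * r / (h ^ 2 * eps))) as [n Hn].
set (l := INR (S n) / c).
assert (HS : 0 < INR (S n)) by (apply lt_0_INR; lia).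
assert (Hl : 0 < l) by now apply Rdiv_lt_0_compat.
assert (Hh2 : 0 < h ^ 2) by now apply pow_lt.
assert (Hlc : l * c = INR (S n)) by (unfold l; field; lra).
assert (Hbig : r / (l * h ^ 2) <= eps).
{ apply Rmult_le_reg_r with (l * h ^ 2); [now apply Rmult_lt_0_compat|].
  replace (r / (l * h ^ 2) * (l * h ^ 2)) with r by (field; lra).
  apply Rmult_le_reg_r with (c / (h ^ 2 * eps)).
  { apply Rdiv_lt_0_compat; [exact Hc|]. now apply Rmult_lt_0_compat. }
  replace (eps * (l * h ^ 2) * (c / (h ^ 2 * eps))) with (l * c) by (field; lra).
  rewrite Hlc, S_INR. replace (r * (c / (h ^ 2 * eps))) with (c * r / (h ^ 2 * eps)) by (field; lra).
  lra. }
exists l, n. split; [exact Hl|].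
assert (Hlh : 0 < l * h) by now apply Rmult_lt_0_compat.
split.
- assert (H := gamma_ge_large (S n) (l * p) (l * h)).
  assert (H' : 1 - gamma_ge (S n) (l * p) <= l * p / (l * h) ^ 2).
  { apply H; [now apply Rmult_lt_0_compat|exact Hlh|]. rewrite <- Hlc. unfold c, h. right. field. }
  assert (l * p / (l * h) ^ 2 <= r / (l * h ^ 2)).
  { replace (l * p / (l * h) ^ 2) with (p / (l * h ^ 2)) by (field; lra).
    apply Rmult_le_compat_r; [left; apply Rinv_0_lt_compat; now apply Rmult_lt_0_compat|lra]. }
  lra.
- assert (H' : gamma_ge (S n) (l * r) <= l * r / (l * h) ^ 2).
  { apply gamma_ge_small; [apply Rmult_lt_0_compat; lra|exact Hlh|].
    rewrite <- Hlc. unfold c, h. right. field. }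
  replace (l * r / (l * h) ^ 2) with (r / (l * h ^ 2)) in H' by (field; lra). lra.
Qed.

Lemma ImproperInt0inf_ge f l B p r : 0 < p -> p < r ->
  ImproperInt0inf f l ->
  (forall a b, 0 < a < p -> r < b -> ex_RInt f a b -> B <= RInt f a b) -> B <= l.
Proof.
rewrite ImproperInt0inf_RInt. intros Hp Hpr H K. apply Rnot_lt_le; intros Hlt.
destruct (H (B - l)) as (d & M & Hd & HM & L); [lra|].
assert (L1 := Rmin_l d p). assert (L2 := Rmin_r d p).
assert (L0 : 0 < Rmin d p) by now apply Rmin_glb_lt.
assert (L3 := Rmax_l M r). assert (L4 := Rmax_r M r).
destruct (L (Rmin d p / 2) (Rmax M r + 1)) as [E1 E2]; [lra..|].
assert (H1 := K (Rmin d p / 2) (Rmax M r + 1) ltac:(lra) ltac:(lra) E1).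
apply Rabs_lt_between in E2. lra.
Qed.

(* If [A x > B x], then [A - B] is bounded below near [x] on the right, while its integral
   against every Gamma density vanishes: the density is a limit of polynomials and the
   moments control the remainder of its Taylor expansion. *)
Lemma moments_determine_tail (A B : R -> R) (m : nat -> R) :
  (forall s, 0 <= A s <= 1) -> (forall s, 0 <= B s <= 1) ->
  (forall s eps, 0 < eps -> exists d, 0 < d /\ forall t, s <= t < s + d -> Rabs (A t - A s) < eps) ->
  (forall s eps, 0 < eps -> exists d, 0 < d /\ forall t, s <= t < s + d -> Rabs (B t - B s) < eps) ->
  (forall k, ImproperInt0inf (fun s => s ^ k * A s) (m k)) ->
  (forall k, ImproperInt0inf (fun s => s ^ k * B s) (m k)) ->
  (forall n l, 0 < l -> exists C, forall J, l ^ J * m (n + J)%nat <= C * INR (fact J) * (1/2) ^ J) ->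
  forall x, 0 <= x -> A x <= B x.
Proof.
intros HA HB RA RB MA MB Hgrowth x Hx. apply Rnot_lt_le; intros Hlt.
set (dl := (A x - B x) / 2).
assert (Hdl : 0 < dl) by (unfold dl; lra).
assert (Hdl1 : dl <= 1 / 2) by (unfold dl; assert (H1 := HA x); assert (H2 := HB x); lra).
destruct (RA x (dl / 2)) as (d1 & Hd1 & K1); [lra|].
destruct (RB x (dl / 2)) as (d2 & Hd2 & K2); [lra|].
set (d := Rmin d1 d2).
assert (Hd : 0 < d) by now apply Rmin_glb_lt.
assert (L1 := Rmin_l d1 d2). assert (L2 := Rmin_r d1 d2). fold d in L1, L2.
(* Only right continuity is available, so the interval lies to the right of [x]; starting at
   [x + d/4] keeps it inside the positive axis even for [x = 0]. *)
set (p := x + d / 4). set (r := x + d / 2).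
assert (Hp : 0 < p) by (unfold p; lra). assert (Hpr : p < r) by (unfold p, r; lra).
assert (Hnear : forall s, p <= s <= r -> dl <= A s - B s).
{ intros s Hs. unfold p, r in Hs.
  assert (H1 := K1 s ltac:(lra)). assert (H2 := K2 s ltac:(lra)).
  apply Rabs_lt_between in H1, H2. unfold dl in *. lra. }
(* Mass at least [1 - dl/4] falls in [[p, r]], where the difference is at least [dl]; elsewhere the
   difference is at least -1 on mass at most [dl/4]. As [dl <= 1/2], the total exceeds [dl/2]. *)
destruct (gamma_kernel_concentrates p r (dl / 8) Hp Hpr) as (l & n & Hl & Q1 & Q2); [lra|].
assert (Hf := INR_fact_lt_0 n).
set (al := l * l ^ n / INR (fact n)).
assert (Hal : 0 < al).
{ apply Rdiv_lt_0_compat; [|exact Hf]. apply Rmult_lt_0_compat; [exact Hl|now apply pow_lt]. }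
set (cf := fun j => al * ((- l) ^ j / INR (fact j))).
set (w := fun J => al * (l ^ S J / INR (fact (S J))) * m (n + S J)%nat).
assert (Key : forall J, dl / 2 <= 2 * w J).
{ intros J.
  set (ce := al * (l ^ S J / INR (fact (S J)))).
  set (P := fun s => s ^ n * sum_f_R0 (fun j => cf j * s ^ j) J).
  assert (IA := ImproperInt0inf_poly A m cf n J MA).
  assert (IB := ImproperInt0inf_poly B m cf n J MB).
  assert (EA := ImproperInt0inf_scal _ _ ce (MA (n + S J)%nat)).
  assert (EB := ImproperInt0inf_scal _ _ ce (MB (n + S J)%nat)).
  apply (ImproperInt0inf_scal _ _ (-1)) in IB.
  assert (I1 := ImproperInt0inf_plus _ _ _ _ IA IB).
  assert (I2 := ImproperInt0inf_plus _ _ _ _ EA EB).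
  assert (I3 := ImproperInt0inf_plus _ _ _ _ I1 I2). clear IA IB EA EB I1 I2.
  (* The polynomial parts cancel because [A] and [B] have the same moments; what remains is the
     Taylor remainder, once for [A] and once for [B]. *)
  match type of I3 with ImproperInt0inf _ ?v => replace v with (2 * w J) in I3 by (unfold w, ce; ring) end.
  match type of I3 with ImproperInt0inf ?f _ => set (g := f) in I3 end.
  (* The kernel is a polynomial up to the Taylor remainder of its exponential, and
     [|A - B| <= A + B] turns that remainder into a quantity governed by moments. *)
  assert (Hg : forall s, 0 < s -> gamma_kernel l n s * (A s - B s) <= g s).
  { intros s Hs. assert (T := exp_opp_taylor (l * s) J ltac:(now apply Rmult_lt_0_compat)).
    assert (EP : P s = l * (l * s) ^ n / INR (fact n) *
       sum_f_R0 (fun j => (- (l * s)) ^ j / INR (fact j)) J).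
    { unfold P. rewrite !scal_sum. apply sum_eq. intros i _. unfold cf, al.
      replace (- (l * s)) with (- l * s) by ring. rewrite !Rpow_mult_distr. unfold Rdiv. ring. }
    assert (Ee : ce * s ^ (n + S J) = l * (l * s) ^ n / INR (fact n) * ((l * s) ^ S J / INR (fact (S J)))).
    { unfold ce, al. rewrite !Rpow_mult_distr, pow_add. unfold Rdiv. ring. }
    replace (g s) with (P s * (A s - B s) + ce * s ^ (n + S J) * (A s + B s))
      by (unfold g, P; ring).
    rewrite EP, Ee. unfold gamma_kernel.
    set (k0 := l * (l * s) ^ n / INR (fact n)).
    assert (Hk0 : 0 <= k0).
    { apply Rmult_le_pos; [|left; now apply Rinv_0_lt_compat].
      apply Rmult_le_pos; [lra|]. apply pow_le, Rmult_le_pos; lra. }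
    apply Rabs_le_between in T. assert (H1 := HA s). assert (H2 := HB s).
    set (S0 := sum_f_R0 (fun j => (- (l * s)) ^ j / INR (fact j)) J) in *.
    set (y := (l * s) ^ S J / INR (fact (S J))) in *.
    assert (H3 : (exp (- (l * s)) - S0) * (A s - B s) <= y * (A s + B s)) by nra.
    nra. }
  apply (ImproperInt0inf_ge g _ _ p r Hp Hpr I3).
  intros a b Ha Hb Hex.
  assert (X1 : ex_RInt g a r) by (apply (ex_RInt_Chasles_1 g a r b); [lra|exact Hex]).
  assert (X2 : ex_RInt g r b) by (apply (ex_RInt_Chasles_2 g a r b); [lra|exact Hex]).
  assert (X3 : ex_RInt g a p) by (apply (ex_RInt_Chasles_1 g a p r); [lra|exact X1]).
  assert (X4 : ex_RInt g p r) by (apply (ex_RInt_Chasles_2 g a p r); [lra|exact X1]).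
  rewrite (RInt_split g a r b X1 X2), (RInt_split g a p r X3 X4).
  assert (Far : forall u v, 0 < u -> u <= v -> ex_RInt g u v ->
    - RInt (gamma_kernel l n) u v <= RInt g u v).
  { intros u v Hu Huv Hi.
    replace (- RInt (gamma_kernel l n) u v) with (RInt (fun s => opp (gamma_kernel l n s)) u v)
      by exact (RInt_opp _ u v (gamma_kernel_ex_RInt l n u v)).
    apply RInt_le; trivial.
    - exact (ex_RInt_opp _ u v (gamma_kernel_ex_RInt l n u v)).
    - intros s Hs. eapply Rle_trans; [|apply Hg; lra].
      assert (H0 := gamma_kernel_pos l n s Hl ltac:(lra)).
      assert (H1 := HA s). assert (H2 := HB s). unfold opp; simpl. nra. }
  assert (Near : dl * RInt (gamma_kernel l n) p r <= RInt g p r).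
  { replace (dl * RInt (gamma_kernel l n) p r) with (RInt (fun s => scal dl (gamma_kernel l n s)) p r)
      by exact (RInt_scal _ p r dl (gamma_kernel_ex_RInt l n p r)).
    apply RInt_le; trivial; [lra| |].
    - exact (ex_RInt_scal _ p r dl (gamma_kernel_ex_RInt l n p r)).
    - intros s Hs. eapply Rle_trans; [|apply Hg; lra].
      assert (H0 := gamma_kernel_pos l n s Hl ltac:(lra)).
      assert (H1 := Hnear s ltac:(lra)). unfold scal; simpl; unfold mult; simpl. nra. }
  assert (F1 := Far a p ltac:(lra) ltac:(lra) X3).
  assert (F2 := Far r b ltac:(lra) ltac:(lra) X2).
  rewrite RInt_gamma_kernel in F1, F2, Near by lra.
  assert (G1 := gamma_ge_bounds (S n) (l * a)). assert (G2 := gamma_ge_bounds (S n) (l * b)).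
  nra. }
destruct (Hgrowth n l Hl) as [C HC].
(* The factorial growth of the moments is cancelled by the factorial of the Taylor remainder; the
   geometric factor sends [w J] to 0, against the fixed lower bound in [Key]. *)
assert (Hw : forall J, w J <= al * C * (1/2) ^ S J).
{ intros J. unfold w. assert (H := HC (S J)). assert (HfJ := INR_fact_lt_0 (S J)).
  replace (al * (l ^ S J / INR (fact (S J))) * m (n + S J)%nat) with
    (al / INR (fact (S J)) * (l ^ S J * m (n + S J)%nat)) by (field; lra).
  replace (al * C * (1/2) ^ S J) with (al / INR (fact (S J)) * (C * INR (fact (S J)) * (1/2) ^ S J))
    by (field; lra).
  apply Rmult_le_compat_l; [|exact H]. left; now apply Rdiv_lt_0_compat. }
assert (HCp : 0 < al * C).
{ assert (H1 := Key 0%nat). assert (H2 := Hw 0%nat). simpl in H2. nra. }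
set (ac := al * C) in *.
destruct (pow_lt_1_zero (1/2) ltac:(rewrite Rabs_pos_eq; lra) (dl / (8 * ac))) as [N HN].
{ apply Rdiv_lt_0_compat; lra. }
specialize (HN (S N) ltac:(lia)).
rewrite Rabs_pos_eq in HN by (apply pow_le; lra).
assert (H1 := Key N). assert (H2 := Hw N).
assert (H3 : ac * (1/2) ^ S N < dl / 8).
{ replace (dl / 8) with (ac * (dl / (8 * ac))) by (field; lra).
  now apply Rmult_lt_compat_l. }
lra.
Qed.

Lemma is_cdf_bounds G s : is_cdf G -> 0 <= G s <= 1.
Proof.
intros (Gm & _ & G0 & G1). split; apply Rnot_lt_le; intros Hlt.
- destruct (G0 (- G s)) as [M HM]; [lra|].
  assert (L1 := Rmin_l M s). assert (L2 := Rmin_r M s).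
  assert (H1 := HM _ L1). assert (H2 := Gm _ _ L2). apply Rabs_lt_between in H1. lra.
- destruct (G1 (G s - 1)) as [M HM]; [lra|].
  assert (L1 := Rmax_l M s). assert (L2 := Rmax_r M s).
  assert (H1 := HM _ L1). assert (H2 := Gm _ _ L2). apply Rabs_lt_between in H1. lra.
Qed.

Lemma moment_succ_power G k m : moment G (INR k + 1) m ->
  ImproperInt0inf (fun s => s ^ k * (1 - G s)) (/ (INR k + 1) * m).
Proof.
intros H. assert (Hk := pos_INR k).
apply (ImproperInt0inf_scal _ _ (/ (INR k + 1))) in H.
revert H. apply ImproperInt0inf_ext. intros t Ht.
replace (INR k + 1 - 1) with (INR k) by ring. rewrite Rpower_pow by exact Ht. field. lra.
Qed.

Lemma pow_le_fact_exp c s k : 0 < c -> 0 <= s -> s ^ k <= INR (fact k) / c ^ k * exp (c * s).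
Proof.
intros Hc Hs. assert (Hck : 0 < c ^ k) by now apply pow_lt. assert (Hf := INR_fact_lt_0 k).
assert (H : (c * s) ^ k / INR (fact k) <= exp (c * s)).
{ apply Rle_trans with (sum_f_R0 (fun j => (c * s) ^ j / INR (fact j)) k).
  - destruct k as [|k]; [simpl; lra|]. rewrite tech5.
    assert (0 <= sum_f_R0 (fun j => (c * s) ^ j / INR (fact j)) k); [|lra].
    apply cond_pos_sum. intros j. apply Rmult_le_pos.
    + apply pow_le, Rmult_le_pos; lra.
    + left; apply Rinv_0_lt_compat, INR_fact_lt_0.
  - apply exp_partial_le, Rmult_le_pos; lra. }
rewrite Rpow_mult_distr in H.
replace (s ^ k) with (INR (fact k) / c ^ k * (c ^ k * s ^ k / INR (fact k))) by (field; lra).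
apply Rmult_le_compat_l; [|exact H]. left; now apply Rdiv_lt_0_compat.
Qed.

(** The tail decays at rate [2 l + 2]. The part [2 l] absorbs [s^J] at the price [J! / (2 l)^J],
    which is the origin of [(1/2)^J]; one unit absorbs [s^n], and the last unit keeps the bound
    integrable. *)
Lemma limit_cdf_moment_growth mu sg (m : nat -> R) : 0 < sg ->
  (forall k, ImproperInt0inf (fun s => s ^ k * (1 - limit_cdf mu sg s)) (m k)) ->
  forall n l, 0 < l -> exists C, forall J, l ^ J * m (n + J)%nat <= C * INR (fact J) * (1/2) ^ J.
Proof.
intros Hsg Hm n l Hl.
destruct (abs_normal_tail_sqr_exp mu sg (2 * l + 2) Hsg ltac:(lra)) as (C & HC & HT).
exists (C * INR (fact n)). intros J.
assert (Hfn := INR_fact_lt_0 n). assert (HfJ := INR_fact_lt_0 J).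
assert (HlJ : 0 < (2 * l) ^ J) by (apply pow_lt; lra).
set (B := C * INR (fact n) * (INR (fact J) / (2 * l) ^ J)).
assert (HB : 0 < B).
{ apply Rmult_lt_0_compat; [now apply Rmult_lt_0_compat|now apply Rdiv_lt_0_compat]. }
assert (HmB : m (n + J)%nat <= B).
(* [ImproperInt0inf_ge] gives lower bounds, so it is applied to the negated integrand; the interval
   from 1 to 2 is arbitrary. *)
{ assert (H : - B <= -1 * m (n + J)%nat); [|lra].
  apply (ImproperInt0inf_ge (fun s => -1 * (s ^ (n + J) * (1 - limit_cdf mu sg s))) _ _ 1 2); try lra.
  - apply (ImproperInt0inf_scal (fun s => s ^ (n + J) * (1 - limit_cdf mu sg s))), Hm.
  - intros a b Ha Hb Hex.
    apply Rle_trans with (RInt (fun s => - (B * exp (- s))) a b).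
    + rewrite (RInt_derive (fun s => B * exp (- s))); try lra.
      * assert (H1 : exp (- a) <= 1) by (rewrite <- exp_0; left; apply exp_increasing; lra).
        assert (H2 := exp_pos (- b)). nra.
      * intros t _. auto_derive; [trivial|ring].
      * intros t _. apply (ex_derive_continuous (V := R_NormedModule)). auto_derive. trivial.
    + apply RInt_le; [lra| |exact Hex|].
      * apply (ex_RInt_continuous (V := R_CompleteNormedModule)). intros z _.
        apply (ex_derive_continuous (V := R_NormedModule)). auto_derive. trivial.
      * intros s Hs. rewrite limit_cdf_pos by lra.
        replace (1 - (1 - abs_normal_tail mu sg (s ^ 2))) with (abs_normal_tail mu sg (s ^ 2)) by ring.
        assert (H1 := pow_le_fact_exp 1 s n ltac:(lra) ltac:(lra)).
        assert (H2 := pow_le_fact_exp (2 * l) s J ltac:(lra) ltac:(lra)).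
        rewrite pow1, Rmult_1_l in H1. specialize (HT s).
        assert (H0 := abs_normal_tail_ge0 mu sg (s ^ 2)).
        assert (P1 : 0 <= s ^ n) by (apply pow_le; lra).
        assert (P2 : 0 <= s ^ J) by (apply pow_le; lra).
        assert (H3 : s ^ (n + J) * abs_normal_tail mu sg (s ^ 2) <=
          (INR (fact n) / 1 * exp s) * (INR (fact J) / (2 * l) ^ J * exp (2 * l * s))
            * (C * exp (- (2 * l + 2) * s))).
        { rewrite pow_add. apply Rmult_le_compat; trivial.
          - now apply Rmult_le_pos.
          - now apply Rmult_le_compat. }
        replace (- (2 * l + 2) * s) with (- s + - s + - (2 * l * s)) in H3 by ring.
        rewrite !exp_plus in H3.
        assert (X1 : exp s * exp (- s) = 1) by (rewrite <- exp_plus, Rplus_opp_r; apply exp_0).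
        assert (X2 : exp (2 * l * s) * exp (- (2 * l * s)) = 1)
          by (rewrite <- exp_plus, Rplus_opp_r; apply exp_0).
        replace (INR (fact n) / 1 * exp s * (INR (fact J) / (2 * l) ^ J * exp (2 * l * s)) *
          (C * (exp (- s) * exp (- s) * exp (- (2 * l * s))))) with
          (B * exp (- s) * (exp s * exp (- s)) * (exp (2 * l * s) * exp (- (2 * l * s)))) in H3
          by (unfold B; field; lra).
        rewrite X1, X2 in H3. lra. }
assert (HlJ' : 0 < l ^ J) by now apply pow_lt.
apply Rle_trans with (l ^ J * B); [apply Rmult_le_compat_l; lra|].
right. unfold B. rewrite Rpow_mult_distr. unfold Rdiv at 2. rewrite Rmult_1_l, pow_inv.
assert (0 < 2 ^ J) by (apply pow_lt; lra). field. lra.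
Qed.

Lemma limit_cdf_unique T z0 G : 0 < T -> is_cdf G -> (forall s, s < 0 -> G s = 0) ->
  moment_identity T z0 G -> forall s, G s = limit_cdf (z0 * T) (sqrt (T ^ 3 / 3)) s.
Proof.
intros HT HG G0 MG s.
assert (Hsg : 0 < sqrt (T ^ 3 / 3)).
{ apply sqrt_lt_R0. apply Rdiv_lt_0_compat; [now apply pow_lt|lra]. }
set (F := limit_cdf (z0 * T) (sqrt (T ^ 3 / 3))).
assert (HF : is_cdf F) by now apply limit_cdf_is_cdf.
assert (MF : moment_identity T z0 F) by now apply limit_cdf_moment_identity.
destruct (Rlt_le_dec s 0) as [Hs|Hs].
{ rewrite G0 by exact Hs. unfold F. rewrite limit_cdf_neg; lra. }
assert (Hm : forall k : nat, exists v, forall H, moment_identity T z0 H ->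
   ImproperInt0inf (fun s => s ^ k * (1 - H s)) v).
{ intros k. assert (Hk := pos_INR k).
  destruct (moment_identity_value T z0 (INR k + 1) HT ltac:(lra)) as [v Hv].
  exists (/ (INR k + 1) * v). intros H HH. now apply moment_succ_power, Hv. }
(* A single sequence of moments for both laws. Its growth is known from the explicit law and thus
   serves both inequalities between the two tails. *)
set (m := fun k => proj1_sig (constructive_indefinite_description _ (Hm k))).
assert (HmF : forall k, ImproperInt0inf (fun s => s ^ k * (1 - F s)) (m k)).
{ intros k. unfold m. destruct constructive_indefinite_description as [v Hv]. now apply Hv. }
assert (HmG : forall k, ImproperInt0inf (fun s => s ^ k * (1 - G s)) (m k)).
{ intros k. unfold m. destruct constructive_indefinite_description as [v Hv]. now apply Hv. }
assert (Hgr := limit_cdf_moment_growth _ _ m Hsg HmF).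
assert (Bd : forall H, is_cdf H -> forall s, 0 <= 1 - H s <= 1).
{ intros H HH t. assert (B := is_cdf_bounds H t HH). lra. }
assert (Rc : forall H, is_cdf H -> forall s eps, 0 < eps ->
  exists d, 0 < d /\ forall t, s <= t < s + d -> Rabs (1 - H t - (1 - H s)) < eps).
{ intros H (_ & HR & _) t eps Heps. destruct (HR t eps Heps) as (d & Hd & K).
  exists d. split; [exact Hd|]. intros t' Ht'.
  replace (1 - H t' - (1 - H t)) with (- (H t' - H t)) by ring. rewrite Rabs_Ropp. now apply K. }
assert (L1 := moments_determine_tail (fun s => 1 - F s) (fun s => 1 - G s) m
  (Bd F HF) (Bd G HG) (Rc F HF) (Rc G HG) HmF HmG Hgr s Hs).
assert (L2 := moments_determine_tail (fun s => 1 - G s) (fun s => 1 - F s) m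
  (Bd G HG) (Bd F HF) (Rc G HG) (Rc F HF) HmG HmF Hgr s Hs).
cbv beta in L1, L2. lra.
Qed.

(** * Lindeberg comparison *)

(** A jump of size [a] one way with probability [b / (a + b)] and of size [b] the other way with
    probability [a / (a + b)] has mean zero, so the first-order terms of [Phi_heat_step] cancel. The
    sign [e] lets the same statement serve [W] and [- W]. *)
Lemma Phi_two_jumps : exists K, 0 < K /\ forall w t a b e D,
  0 < D -> 0 < a -> 0 < b -> e ^ 2 = 1 -> a ^ 2 + b ^ 2 + D <= t ->
  Rabs (Phi (w / sqrt t) - (b / (a + b) * Phi ((w + e * a) / sqrt (t - a ^ 2))
                            + a / (a + b) * Phi ((w - e * b) / sqrt (t - b ^ 2))))
  <= K * (((a + b) / sqrt D) ^ 3 + ((a + b) / sqrt D) ^ 4).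
Proof.
destruct Phi_heat_step as (K & HK & H). exists K. split; [exact HK|].
intros w t a b e D HD Ha Hb He Ht.
assert (HsD : 0 < sqrt D) by now apply sqrt_lt_R0.
assert (Ea : (e * a) ^ 2 = a ^ 2) by (rewrite Rpow_mult_distr, He; ring).
assert (Eb : (- e * b) ^ 2 = b ^ 2).
{ rewrite Rpow_mult_distr. replace ((- e) ^ 2) with (e ^ 2) by ring. rewrite He; ring. }
assert (Hb2 : 0 < b ^ 2) by now apply pow_lt.
assert (Ha2 : 0 < a ^ 2) by now apply pow_lt.
assert (H1 := H w t (e * a) D HD ltac:(rewrite Ea; lra)).
assert (H2 := H w t (- e * b) D HD ltac:(rewrite Eb; lra)).
rewrite Ea in H1. rewrite Eb in H2.
replace (w + - e * b) with (w - e * b) in H2 by ring.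
assert (Aa : Rabs (e * a) <= a + b).
{ apply Rsqr_incr_0; [|apply Rabs_pos|lra]. rewrite <- Rsqr_abs. unfold Rsqr.
  replace (e * a * (e * a)) with ((e * a) ^ 2) by ring. rewrite Ea. nra. }
assert (Ab : Rabs (- e * b) <= a + b).
{ apply Rsqr_incr_0; [|apply Rabs_pos|lra]. rewrite <- Rsqr_abs. unfold Rsqr.
  replace (- e * b * (- e * b)) with ((- e * b) ^ 2) by ring. rewrite Eb. nra. }
set (Q := ((a + b) / sqrt D) ^ 3 + ((a + b) / sqrt D) ^ 4).
assert (HQ : forall z, Rabs z <= a + b -> K * ((Rabs z / sqrt D) ^ 3 + (Rabs z / sqrt D) ^ 4) <= K * Q).
{ intros z Hz. apply Rmult_le_compat_l; [lra|].
  assert (0 <= Rabs z / sqrt D <= (a + b) / sqrt D).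
  { assert (Hi : 0 < / sqrt D) by now apply Rinv_0_lt_compat.
    split; [apply Rmult_le_pos; [apply Rabs_pos|lra]|]. apply Rmult_le_compat_r; lra. }
  apply Rplus_le_compat; now apply pow_incr. }
assert (B1 := Rle_trans _ _ _ H1 (HQ _ Aa)). assert (B2 := Rle_trans _ _ _ H2 (HQ _ Ab)).
clear H1 H2 HQ.
set (g := gauss (w / sqrt t) / (2 * half_mass) / sqrt t) in *.
set (P0 := Phi (w / sqrt t)) in *.
set (P1 := Phi ((w + e * a) / sqrt (t - a ^ 2))) in *.
set (P2 := Phi ((w - e * b) / sqrt (t - b ^ 2))) in *.
assert (Hp : 0 <= b / (a + b)) by (left; apply Rdiv_lt_0_compat; lra).
assert (Hq : 0 <= a / (a + b)) by (left; apply Rdiv_lt_0_compat; lra).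
assert (Hpq : b / (a + b) + a / (a + b) = 1) by (field; lra).
assert (Hc : b / (a + b) * (e * a) + a / (a + b) * (- e * b) = 0) by (field; lra).
replace (P0 - (b / (a + b) * P1 + a / (a + b) * P2)) with
  (- (b / (a + b) * (P1 - P0 - e * a * g) + a / (a + b) * (P2 - P0 - - e * b * g))).
2: { transitivity ((b / (a + b) + a / (a + b)) * P0 - (b / (a + b) * P1 + a / (a + b) * P2)
       + (b / (a + b) * (e * a) + a / (a + b) * (- e * b)) * g); [ring|rewrite Hpq, Hc; ring]. }
rewrite Rabs_Ropp. set (p := b / (a + b)) in *. set (q := a / (a + b)) in *.
apply Rabs_le_between in B1, B2. apply Rabs_le. nra.
Qed.

(** The closed form of [1^2 + ... + x^2], as a polynomial on the reals so that increments are
    computed by [field]. *)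
Definition sum_squares (x : R) : R := x * (x + 1) * (2 * x + 1) / 6.

(* [balance] and [balance ^ 2 + bracket] are martingales of the jump chain. *)
Definition balance (x y : nat) : R := (INR x * (INR x + 1) - INR y * (INR y + 1)) / 2.

Definition bracket (x y : nat) : R := sum_squares (INR x) + sum_squares (INR y).

(** The probability that [|w + sqrt (v + D) Z|] exceeds [c] for a standard normal [Z]: [v] is the
    variance still to be spent, and [D] keeps the denominator large when [v] is nearly exhausted. *)
Definition smooth_tail (c D w v : R) : R := Phi ((w - c) / sqrt (v + D)) + Phi ((- w - c) / sqrt (v + D)).

Definition edge_tail (c D : R) (r : nat) : R :=
  smooth_tail c D (INR r * (INR r + 1) / 2) (sum_squares (INR r)).

Lemma sum_squares_ge0 x : 0 <= x -> 0 <= sum_squares x.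
Proof.
intros Hx. unfold sum_squares. apply Rmult_le_pos; [|lra].
apply Rmult_le_pos; [|lra]. apply Rmult_le_pos; lra.
Qed.

(** Both summands obey [Phi_two_jumps], with opposite orientations. Its variance condition holds
    because the last squares of the two sums in [bracket] are exactly the squares of the two
    possible jumps. *)
Lemma smooth_tail_harmonic : exists K, 0 < K /\ forall c D x y, 0 < D ->
  Rabs (smooth_tail c D (balance (S x) (S y)) (bracket (S x) (S y)) -
    (INR (S x) / INR (S x + S y) * smooth_tail c D (balance (S x) y) (bracket (S x) y)
     + INR (S y) / INR (S x + S y) * smooth_tail c D (balance x (S y)) (bracket x (S y))))
  <= K * ((INR (S x + S y) / sqrt D) ^ 3 + (INR (S x + S y) / sqrt D) ^ 4).
Proof.
destruct Phi_two_jumps as (K & HK & H). exists (2 * K). split; [lra|].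
intros c D x y HD.
assert (Hx := pos_INR x). assert (Hy := pos_INR y).
set (a := INR (S y)). set (b := INR (S x)).
assert (Ha : 0 < a) by (apply lt_0_INR; lia). assert (Hb : 0 < b) by (apply lt_0_INR; lia).
replace (INR (S x + S y)) with (a + b) by (rewrite plus_INR; unfold a, b; ring).
set (w := balance (S x) (S y)). set (v := bracket (S x) (S y)).
assert (Hv : a ^ 2 + b ^ 2 + D <= v + D).
{ unfold v, bracket, a, b. rewrite !S_INR.
  assert (H1 := sum_squares_ge0 (INR x) Hx). assert (H2 := sum_squares_ge0 (INR y) Hy).
  unfold sum_squares in *. nra. }
assert (E1 : balance (S x) y = w + a) by (unfold w, balance, a; rewrite !S_INR; field).
assert (E2 : balance x (S y) = w - b) by (unfold w, balance, b; rewrite !S_INR; field).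
assert (E3 : bracket (S x) y + D = v + D - a ^ 2)
  by (unfold v, bracket, sum_squares, a; rewrite !S_INR; field).
assert (E4 : bracket x (S y) + D = v + D - b ^ 2)
  by (unfold v, bracket, sum_squares, b; rewrite !S_INR; field).
unfold smooth_tail. rewrite E1, E2, E3, E4.
assert (H1 := H (w - c) (v + D) a b 1 D HD Ha Hb ltac:(ring) Hv).
assert (H2 := H (- w - c) (v + D) a b (-1) D HD Ha Hb ltac:(ring) Hv).
replace (w - c + 1 * a) with (w + a - c) in H1 by ring.
replace (w - c - 1 * b) with (w - b - c) in H1 by ring.
replace (- w - c + -1 * a) with (- (w + a) - c) in H2 by ring.
replace (- w - c - -1 * b) with (- (w - b) - c) in H2 by ring.
set (Q := ((a + b) / sqrt D) ^ 3 + ((a + b) / sqrt D) ^ 4) in *.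
set (p := b / (a + b)) in *. set (q := a / (a + b)) in *.
apply Rabs_le_between in H1, H2. apply Rabs_le. lra.
Qed.

(** The two axes give opposite values of [balance], but [smooth_tail] is symmetric in [w], so the
    boundary value depends on the number of survivors alone, as [ruin_mean_approx] requires. *)
Lemma ruin_mean_edge_tail : exists K, 0 < K /\ forall c D x y, 0 < D ->
  Rabs (smooth_tail c D (balance x y) (bracket x y) - ruin_mean x y (edge_tail c D))
  <= INR (x + y) * (K * ((INR (x + y) / sqrt D) ^ 3 + (INR (x + y) / sqrt D) ^ 4)).
Proof.
destruct smooth_tail_harmonic as (K & HK & H). exists K. split; [exact HK|].
intros c D x y HD.
assert (HsD : 0 < sqrt D) by now apply sqrt_lt_R0.
assert (Hi : 0 < / sqrt D) by now apply Rinv_0_lt_compat.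
apply (ruin_mean_approx (fun x y => smooth_tail c D (balance x y) (bracket x y)) _ _ (x + y)).
- intros r. unfold edge_tail, balance, bracket, sum_squares. simpl INR. f_equal; field.
- intros r. unfold edge_tail, smooth_tail.
  replace (bracket 0 r) with (sum_squares (INR r)) by (unfold bracket, sum_squares; simpl INR; field).
  replace (balance 0 r) with (- (INR r * (INR r + 1) / 2)) by (unfold balance; simpl INR; field).
  rewrite Ropp_involutive. apply Rplus_comm.
- apply Rmult_le_pos; [lra|].
  assert (H0 : 0 <= INR (x + y) / sqrt D) by (apply Rmult_le_pos; [apply pos_INR|lra]).
  apply Rplus_le_le_0_compat; now apply pow_le.
- intros x' y' Hxy. eapply Rle_trans; [now apply H|].
  apply Rmult_le_compat_l; [lra|].
  assert (H0 : 0 <= INR (S x' + S y') / sqrt D <= INR (x + y) / sqrt D).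
  { split; [apply Rmult_le_pos; [apply pos_INR|lra]|].
    apply Rmult_le_compat_r; [lra|]. now apply le_INR. }
  apply Rplus_le_compat; now apply pow_incr.
- lia.
Qed.

Lemma edge_tail_bounds c D r : 0 <= c -> 0 <= edge_tail c D r <= 1.
Proof.
intros Hc. unfold edge_tail, smooth_tail.
set (w := INR r * (INR r + 1) / 2). set (d := sqrt (sum_squares (INR r) + D)).
split; [apply Rplus_le_le_0_compat; apply Phi_ge0|].
assert (H : Phi ((- w - c) / d) <= Phi (- ((w - c) / d))).
{ apply Phi_le. replace (- ((w - c) / d)) with ((- w + c) / d) by (unfold Rdiv; ring).
  (* Here [D] is arbitrary and [d] may vanish; both quotients are then 0 by the convention
     [/ 0 = 0]. *)
  destruct (Req_dec d 0) as [->|Hd].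
  - unfold Rdiv. rewrite Rinv_0. lra.
  - apply Rmult_le_compat_r; [|lra]. left; apply Rinv_0_lt_compat.
    destruct (sqrt_pos (sum_squares (INR r) + D)) as [Hp|Hp]; [exact Hp|].
    now elim Hd. }
rewrite Phi_opp in H. lra.
Qed.

(** The clock runs for a time of order [m^8], hence fluctuates by about [m^4], while the window has
    width [h m^6]: the Chebyshev quotient is of order [m^(-4)]. *)
Lemma chebyshev_scale T s h eps : 0 < T -> 0 < h -> 0 < eps -> exists B, 1 <= B /\
  forall m, B <= m -> 0 < T * m ^ 8 - s * m ^ 6 /\
    (T * m ^ 8 - s * m ^ 6) / (h * m ^ 6) ^ 2 <= eps.
Proof.
intros HT Hh Heps.
assert (Hs := Rle_abs s). assert (Hs' := Rle_abs (- s)). rewrite Rabs_Ropp in Hs'.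
assert (Hs0 := Rabs_pos s).
assert (Hh2 : 0 < h ^ 2) by now apply pow_lt.
set (B1 := (Rabs s + 1) / T). set (B2 := (T + Rabs s) / (eps * h ^ 2)).
assert (HB1 : 0 < B1) by (apply Rdiv_lt_0_compat; lra).
assert (HB2 : 0 < B2) by (apply Rdiv_lt_0_compat; [lra|now apply Rmult_lt_0_compat]).
exists (1 + B1 + B2). split; [lra|]. intros m Hm.
assert (Hm6 : 0 < m ^ 6) by (apply pow_lt; lra).
assert (E1 : B1 * T = Rabs s + 1) by (unfold B1; field; lra).
assert (E2 : B2 * (eps * h ^ 2) = T + Rabs s) by (unfold B2; field; lra).
assert (M2 : m <= m ^ 2) by nra.
assert (M4 : m <= m ^ 4) by (replace (m ^ 4) with (m ^ 2 * m ^ 2) by ring; nra).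
replace (T * m ^ 8 - s * m ^ 6) with (m ^ 6 * (T * m ^ 2 - s)) by ring.
assert (HTm : Rabs s + 1 <= T * m ^ 2) by nra.
split.
- apply Rmult_lt_0_compat; [exact Hm6|lra].
- apply Rmult_le_reg_r with ((h * m ^ 6) ^ 2).
  { apply pow_lt. now apply Rmult_lt_0_compat. }
  replace (m ^ 6 * (T * m ^ 2 - s) / (h * m ^ 6) ^ 2 * (h * m ^ 6) ^ 2) with (m ^ 6 * (T * m ^ 2 - s))
    by (field; lra).
  replace (eps * (h * m ^ 6) ^ 2) with (m ^ 6 * (m ^ 2 * (eps * h ^ 2 * m ^ 4))) by ring.
  apply Rmult_le_compat_l; [lra|].
  assert (Heh : 0 < eps * h ^ 2) by now apply Rmult_lt_0_compat.
  assert (T + Rabs s <= eps * h ^ 2 * m ^ 4) by nra.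
  assert (1 <= m ^ 2) by nra.
  apply Rle_trans with (m ^ 2 * (T + Rabs s)); [nra|]. apply Rmult_le_compat_l; lra.
Qed.

(** A level [rho] between [s] and [sg] separates two cases. If [r >= rho m^6], ruin takes too few
    jumps for the clock to be that late. If [r < rho m^6], then [r(r+1)/2] lies below the threshold
    by order [m^12], beyond the blur [m^11], and [edge_tail] is small. *)
Lemma clock_below_edge_tail T s sg eps : 0 < T -> s < sg -> 0 < sg -> 0 < eps ->
  exists B, 1 <= B /\ forall m n r, B <= m -> (r <= n)%nat -> INR n = T * m ^ 8 ->
    gamma_ge (n - r) (T * m ^ 8 - s * m ^ 6) <= 1 - edge_tail (sg ^ 2 * m ^ 12 / 2) (m ^ 22) r + eps.
Proof.
intros HT Hs Hsg Heps.
(* The maximum with 0 keeps [rho] positive when [s] is negative. *)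
set (rho := (Rmax s 0 + sg) / 2).
assert (L1 := Rmax_l s 0). assert (L2 := Rmax_r s 0).
assert (L3 : Rmax s 0 < sg) by (apply Rmax_lub_lt; lra).
assert (R1 : s < rho) by (unfold rho; lra). assert (R2 : 0 < rho) by (unfold rho; lra).
assert (R3 : rho < sg) by (unfold rho; lra).
destruct (chebyshev_scale T s (rho - s) eps HT ltac:(lra) Heps) as (B1 & HB1 & K1).
destruct (Phi_near0 (eps / 2) ltac:(lra)) as (M & HM & KM).
(* For [x < rho m^6] the sum of squares is at most [(rho + 1)^3 m^18], so together with [m^22] its
   square root is at most [C m^11]. *)
set (C := sqrt ((rho + 1) ^ 3 + 1)).
assert (HC0 : 0 < (rho + 1) ^ 3) by (apply pow_lt; lra).
assert (HC : 0 < C) by (apply sqrt_lt_R0; lra).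
set (g := sg ^ 2 - rho ^ 2).
assert (Hg : 0 < g) by (unfold g; nra).
(* Ensures [g m >= 2 M C + rho]: the gap [g m^12] then beats the lower-order [rho m^6] and still
   leaves [2 M C m^11], that is [M] standard deviations after halving. *)
set (B2 := (2 * M * C + rho) / g).
assert (HB2 : 0 < B2).
{ apply Rdiv_lt_0_compat; [|exact Hg]. assert (0 < M * C) by now apply Rmult_lt_0_compat. lra. }
exists (B1 + B2). split; [lra|]. intros m n r Hm Hr Hn.
assert (Hm1 : 1 <= m) by lra.
assert (P6 : 1 <= m ^ 6) by now apply pow_R1_Rle.
assert (Hc : 0 <= sg ^ 2 * m ^ 12 / 2).
{ apply Rmult_le_pos; [|lra]. apply Rmult_le_pos; [apply pow2_ge_0|]. apply pow_le; lra. }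
destruct (edge_tail_bounds (sg ^ 2 * m ^ 12 / 2) (m ^ 22) r Hc) as [E0 E1].
destruct (Rle_lt_dec (rho * m ^ 6) (INR r)) as [Hcase|Hcase].
- destruct (K1 m ltac:(lra)) as [U1 U2].
  assert (H : gamma_ge (n - r) (T * m ^ 8 - s * m ^ 6) <= eps); [|lra].
  eapply Rle_trans; [|exact U2]. apply gamma_ge_small; [exact U1| |].
  + apply Rmult_lt_0_compat; lra.
  + rewrite minus_INR by exact Hr. rewrite Hn. lra.
- assert (HG := gamma_ge_bounds (n - r) (T * m ^ 8 - s * m ^ 6)).
  assert (H : edge_tail (sg ^ 2 * m ^ 12 / 2) (m ^ 22) r <= eps); [|lra].
  assert (Hr0 := pos_INR r). set (x := INR r) in *.
  unfold edge_tail, smooth_tail. fold x.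
  assert (P11 : 0 < m ^ 11) by (apply pow_lt; lra).
  assert (P22 : 0 < m ^ 22) by (apply pow_lt; lra).
  assert (Q0 := sum_squares_ge0 x Hr0).
  assert (Hd : sqrt (sum_squares x + m ^ 22) <= C * m ^ 11).
  { replace (m ^ 11) with (sqrt (m ^ 22)).
    2: { replace (m ^ 22) with (m ^ 11 * m ^ 11) by ring. apply sqrt_square. lra. }
    unfold C. rewrite <- sqrt_mult by lra. apply sqrt_le_1; [lra|nra|].
    rewrite Rmult_plus_distr_r, Rmult_1_l. apply Rplus_le_compat_r.
    apply Rle_trans with ((x + 1) ^ 3).
    { unfold sum_squares. nra. }
    apply Rle_trans with (((rho + 1) * m ^ 6) ^ 3).
    { apply pow_incr. nra. }
    rewrite Rpow_mult_distr. apply Rmult_le_compat_l; [lra|].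
    rewrite <- pow_mult. apply Rle_pow; [exact Hm1|]. simpl. lia. }
  assert (Hd0 : 0 < sqrt (sum_squares x + m ^ 22)) by (apply sqrt_lt_R0; lra).
  set (d := sqrt (sum_squares x + m ^ 22)) in *.
  assert (Num : x * (x + 1) / 2 - sg ^ 2 * m ^ 12 / 2 <= - M * (C * m ^ 11)).
  { assert (X2 : x * (x + 1) <= (rho * m ^ 6) * (rho * m ^ 6 + 1)) by nra.
    assert (X3 : (rho * m ^ 6) * (rho * m ^ 6 + 1) - sg ^ 2 * m ^ 12 = - (g * m ^ 12) + rho * m ^ 6)
      by (unfold g; ring).
    assert (X4 : m ^ 6 <= m ^ 11) by (apply Rle_pow; [exact Hm1|lia]).
    assert (X5 : 2 * M * C + rho <= g * m).
    { replace (2 * M * C + rho) with (g * B2) by (unfold B2; field; lra). nra. }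
    replace (m ^ 12) with (m * m ^ 11) in X3 at 2 by ring.
    assert (X6 : (2 * M * C + rho) * m ^ 11 <= g * m * m ^ 11) by (apply Rmult_le_compat_r; lra).
    nra. }
  assert (Num2 : - (x * (x + 1) / 2) - sg ^ 2 * m ^ 12 / 2 <= - M * (C * m ^ 11)).
  { assert (0 <= x * (x + 1)) by nra. lra. }
  assert (Hq : forall z, z <= - M * (C * m ^ 11) -> Phi (z / d) < eps / 2).
  { intros z Hz. apply KM. apply Rmult_le_reg_r with d; [exact Hd0|].
    unfold Rdiv. rewrite Rmult_assoc, Rinv_l, Rmult_1_r by lra. nra. }
  assert (H1 := Hq _ Num). assert (H2 := Hq _ Num2). lra.
Qed.

(** The mirror image, with [sg < rho < s]. In the second case [r] has no upper bound of order [m^6],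
    so both the distance to the threshold and the blur are measured against [r^2] instead of powers
    of [m]. *)
Lemma clock_above_edge_tail T s sg eps : 0 < T -> sg < s -> 0 < sg -> 0 < eps ->
  exists B, 1 <= B /\ forall m n r, B <= m -> (r <= n)%nat -> INR n = T * m ^ 8 ->
    1 - edge_tail (sg ^ 2 * m ^ 12 / 2) (m ^ 22) r - eps <= gamma_ge (n - r) (T * m ^ 8 - s * m ^ 6).
Proof.
intros HT Hs Hsg Heps.
set (rho := (s + sg) / 2).
assert (R1 : rho < s) by (unfold rho; lra). assert (R2 : 0 < rho) by (unfold rho; lra).
assert (R3 : sg < rho) by (unfold rho; lra).
destruct (chebyshev_scale T s (s - rho) eps HT ltac:(lra) Heps) as (B1 & HB1 & K1).
destruct (Phi_near1 eps Heps) as (M & HM & KM).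
(* For [x > rho m^6], the sum of squares times [m^2] is at most [x^4 / rho] and [m^24] is at most
   [x^4 / rho^4]; hence [m] times the standard deviation is at most [sqrt E x^2]. *)
set (E := / rho + / rho ^ 4).
assert (Hr4 : 0 < rho ^ 4) by now apply pow_lt.
assert (HE : 0 < E).
{ apply Rplus_lt_0_compat; now apply Rinv_0_lt_compat. }
assert (HsE : 0 < sqrt E) by now apply sqrt_lt_R0.
(* The fraction of [x^2] that survives subtraction of the threshold:
   [sg^2 m^12 <= (sg^2 / rho^2) x^2]. *)
set (th := 1 - sg ^ 2 / rho ^ 2).
assert (Hr2 : 0 < rho ^ 2) by now apply pow_lt.
assert (Hth : 0 < th).
{ unfold th. assert (sg ^ 2 / rho ^ 2 < 1); [|lra].
  apply Rmult_lt_reg_r with (rho ^ 2); [exact Hr2|].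
  replace (sg ^ 2 / rho ^ 2 * rho ^ 2) with (sg ^ 2) by (field; lra). nra. }
set (B2 := 2 * M * sqrt E / th).
assert (HB2 : 0 < B2).
{ apply Rdiv_lt_0_compat; [|exact Hth]. apply Rmult_lt_0_compat; lra. }
exists (B1 + B2). split; [lra|]. intros m n r Hm Hr Hn.
assert (Hm1 : 1 <= m) by lra.
assert (P6 : 1 <= m ^ 6) by now apply pow_R1_Rle.
assert (Hc : 0 <= sg ^ 2 * m ^ 12 / 2).
{ apply Rmult_le_pos; [|lra]. apply Rmult_le_pos; [apply pow2_ge_0|]. apply pow_le; lra. }
destruct (edge_tail_bounds (sg ^ 2 * m ^ 12 / 2) (m ^ 22) r Hc) as [E0 E1].
destruct (Rle_lt_dec (INR r) (rho * m ^ 6)) as [Hcase|Hcase].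
- destruct (K1 m ltac:(lra)) as [U1 U2].
  assert (H : 1 - gamma_ge (n - r) (T * m ^ 8 - s * m ^ 6) <= eps); [|lra].
  eapply Rle_trans; [|exact U2]. apply gamma_ge_large; [exact U1| |].
  + apply Rmult_lt_0_compat; lra.
  + rewrite minus_INR by exact Hr. rewrite Hn. lra.
- assert (HG := gamma_ge_bounds (n - r) (T * m ^ 8 - s * m ^ 6)).
  assert (H : 1 - eps <= edge_tail (sg ^ 2 * m ^ 12 / 2) (m ^ 22) r); [|lra].
  assert (Hr1 : 1 <= INR r).
  { apply (le_INR 1). destruct r; [simpl in Hcase; nra|lia]. }
  set (x := INR r) in *.
  unfold edge_tail, smooth_tail. fold x.
  assert (P22 : 0 < m ^ 22) by (apply pow_lt; lra).
  assert (Q0 := sum_squares_ge0 x ltac:(lra)).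
  assert (Hd0 : 0 < sqrt (sum_squares x + m ^ 22)) by (apply sqrt_lt_R0; lra).
  assert (Hx2 : 0 < x ^ 2) by (apply pow_lt; lra).
  assert (Hx3 : 0 < x ^ 3) by (apply pow_lt; lra).
  assert (Hx4 : 0 < x ^ 4) by (apply pow_lt; lra).
  assert (Hm2 : 0 < m ^ 2) by (apply pow_lt; lra).
  assert (Hd : m * sqrt (sum_squares x + m ^ 22) <= sqrt E * x ^ 2).
  { rewrite <- (sqrt_pow2 m) at 1 by lra. rewrite <- sqrt_mult by lra.
    rewrite <- (sqrt_pow2 (x ^ 2)) by lra. rewrite <- sqrt_mult by nra.
    apply sqrt_le_1; [nra|nra|].
    assert (Y1 : sum_squares x <= x ^ 3) by (unfold sum_squares; nra).
    assert (Y2 : m ^ 2 * x ^ 3 <= / rho * x ^ 4).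
    { apply Rmult_le_reg_l with rho; [exact R2|].
      replace (rho * (/ rho * x ^ 4)) with (x * x ^ 3) by (field; lra).
      replace (rho * (m ^ 2 * x ^ 3)) with (rho * m ^ 2 * x ^ 3) by ring.
      apply Rmult_le_compat_r; [lra|].
      assert (m ^ 2 <= m ^ 6) by (apply Rle_pow; [exact Hm1|lia]). nra. }
    assert (Y3 : m ^ 2 * m ^ 22 <= / rho ^ 4 * x ^ 4).
    { apply Rmult_le_reg_l with (rho ^ 4); [exact Hr4|].
      replace (rho ^ 4 * (/ rho ^ 4 * x ^ 4)) with (x ^ 4) by (field; lra).
      replace (rho ^ 4 * (m ^ 2 * m ^ 22)) with ((rho * m ^ 6) ^ 4) by ring.
      apply pow_incr. split; [|lra]. apply Rmult_le_pos; lra. }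
    replace ((x ^ 2) ^ 2) with (x ^ 4) by ring. unfold E. nra. }
  set (d := sqrt (sum_squares x + m ^ 22)) in *.
  assert (Num : th * x ^ 2 / 2 <= x * (x + 1) / 2 - sg ^ 2 * m ^ 12 / 2).
  { assert (sg ^ 2 * m ^ 12 <= sg ^ 2 / rho ^ 2 * x ^ 2); [|unfold th; nra].
    replace (sg ^ 2 * m ^ 12) with (sg ^ 2 / rho ^ 2 * (rho * m ^ 6) ^ 2) by (field; lra).
    apply Rmult_le_compat_l.
    - apply Rmult_le_pos; [apply pow2_ge_0|]. left; now apply Rinv_0_lt_compat.
    - apply pow_incr. split; [|lra]. apply Rmult_le_pos; lra. }
  assert (HA : M <= (x * (x + 1) / 2 - sg ^ 2 * m ^ 12 / 2) / d).
  { apply Rmult_le_reg_r with d; [exact Hd0|].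
    unfold Rdiv at 1. rewrite Rmult_assoc, Rinv_l, Rmult_1_r by lra.
    eapply Rle_trans; [|exact Num].
    assert (Hmb : 2 * M * sqrt E <= th * m).
    { replace (2 * M * sqrt E) with (th * B2) by (unfold B2; field; lra). nra. }
    apply Rmult_le_reg_l with (2 * m); [lra|].
    replace (2 * m * (M * d)) with (2 * M * (m * d)) by ring.
    replace (2 * m * (th * x ^ 2 / 2)) with (th * m * x ^ 2) by field.
    apply Rle_trans with (2 * M * (sqrt E * x ^ 2)).
    - apply Rmult_le_compat_l; lra.
    - replace (2 * M * (sqrt E * x ^ 2)) with (2 * M * sqrt E * x ^ 2) by ring.
      apply Rmult_le_compat_r; lra. }
  specialize (KM _ HA).
  assert (H0 := Phi_ge0 ((- (x * (x + 1) / 2) - sg ^ 2 * m ^ 12 / 2) / d)). lra.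
Qed.

(** * Convergence *)

(* All scales of the problem are integer powers of N^(1/8). *)
Definition scale (N : nat) : R := Rpower (INR N) (1 / 8).

Lemma scale_powers N : (0 < N)%nat ->
  0 < scale N /\ scale N ^ 8 = INR N /\ scale N ^ 2 = Rpower (INR N) (1 / 4) /\
  scale N ^ 4 = sqrt (INR N).
Proof.
intros HN. assert (H : 0 < INR N) by now apply lt_0_INR.
assert (Hm : 0 < scale N) by apply exp_pos. unfold scale in *.
repeat split; [exact Hm|..].
- rewrite <- Rpower_pow, Rpower_mult by exact Hm.
  replace (1 / 8 * INR 8) with 1 by (simpl; field). now apply Rpower_1.
- rewrite <- Rpower_pow, Rpower_mult by exact Hm. f_equal. simpl; field.
- rewrite <- Rpower_pow, Rpower_mult by exact Hm.
  replace (1 / 8 * INR 4) with (/ 2) by (simpl; field). now apply Rpower_sqrt.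
Qed.

Lemma scale_unbounded B : exists N0, forall N, (N0 <= N)%nat -> B <= scale N.
Proof.
destruct (INR_unbounded (Rmax B 0 ^ 8)) as [N0 HN0].
exists (S N0). intros N HN. apply Rnot_lt_le; intros Hlt.
destruct (scale_powers N ltac:(lia)) as (Hm & E8 & _).
assert (H1 : scale N ^ 8 <= Rmax B 0 ^ 8).
{ apply pow_incr. split; [lra|]. apply Rle_trans with B; [lra|apply Rmax_l]. }
assert (INR N0 <= INR N) by (apply le_INR; lia). lra.
Qed.

Lemma is_lim_seq_inv_scale : is_lim_seq (fun N => / scale N) 0.
Proof.
apply is_lim_seq_spec. intros eps. simpl.
destruct (scale_unbounded (/ eps + 1)) as [N0 H]. exists (S N0). intros N HN.
assert (He : 0 < / eps) by apply Rinv_0_lt_compat, cond_pos.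
specialize (H N ltac:(lia)).
rewrite Rminus_0_r, Rabs_pos_eq by (left; apply Rinv_0_lt_compat; lra).
rewrite <- (Rinv_inv eps). apply Rinv_lt_contravar; [|lra]. apply Rmult_lt_0_compat; lra.
Qed.

Lemma is_lim_seq_pow_const (u : nat -> R) (l : R) k :
  is_lim_seq u l -> is_lim_seq (fun n => u n ^ k) (l ^ k).
Proof.
intros H. apply (is_lim_seq_continuous (fun x => x ^ k)); [|exact H].
apply derivable_continuous_pt, derivable_pt_pow.
Qed.

Lemma is_lim_seq_Phi (u : nat -> R) (l : R) :
  is_lim_seq u l -> is_lim_seq (fun n => Phi (u n)) (Phi l).
Proof.
intros H. apply (is_lim_seq_continuous Phi); [|exact H].
apply continuity_pt_filterlim, Phi_continuous.
Qed.

Lemma INR_total T X Y N : (0 < N)%nat ->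
  INR X / INR N + INR Y / INR N = T -> INR (X + Y) = T * scale N ^ 8.
Proof.
intros HN H. destruct (scale_powers N HN) as (_ & E8 & _).
assert (HN' : 0 < INR N) by now apply lt_0_INR.
rewrite E8, plus_INR, <- H. field. lra.
Qed.

(** Dividing by [m^12], the balance tends to [z0 T / 2], the threshold is [sg^2 / 2], and the
    variance tends to [T^3 / 12] since [D / m^24 = m^(-2)] vanishes. Doubling numerator and
    denominator gives the parameters of the limit. *)
Lemma smooth_tail_start_lim (X0 Y0 : nat -> nat) (x0 T z0 sg : R) :
  0 < x0 -> T = x0 + x0 ->
  Un_cv (fun N => INR (X0 N) / INR N) x0 -> Un_cv (fun N => INR (Y0 N) / INR N) x0 ->
  (forall N : nat, (0 < N)%nat -> INR (X0 N) / INR N + INR (Y0 N) / INR N = T) ->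
  Un_cv (fun N => sqrt (INR N) * (INR (X0 N) / INR N - INR (Y0 N) / INR N)) z0 ->
  is_lim_seq (fun N => smooth_tail (sg ^ 2 * scale N ^ 12 / 2) (scale N ^ 22)
      (balance (X0 N) (Y0 N)) (bracket (X0 N) (Y0 N)))
    (abs_normal_tail (z0 * T) (sqrt (T ^ 3 / 3)) (sg ^ 2)).
Proof.
intros Hx0 HT HX HY Hsum Hz.
apply is_lim_seq_Reals in HX, HY, Hz.
assert (HTp : 0 < T) by lra.
assert (HT3 : 0 < T ^ 3) by now apply pow_lt.
set (zt := fun N => sqrt (INR N) * (INR (X0 N) / INR N - INR (Y0 N) / INR N)) in *.
set (xs := fun N => INR (X0 N) / INR N) in *. set (ys := fun N => INR (Y0 N) / INR N) in *.
set (i := fun N => (/ scale N) ^ 8).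
assert (Hi : is_lim_seq i 0).
{ replace 0 with (0 ^ 8) by ring. apply is_lim_seq_pow_const, is_lim_seq_inv_scale. }
set (w := fun N => zt N * (T + i N) * / 2).
assert (Hw : is_lim_seq w (z0 * T / 2)).
{ replace (z0 * T / 2) with (z0 * (T + 0) * / 2) by field.
  apply is_lim_seq_mult'; [|apply is_lim_seq_const].
  apply is_lim_seq_mult'; [exact Hz|].
  apply is_lim_seq_plus'; [apply is_lim_seq_const|exact Hi]. }
assert (Hss : forall u, is_lim_seq u x0 ->
  is_lim_seq (fun N => u N * (u N + i N) * (2 * u N + i N) * / 6) (x0 ^ 3 / 3)).
{ intros u Hu. replace (x0 ^ 3 / 3) with (x0 * (x0 + 0) * (2 * x0 + 0) * / 6) by field.
  apply is_lim_seq_mult'; [|apply is_lim_seq_const].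
  apply is_lim_seq_mult'.
  - apply is_lim_seq_mult'; [exact Hu|]. now apply is_lim_seq_plus'.
  - apply is_lim_seq_plus'; [|exact Hi]. apply is_lim_seq_mult'; [apply is_lim_seq_const|exact Hu]. }
set (v := fun N => xs N * (xs N + i N) * (2 * xs N + i N) * / 6 +
  ys N * (ys N + i N) * (2 * ys N + i N) * / 6 + (/ scale N) ^ 2).
assert (Hv : is_lim_seq v (T ^ 3 / 12)).
{ replace (T ^ 3 / 12) with (x0 ^ 3 / 3 + x0 ^ 3 / 3 + 0 ^ 2) by (rewrite HT; field).
  apply is_lim_seq_plus'; [apply is_lim_seq_plus'; now apply Hss|].
  apply is_lim_seq_pow_const, is_lim_seq_inv_scale. }
set (sv := sqrt (T ^ 3 / 12)).
assert (Hsv0 : 0 < sv) by (apply sqrt_lt_R0; lra).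
assert (Hsv : is_lim_seq (fun N => sqrt (v N)) sv).
{ apply (is_lim_seq_continuous sqrt); [|exact Hv].
  apply continuity_pt_filterlim, continuous_sqrt. }
assert (Es : sqrt (T ^ 3 / 3) = 2 * sv).
{ unfold sv. replace (T ^ 3 / 3) with (2 ^ 2 * (T ^ 3 / 12)) by field.
  rewrite sqrt_mult by lra. rewrite sqrt_pow2 by lra. reflexivity. }
apply (is_lim_seq_ext_loc (fun N => Phi ((w N - sg ^ 2 / 2) / sqrt (v N)) +
   Phi ((- w N - sg ^ 2 / 2) / sqrt (v N)))).
- exists 1%nat. intros N HN.
  destruct (scale_powers N ltac:(lia)) as (Hm & E8 & _ & E4).
  assert (HNp : 0 < INR N) by (apply lt_0_INR; lia).
  set (m := scale N) in *.
  assert (Hm12 : 0 < m ^ 12) by now apply pow_lt.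
  assert (Ew : balance (X0 N) (Y0 N) = m ^ 12 * w N).
  { assert (Hs := INR_total T (X0 N) (Y0 N) N ltac:(lia) (Hsum N ltac:(lia))).
    rewrite plus_INR in Hs. fold m in Hs.
    unfold w, zt, i, balance. fold m. rewrite <- E4, <- E8.
    replace (INR (X0 N) * (INR (X0 N) + 1) - INR (Y0 N) * (INR (Y0 N) + 1)) with
      ((INR (X0 N) - INR (Y0 N)) * (INR (X0 N) + INR (Y0 N) + 1)) by ring.
    rewrite Hs. field. lra. }
  assert (Ev : bracket (X0 N) (Y0 N) + m ^ 22 = (m ^ 12) ^ 2 * v N).
  { unfold v, xs, ys, i, bracket, sum_squares. fold m. rewrite <- E8. field. lra. }
  unfold smooth_tail. rewrite Ev, Ew.
  rewrite sqrt_mult_alt by (apply pow_le; lra). rewrite sqrt_pow2 by lra.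
  assert (Ed : forall y, m ^ 12 * y / (m ^ 12 * sqrt (v N)) = y / sqrt (v N)).
  { intros y. assert (Hvp : 0 < v N).
    { apply Rmult_lt_reg_l with ((m ^ 12) ^ 2); [now apply pow_lt|].
      rewrite Rmult_0_r, <- Ev. unfold bracket.
      assert (A1 := sum_squares_ge0 (INR (X0 N)) (pos_INR _)).
      assert (A2 := sum_squares_ge0 (INR (Y0 N)) (pos_INR _)).
      assert (0 < m ^ 22) by now apply pow_lt. lra. }
    apply sqrt_lt_R0 in Hvp. field. lra. }
  rewrite <- (Ed (w N - sg ^ 2 / 2)), <- (Ed (- w N - sg ^ 2 / 2)).
  f_equal; f_equal; f_equal; field.
- unfold abs_normal_tail. rewrite Es.
  replace ((z0 * T - sg ^ 2) / (2 * sv)) with ((z0 * T / 2 - sg ^ 2 / 2) / sv) by (field; lra).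
  replace ((- (z0 * T) - sg ^ 2) / (2 * sv)) with ((- (z0 * T / 2) - sg ^ 2 / 2) / sv) by (field; lra).
  apply is_lim_seq_plus'; apply is_lim_seq_Phi.
  + apply is_lim_seq_div'; [|exact Hsv|lra].
    apply is_lim_seq_minus'; [exact Hw|apply is_lim_seq_const].
  + apply is_lim_seq_div'; [|exact Hsv|lra].
    apply is_lim_seq_minus'; [|apply is_lim_seq_const].
    apply (is_lim_seq_opp w (z0 * T / 2)). exact Hw.
Qed.

Lemma ruin_mean_edge_tail_lim (X0 Y0 : nat -> nat) (x0 T z0 sg : R) :
  0 < x0 -> T = x0 + x0 ->
  Un_cv (fun N => INR (X0 N) / INR N) x0 -> Un_cv (fun N => INR (Y0 N) / INR N) x0 ->
  (forall N : nat, (0 < N)%nat -> INR (X0 N) / INR N + INR (Y0 N) / INR N = T) ->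
  Un_cv (fun N => sqrt (INR N) * (INR (X0 N) / INR N - INR (Y0 N) / INR N)) z0 ->
  is_lim_seq (fun N => ruin_mean (X0 N) (Y0 N)
      (edge_tail (sg ^ 2 * scale N ^ 12 / 2) (scale N ^ 22)))
    (abs_normal_tail (z0 * T) (sqrt (T ^ 3 / 3)) (sg ^ 2)).
Proof.
intros Hx0 HT HX HY Hsum Hz.
destruct ruin_mean_edge_tail as (K & HK & H).
assert (HTp : 0 < T) by lra.
assert (Hlim := smooth_tail_start_lim X0 Y0 x0 T z0 sg Hx0 HT HX HY Hsum Hz).
set (u := fun N => smooth_tail _ _ _ _) in Hlim.
set (b := fun N => ruin_mean _ _ _).
(* The Lindeberg bound with [T m^8] jumps and [sqrt D = m^11]: each jump contributes the cube and
   the fourth power of [T m^(-3)]. *)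
set (e := fun N => T * K * (T ^ 3 * (/ scale N) ^ 1 + T ^ 4 * (/ scale N) ^ 4)).
assert (He : is_lim_seq e 0).
{ replace 0 with (T * K * (T ^ 3 * 0 ^ 1 + T ^ 4 * 0 ^ 4)) by ring.
  apply is_lim_seq_mult'; [apply is_lim_seq_const|].
  apply is_lim_seq_plus'; (apply is_lim_seq_mult';
    [apply is_lim_seq_const|apply is_lim_seq_pow_const, is_lim_seq_inv_scale]). }
assert (Hd : is_lim_seq (fun N => u N - b N) 0).
{ apply is_lim_seq_abs_0.
  apply (is_lim_seq_le_le_loc (fun _ => 0) _ e); [|apply is_lim_seq_const|exact He].
  exists 1%nat. intros N HN. split; [apply Rabs_pos|].
  destruct (scale_powers N ltac:(lia)) as (Hm & _).
  set (m := scale N) in *.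
  eapply Rle_trans; [apply H; now apply pow_lt|].
  rewrite (INR_total T _ _ N ltac:(lia) (Hsum N ltac:(lia))). fold m.
  replace (sqrt (m ^ 22)) with (m ^ 11).
  2: { replace (m ^ 22) with (m ^ 11 * m ^ 11) by ring. rewrite sqrt_square; [reflexivity|].
       apply pow_le; lra. }
  right. unfold e. fold m. field. lra. }
apply (is_lim_seq_ext (fun N => u N - (u N - b N))); [intros; ring|].
match goal with |- is_lim_seq _ (Finite ?l) => replace l with (l - 0) by ring end.
now apply is_lim_seq_minus'.
Qed.

Lemma cdf_S_ruin_mean T X Y N s : (0 < N)%nat ->
  cdf_S T N X Y s =
  ruin_mean X Y (fun r => gamma_ge (X + Y - r) (T * scale N ^ 8 - s * scale N ^ 6)).
Proof.
intros HN. unfold cdf_S. rewrite tau_ge_ruin_mean.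
destruct (scale_powers N HN) as (Hm & E8 & E2 & _). rewrite <- E2, <- E8.
replace (scale N ^ 8 * (T - s / scale N ^ 2)) with (T * scale N ^ 8 - s * scale N ^ 6); [reflexivity|].
field. lra.
Qed.

Theorem mainTheorem10
  (X0 Y0 : nat -> nat) (x0 y0 T z0 : R)
  (Hx0 : 0 < x0) (Hxy : x0 = y0) (HT : T = x0 + y0)
  (HX : Un_cv (fun N => INR (X0 N) / INR N) x0)
  (HY : Un_cv (fun N => INR (Y0 N) / INR N) y0)
  (Hsum : forall N : nat, (0 < N)%nat -> INR (X0 N) / INR N + INR (Y0 N) / INR N = T)
  (Hz : Un_cv (fun N => sqrt (INR N) * (INR (X0 N) / INR N - INR (Y0 N) / INR N)) z0) :
  exists F : R -> R,
    is_cdf F /\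
    F 0 = 0 /\
    (forall s, continuity_pt F s ->
       Un_cv (fun N => cdf_S T N (X0 N) (Y0 N) s) (F s)) /\
    moment_identity T z0 F /\
    (forall G : R -> R, is_cdf G -> (forall s, s < 0 -> G s = 0) ->
       moment_identity T z0 G -> forall s, G s = F s).
Proof.
subst y0.
assert (HTp : 0 < T) by lra.
assert (Hsd : 0 < sqrt (T ^ 3 / 3)).
{ apply sqrt_lt_R0. apply Rdiv_lt_0_compat; [now apply pow_lt|lra]. }
set (F := limit_cdf (z0 * T) (sqrt (T ^ 3 / 3))).
assert (HF : is_cdf F) by now apply limit_cdf_is_cdf.
exists F. split; [exact HF|]. split; [|split; [|split]].
- apply limit_cdf_neg; lra.
(* For a positive level [sg], the smoothed event that the survivors exceed [sg m^6] has probability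
   tending to [1 - F sg]. Levels slightly above and slightly below [s] then enclose the distribution
   function. *)
- assert (Hedge : forall sg eps, 0 < sg -> 0 < eps -> exists N0, forall N, (N0 <= N)%nat ->
    Rabs (ruin_mean (X0 N) (Y0 N) (edge_tail (sg ^ 2 * scale N ^ 12 / 2) (scale N ^ 22))
          - (1 - F sg)) < eps).
  { intros sg eps Hsg Heps.
    assert (L := ruin_mean_edge_tail_lim X0 Y0 x0 T z0 sg Hx0 HT HX HY Hsum Hz).
    apply is_lim_seq_spec in L. destruct (L (mkposreal eps Heps)) as [N0 HN0].
    exists N0. intros N HN. unfold F. rewrite limit_cdf_pos by lra.
    replace (1 - (1 - abs_normal_tail (z0 * T) (sqrt (T ^ 3 / 3)) (sg ^ 2)))
      with (abs_normal_tail (z0 * T) (sqrt (T ^ 3 / 3)) (sg ^ 2)) by ring.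
    now apply HN0. }
  intros s _ eps Heps.
  assert (Up : exists N0, forall N, (N0 <= N)%nat -> cdf_S T N (X0 N) (Y0 N) s < F s + eps).
  { assert (Es : F s = F (Rmax s 0)).
    { unfold F. destruct (Rle_dec 0 s); [now rewrite Rmax_left|].
      rewrite Rmax_right by lra. rewrite !limit_cdf_neg by lra. reflexivity. }
    destruct (limit_cdf_eps (z0 * T) (sqrt (T ^ 3 / 3)) (Rmax s 0) (eps / 3) Hsd) as (d & Hd & Kd); [lra|].
    (* A level above [s] that stays positive for negative [s]; nothing is lost, because [F] vanishes
       on the whole negative axis. *)
    set (sg := Rmax s 0 + d / 2).
    assert (L1 := Rmax_l s 0). assert (L2 := Rmax_r s 0).
    assert (Hc := Kd sg ltac:(unfold sg; rewrite Rabs_pos_eq; lra)). fold F in Hc.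
    destruct (clock_below_edge_tail T s sg (eps / 3) HTp) as (B & HB & K); [unfold sg; lra..|].
    destruct (scale_unbounded B) as [N1 HN1].
    destruct (Hedge sg (eps / 3)) as [N2 HN2]; [unfold sg; lra|lra|].
    exists (S (N1 + N2)). intros N HN.
    rewrite cdf_S_ruin_mean by lia.
    specialize (HN1 N ltac:(lia)). specialize (HN2 N ltac:(lia)).
    set (f := edge_tail (sg ^ 2 * scale N ^ 12 / 2) (scale N ^ 22)) in *.
    assert (H : ruin_mean (X0 N) (Y0 N)
        (fun r => gamma_ge (X0 N + Y0 N - r) (T * scale N ^ 8 - s * scale N ^ 6) + f r)
      <= ruin_mean (X0 N) (Y0 N) (fun _ => 1 + eps / 3)).
    { apply ruin_mean_le. intros r Hr.
      assert (H := K (scale N) (X0 N + Y0 N)%nat r HN1 Hr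
        (INR_total T _ _ N ltac:(lia) (Hsum N ltac:(lia)))). fold f in H. lra. }
    rewrite ruin_mean_plus, ruin_mean_const in H.
    apply Rabs_lt_between in Hc, HN2. change (ruin_mean (X0 N) (Y0 N) (fun r => f r))
      with (ruin_mean (X0 N) (Y0 N) f) in H. lra. }
  assert (Low : exists N0, forall N, (N0 <= N)%nat -> F s - eps < cdf_S T N (X0 N) (Y0 N) s).
  { destruct (Rle_lt_dec s 0) as [Hs|Hs].
    { exists 1%nat. intros N HN. unfold F. rewrite limit_cdf_neg, cdf_S_ruin_mean by (lra || lia).
      assert (H : ruin_mean (X0 N) (Y0 N) (fun _ => 0) <= ruin_mean (X0 N) (Y0 N)
        (fun r => gamma_ge (X0 N + Y0 N - r) (T * scale N ^ 8 - s * scale N ^ 6))).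
      { apply ruin_mean_le. intros r _. apply gamma_ge_bounds. }
      rewrite ruin_mean_const in H. lra. }
    destruct (limit_cdf_eps (z0 * T) (sqrt (T ^ 3 / 3)) s (eps / 3) Hsd) as (d & Hd & Kd); [lra|].
    (* A level below [s], within the modulus of continuity and still at least [s / 2], hence
       positive. *)
    set (sg := s - Rmin d s / 2).
    assert (L1 := Rmin_l d s). assert (L2 := Rmin_r d s).
    assert (L3 : 0 < Rmin d s) by now apply Rmin_glb_lt.
    assert (Hc := Kd sg ltac:(unfold sg; apply Rabs_lt_between; lra)). fold F in Hc.
    destruct (clock_above_edge_tail T s sg (eps / 3) HTp) as (B & HB & K); [unfold sg; lra..|].
    destruct (scale_unbounded B) as [N1 HN1].
    destruct (Hedge sg (eps / 3)) as [N2 HN2]; [unfold sg; lra|lra|].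
    exists (S (N1 + N2)). intros N HN.
    rewrite cdf_S_ruin_mean by lia.
    specialize (HN1 N ltac:(lia)). specialize (HN2 N ltac:(lia)).
    set (f := edge_tail (sg ^ 2 * scale N ^ 12 / 2) (scale N ^ 22)) in *.
    assert (H : ruin_mean (X0 N) (Y0 N) (fun _ => 1 - eps / 3) <= ruin_mean (X0 N) (Y0 N)
        (fun r => gamma_ge (X0 N + Y0 N - r) (T * scale N ^ 8 - s * scale N ^ 6) + f r)).
    { apply ruin_mean_le. intros r Hr.
      assert (H := K (scale N) (X0 N + Y0 N)%nat r HN1 Hr
        (INR_total T _ _ N ltac:(lia) (Hsum N ltac:(lia)))). fold f in H. lra. }
    rewrite ruin_mean_plus, ruin_mean_const in H.
    apply Rabs_lt_between in Hc, HN2. change (ruin_mean (X0 N) (Y0 N) (fun r => f r))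
      with (ruin_mean (X0 N) (Y0 N) f) in H. lra. }
  destruct Up as [N1 H1]. destruct Low as [N2 H2].
  exists (N1 + N2)%nat. intros N HN. unfold Rdist. apply Rabs_lt_between.
  specialize (H1 N ltac:(lia)). specialize (H2 N ltac:(lia)). lra.
- now apply limit_cdf_moment_identity.
- intros G HG G0 MG. now apply limit_cdf_unique.
Qed.
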